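(* Let $L$ be an algebraically closed field with $\mathrm{char}(L)=0$. Let $D$ be a smooth projective algebraic curve over $L$, and let $F\subset D\times P^m$ be an irreducible projective curve over $L$ (not assumed smooth) such that the projection $pr:F\to D$ is a finite surjective morphism. Then, if $(ab)\in F$ is a non-singular point of $F$ (lying over $a\in D$), $$Mult_{(ab)}(F/D)=mult^{alg}_{(ab)}(F/D),$$ that is, Zariski multiplicity and algebraic multiplicity coincide. In particular, the cover $F/D$ is Zariski unramified at $(ab)$ if and only if there exists an open $U\subset F$, containing $(ab)$, such that $pr:U\to D$ is etale.
   Context: All curves are over the algebraically closed field $L$; points are $L$-points unless stated otherwise. Zariski multiplicity: let $K\supsetneq L$ be an algebraically closed field with a nontrivial valuation, trivial on $L$, whose residue field is $L$ (a ''nonstandard model'' of $L$; e.g. an algebraic closure of $L((\epsilon))$), and let $P^n(K)\to P^n(L)$ be the associated specialisation (reduction) maps. For a point $x$ of a projective variety over $L$, ${\mathcal V}_x$ denotes the infinitesimal neighbourhood of $x$, i.e. the set of $K$-points of the ambient projective space specialising to $x$. For $(ab)\in F$ with $a\in D$, choose $a'\in D(K)\cap {\mathcal V}_a$ generic in $D$ over $L$ (i.e. $a'\notin D(L)$). Then $$Mult_{(ab)}(F/D)=\mathrm{Card}\{b'\in{\mathcal V}_b : (a',b')\in F(K)\},$$ which does not depend on the choice of $a'$. The cover is Zariski unramified at $(ab)$ if $Mult_{(ab)}(F/D)=1$. Algebraic multiplicity: $mult^{alg}_{(ab)}(F/D)$ is the length of ${\mathcal O}_{(ab),F}/m_a{\mathcal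 O}_{(ab),F}$, where $m_a$ is the maximal ideal of ${\mathcal O}_{a,D}$; at a non-singular point $(ab)$ of $F$ it equals $ord_{(ab)}(pr^*x)$ for $x$ a local uniformiser of $D$ at $a$. *)

(* Defs.v *)
(* Classical (Serre-style) algebraic geometry over a field L: a variety is its
   set of L-points together with a graded algebra of "forms", i.e. functions
   whose zero sets are the closed sets and whose degree-0 quotients are the
   regular functions. *)
From HB Require Import structures.
From mathcomp Require Import all_boot all_algebra.
From mathcomp Require Import boolp classical_sets functions cardinality.
From mathcomp Require Import mpoly.

Set Implicit Arguments.
Unset Strict Implicit.
Unset Printing Implicit Defensive.

Import GRing.Theory.
Local Open Scope classical_set_scope.
Local Open Scope ring_scope.

(* A homogeneous polynomial is not a function on projective space, so a form is
   a function only after homogeneous coordinates have been chosen for each point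
   (see [coord]); neither its zero set nor a quotient of two forms of the same
   degree depends on that choice. *)
Record funSpace (L : fieldType) := FunSpace {
  pt :> Type;
  deg : nmodType;
  form : deg -> set (pt -> L);
  formC : forall c : L, form 0 (cst c);
  formD : forall d f g, form d f -> form d g -> form d (f + g);
  formM : forall d e f g, form d f -> form e g -> form (d + e) (f * g)
}.

Section Topology.
Variables (L : fieldType) (X : funSpace L).

Definition zclosed (C : set X) : Prop :=
  exists E : set (X -> L),
    (forall f, E f -> exists d, form d f) /\
    C = [set x | forall f, E f -> f x = 0].

Definition zopen (U : set X) : Prop := zclosed (~` U).

Definition irreducible_set (C : set X) : Prop :=
  C !=set0 /\
  forall C1 C2, zclosed C1 -> zclosed C2 ->
    C `<=` C1 `|` C2 -> C `<=` C1 \/ C `<=` C2.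

Definition regular_at (phi : X -> L) (x : X) : Prop :=
  exists U, [/\ zopen U, U x &
    exists d f g, [/\ form d f, form d g &
      forall y, U y -> g y != 0 /\ phi y = f y / g y]].

Definition regular_on (V : set X) (phi : X -> L) : Prop :=
  forall x, V x -> regular_at phi x.

Lemma zclosedU C1 C2 : zclosed C1 -> zclosed C2 -> zclosed (C1 `|` C2).
Proof.
move=> [E1 [h1 ->]] [E2 [h2 ->]].
exists [set f * g | f in E1 & g in E2]; split.
  move=> _ [f Ef [g Eg <-]]; have [d fd] := h1 _ Ef; have [e ge] := h2 _ Eg.
  by exists (d + e); apply: formM.
apply/seteqP; split=> [x [H|H] _ [f Ef [g Eg <-]]|x /= H].
- by rewrite /GRing.mul /= H // mul0r.
- by rewrite /GRing.mul /= [g x]H // mulr0.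
- have [E1x|/existsNP [f /not_implyP [Ef /eqP fx]]] :=
      pselect (forall f, E1 f -> f x = 0); first by left.
  right=> g Eg; have : (f * g) x = 0 by apply: H; exists f => //; exists g.
  by move/eqP; rewrite mulf_eq0 (negPf fx) => /eqP.
Qed.

Lemma zopenT : zopen setT.
Proof.
exists [set cst 1]; split=> [_ ->|]; first by exists 0; apply: formC.
rewrite setCT; apply/seteqP; split=> // x /= /(_ _ erefl)/eqP.
by rewrite oner_eq0.
Qed.

Lemma zopenI U V : zopen U -> zopen V -> zopen (U `&` V).
Proof. by rewrite /zopen setCI; apply: zclosedU. Qed.

Lemma regular_cst c x : regular_at (cst c) x.
Proof.
exists setT; split=> //; first exact: zopenT.
exists 0, (cst c), (cst 1); split; try exact: formC.
by move=> y _; rewrite oner_neq0 divr1.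
Qed.

Lemma regularD phi psi x :
  regular_at phi x -> regular_at psi x -> regular_at (phi + psi) x.
Proof.
move=> [U [oU Ux [d [f [g [fd gd H]]]]]] [V [oV Vx [e [f' [g' [fe ge H']]]]]].
exists (U `&` V); split=> //; first exact: zopenI.
exists (d + e), (f * g' + g * f'), (g * g'); split.
- by apply: formD; apply: formM.
- exact: formM.
- move=> y [/H [g0 e1] /H' [g0' e2]].
  have -> : (phi + psi) y = phi y + psi y by [].
  have -> : (g * g') y = g y * g' y by [].
  have -> : (f * g' + g * f') y = f y * g' y + g y * f' y by [].
  split; first by rewrite mulf_neq0.
  by rewrite e1 e2 addf_div // [f' y * _]mulrC.
Qed.

Lemma regularM phi psi x :
  regular_at phi x -> regular_at psi x -> regular_at (phi * psi) x.
Proof.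
move=> [U [oU Ux [d [f [g [fd gd H]]]]]] [V [oV Vx [e [f' [g' [fe ge H']]]]]].
exists (U `&` V); split=> //; first exact: zopenI.
exists (d + e), (f * f'), (g * g'); split; try exact: formM.
move=> y [/H [g0 e1] /H' [g0' e2]].
have -> : (phi * psi) y = phi y * psi y by [].
have -> : (g * g') y = g y * g' y by [].
have -> : (f * f') y = f y * f' y by [].
by split; [rewrite mulf_neq0 | rewrite e1 e2 mulf_div].
Qed.

End Topology.

Section Subspace.
Variables (L : fieldType) (X : funSpace L) (V : set X).

Definition subform (d : deg X) : set (V -> L) :=
  [set f \o val | f in form d].

Lemma subformC c : subform 0 (cst c).
Proof. by exists (cst c) => //; apply: formC. Qed.

Lemma subformD d f g : subform d f -> subform d g -> subform d (f + g).
Proof. by move=> [f' ? <-] [g' ? <-]; exists (f' + g') => //; apply: formD. Qed.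

Lemma subformM d e f g : subform d f -> subform e g -> subform (d + e) (f * g).
Proof. by move=> [f' ? <-] [g' ? <-]; exists (f' * g') => //; apply: formM. Qed.

Definition subspace : funSpace L := FunSpace subformC subformD subformM.

End Subspace.

Section Morphism.
Variables (L : fieldType) (X Y : funSpace L).

Definition morphism (f : X -> Y) : Prop :=
  (forall C, zclosed C -> zclosed (f @^-1` C)) /\
  (forall x phi, regular_at phi (f x) -> regular_at (phi \o f) x).

Lemma morphism_forms (f : X -> Y) (delta : deg Y -> deg X) :
  (forall d h, form d h -> form (delta d) (h \o f)) -> morphism f.
Proof.
move=> H.
have Hc C : zclosed C -> zclosed (f @^-1` C).
  move=> [E [hE ->]]; exists [set h \o f | h in E]; split.
    by move=> _ [h Eh <-]; have [d hd] := hE _ Eh; exists (delta d); apply: H.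
  apply/seteqP; split=> [x /= hx _ [h Eh <-]|x /= hx h Eh]; first exact: hx.
  by apply: (hx (h \o f)); exists h.
split=> // x phi [U [oU Ux [d [h [g [hd gd K]]]]]].
exists (f @^-1` U); split=> //; first exact: (Hc (~` U)).
exists (delta d), (h \o f), (g \o f); split; try exact: H.
by move=> y /K.
Qed.

End Morphism.

Definition isomorphism (L : fieldType) (X Y : funSpace L) (f : X -> Y) : Prop :=
  morphism f /\
  exists g : Y -> X, [/\ cancel f g, cancel g f & morphism g].

(* Some chain J 0 < ... < J n of members of P has n strict inclusions, and no
   chain has n + 1 of them. *)
Definition max_chain_length (T : Type) (P : set (set T)) (n : nat) : Prop :=
  let chain k := exists J : nat -> set T,
    (forall i, (i <= k)%N -> P (J i)) /\
    (forall i, (i < k)%N -> J i `<` J i.+1) in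
  chain n /\ ~ chain n.+1.

Definition dimension (L : fieldType) (X : funSpace L) (d : nat) : Prop :=
  max_chain_length [set C : set X | zclosed C /\ irreducible_set C] d.

Definition curve (L : fieldType) (X : funSpace L) : Prop :=
  irreducible_set [set: X] /\ dimension X 1.

Section Ideals.
Variable R : comNzRingType.

Definition is_ideal (I : set R) : Prop :=
  [/\ I 0, forall a b, I a -> I b -> I (a + b) & forall a b, I b -> I (a * b)].

Definition ideal_gen (S : set R) : set R := smallest is_ideal S.

(* The submodules of R / I are the J / I, for J an ideal containing I. *)
Definition quotient_length (I : set R) (n : nat) : Prop :=
  max_chain_length [set J | is_ideal J /\ I `<=` J] n.

(* For R local with maximal ideal m: the t i induce a basis of m / m^2 over
   R / m. *)
Definition cotangent_dim (m : set R) (d : nat) : Prop :=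
  let m2 := ideal_gen [set a * b | a in m & b in m] in
  exists t : 'I_d -> R,
    [/\ forall i, m (t i),
        forall f, m f -> exists c : 'I_d -> R, m2 (f - \sum_i c i * t i) &
        forall c : 'I_d -> R, m2 (\sum_i c i * t i) -> forall i, m (c i)].

End Ideals.

Section Flat.
Variables (A B : comNzRingType) (phi : A -> B).

(* N (x)_A B is the quotient of the free commutative monoid on N * B, here the
   lists up to permutation, by the congruence below. *)
Inductive tensor_eq (N : lmodType A) : seq (N * B) -> seq (N * B) -> Prop :=
| te_refl s : tensor_eq s s
| te_sym s t : tensor_eq s t -> tensor_eq t s
| te_trans s t u : tensor_eq s t -> tensor_eq t u -> tensor_eq s u
| te_cat s s' t t' :
    tensor_eq s s' -> tensor_eq t t' -> tensor_eq (s ++ t) (s' ++ t')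
| te_comm s t : tensor_eq (s ++ t) (t ++ s)
| te_addl n n' b : tensor_eq [:: (n + n', b)] [:: (n, b); (n', b)]
| te_addr n b b' : tensor_eq [:: (n, b + b')] [:: (n, b); (n, b')]
| te_zero b : tensor_eq [:: (0, b)] [::]
| te_scale a n b : tensor_eq [:: (a *: n, b)] [:: (n, phi a * b)].

Definition flat : Prop :=
  forall (N' N : lmodType A) (u : {linear N' -> N}), injective u ->
  forall s t : seq (N' * B),
    tensor_eq [seq (u p.1, p.2) | p <- s] [seq (u p.1, p.2) | p <- t] ->
    tensor_eq s t.

End Flat.

Section LocalRing.
Variables (L : fieldType) (X : funSpace L) (x : X).

Definition regular_pred : {pred X -> L} := fun phi => `[< regular_at phi x >].

Lemma regular_subring : subring_closed regular_pred.
Proof.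
split=> [|f g /asboolP hf /asboolP hg|f g /asboolP hf /asboolP hg]; apply/asboolP.
- exact: regular_cst.
- apply: regularD => //.
  have -> : - g = cst (-1) * g.
    by apply/funext => y; rewrite /GRing.mul /= mulN1r.
  by apply: regularM => //; apply: regular_cst.
- exact: regularM.
Qed.

HB.instance Definition _ :=
  GRing.isSubringClosed.Build (X -> L) regular_pred regular_subring.

Record regular_fun := RegularFun {
  regval :> X -> L;
  regvalP : regval \in regular_pred
}.

HB.instance Definition _ := [isSub for regval].
HB.instance Definition _ := [Choice of regular_fun by <:].
HB.instance Definition _ :=
  GRing.SubChoice_isSubComPzRing.Build _ _ regular_fun
    (GRing.subringClosedP _).

Lemma regular_fun1_neq0 : (1 : regular_fun) != 0.
Proof.
apply/eqP => /(congr1 regval) /(congr1 (fun f : X -> L => f x)).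
by move/eqP; rewrite oner_eq0.
Qed.

HB.instance Definition _ :=
  GRing.PzSemiRing_isNonZero.Build regular_fun regular_fun1_neq0.

Definition zero_germ : {pred regular_fun} :=
  fun phi => `[< exists U, [/\ zopen U, U x & forall y, U y -> phi y = 0] >].

Lemma zero_germ_ideal : idealr_closed zero_germ.
Proof.
split.
- apply/asboolP; exists setT; split=> //; exact: zopenT.
- apply/asboolP => -[U [_ Ux /(_ _ Ux)/eqP]]; by rewrite oner_eq0.
- move=> a u v /asboolP [U [oU Ux hu]] /asboolP [V [oV Vx hv]].
  apply/asboolP; exists (U `&` V); split=> //; first exact: zopenI.
  move=> y [Uy Vy]; have -> : (a * u + v) y = a y * u y + v y by [].
  by rewrite hu // hv // mulr0 add0r.
Qed.

HB.instance Definition _ :=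
  isIdealr.Build regular_fun zero_germ zero_germ_ideal.

Definition stalk : comNzRingType := {ideal_quot zero_germ}.

Definition germ (phi : regular_fun) : stalk := \pi_({ideal_quot zero_germ})%qT phi.

Definition max_ideal : set stalk :=
  [set s | exists2 phi : regular_fun, s = germ phi & phi x = 0].

Definition nonsingular : Prop :=
  exists2 d, dimension X d & cotangent_dim max_ideal d.

End LocalRing.

Section StalkMap.
Variables (L : fieldType) (X Y : funSpace L) (f : X -> Y) (hf : morphism f).
Variable x : X.

Lemma pullback_subproof (phi : regular_fun (f x)) :
  (phi \o f) \in regular_pred x.
Proof. by apply/asboolP; apply: hf.2; apply/asboolP; apply: regvalP. Qed.

Definition pullback (phi : regular_fun (f x)) : regular_fun x :=
  RegularFun (pullback_subproof phi).

Definition stalk_map (s : stalk (f x)) : stalk x := germ (pullback (repr s)).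

Lemma stalk_map_germ phi : stalk_map (germ phi) = germ (pullback phi).
Proof.
apply/eqP; rewrite /stalk_map /germ -Quotient.idealrBE; apply/asboolP.
have /asboolP [U [oU Ux H]] : repr (germ phi) - phi \in @zero_germ L Y (f x).
  by rewrite Quotient.idealrBE reprK.
by exists (f @^-1` U); split=> //; [exact: (hf.1 _ oU) | move=> y /H].
Qed.

Lemma germ_repr (s : stalk (f x)) : s = germ (repr s).
Proof. by rewrite /germ reprK. Qed.

Lemma stalk_map_zmod : zmod_morphism stalk_map.
Proof.
move=> s t; rewrite [s]germ_repr [t]germ_repr -[in LHS]rmorphB !stalk_map_germ.
by rewrite -rmorphB; congr germ; apply: val_inj.
Qed.

Lemma stalk_map_monoid : monoid_morphism stalk_map.
Proof.
split=> [|s t].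
  rewrite -[1 in LHS](rmorph1 (@germ _ Y (f x))) stalk_map_germ.
  by rewrite -(rmorph1 (@germ _ X x)); congr germ; apply: val_inj.
rewrite [s]germ_repr [t]germ_repr -[in LHS]rmorphM !stalk_map_germ.
by rewrite -rmorphM; congr germ; apply: val_inj.
Qed.

HB.instance Definition _ :=
  GRing.isZmodMorphism.Build (stalk (f x)) (stalk x) stalk_map stalk_map_zmod.
HB.instance Definition _ :=
  GRing.isMonoidMorphism.Build (stalk (f x)) (stalk x) stalk_map
    stalk_map_monoid.

(* m_{f x} O_x *)
Definition fibre_ideal : set (stalk x) :=
  ideal_gen (stalk_map @` @max_ideal L Y (f x)).

Definition alg_mult (e : nat) : Prop := quotient_length fibre_ideal e.

(* All residue fields are L, so that only m_{f x} O_x = m_x remains of the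
   condition of being unramified. *)
Definition etale_at : Prop := flat stalk_map /\ fibre_ideal = @max_ideal L X x.

End StalkMap.

Section Affine.
Variables (L : fieldType) (N : nat).

Definition poly_form (d : nat) : set ('rV[L]_N -> L) :=
  [set (fun v : 'rV[L]_N => p.@[v ord0]) | p in [set: {mpoly L[N]}]].

Lemma poly_formC c : poly_form 0 (cst c).
Proof. by exists c%:MP => //; apply/funext => v; rewrite mevalC. Qed.

Lemma poly_formD d f g : poly_form d f -> poly_form d g -> poly_form d (f + g).
Proof.
by move=> [p _ <-] [q _ <-]; exists (p + q) => //; apply/funext => v; rewrite mevalD.
Qed.

Lemma poly_formM d e f g :
  poly_form d f -> poly_form e g -> poly_form (d + e) (f * g).
Proof.
by move=> [p _ <-] [q _ <-]; exists (p * q) => //; apply/funext => v; rewrite mevalM.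
Qed.

(* In affine space no homogeneity is required: all polynomials are forms, in
   every degree. *)
Definition affine_space : funSpace L := FunSpace poly_formC poly_formD poly_formM.

End Affine.

Definition affine (L : fieldType) (X : funSpace L) : Prop :=
  exists (N : nat) (W : set (affine_space L N)) (h : X -> subspace W),
    zclosed W /\ isomorphism h.

Definition finite_morphism (L : fieldType) (X Y : funSpace L) (f : X -> Y) : Prop :=
  morphism f /\
  forall y : Y, exists V : set Y,
    [/\ zopen V, V y, affine (subspace V), affine (subspace (f @^-1` V)) &
      (* O(f^-1 V) is a finitely generated O(V)-module *)
      exists (k : nat) (e : 'I_k -> X -> L),
        (forall i, regular_on (f @^-1` V) (e i)) /\
        forall phi, regular_on (f @^-1` V) phi ->
          exists c : 'I_k -> Y -> L,
            (forall i, regular_on V (c i)) /\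
            forall x, V (f x) -> phi x = \sum_i c i (f x) * e i x].

Record proj (R : fieldType) (n : nat) := Proj {
  line :> {vspace 'rV[R]_n.+1};
  _ : \dim line == 1%N
}.

(* A choice of homogeneous coordinates. *)
Definition coord (R : fieldType) n (p : proj R n) : 'I_n.+1 -> R := vpick p ord0.

Definition coord2 (R : fieldType) n m (x : proj R n * proj R m) :
    'I_(n.+1 + m.+1) -> R :=
  row_mx (vpick x.1) (vpick x.2) ord0.

Section Projective.
Variables (R : fieldType) (n : nat).

Definition proj_form (d : nat) : set (proj R n -> R) :=
  [set (fun x => p.@[coord x]) | p in [set p : {mpoly R[n.+1]} | p \is d.-homog]].

Lemma proj_formC c : proj_form 0 (cst c).
Proof.
exists c%:MP; last by apply/funext => x; rewrite mevalC.
by rewrite /= -[c%:MP]mulr1 mul_mpolyC dhomogZ // dhomog1.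
Qed.

Lemma proj_formD d f g : proj_form d f -> proj_form d g -> proj_form d (f + g).
Proof.
move=> [p hp <-] [q hq <-]; exists (p + q); first exact: dhomogD.
by apply/funext => v; rewrite mevalD.
Qed.

Lemma proj_formM d e f g :
  proj_form d f -> proj_form e g -> proj_form (d + e) (f * g).
Proof.
move=> [p hp <-] [q hq <-]; exists (p * q); first exact: dhomogM.
by apply/funext => v; rewrite mevalM.
Qed.

Definition proj_space : funSpace R := FunSpace proj_formC proj_formD proj_formM.

End Projective.

Section Bihomogeneous.
Variables n m : nat.

Definition mdegl (u : 'X_{1.. n.+1 + m.+1}) : nat :=
  (\sum_(i < n.+1) u (lshift m.+1 i))%N.
Definition mdegr (u : 'X_{1.. n.+1 + m.+1}) : nat :=
  (\sum_(j < m.+1) u (rshift n.+1 j))%N.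

Lemma mdegl0 : mdegl 0%MM = 0%N.
Proof. by rewrite /mdegl big1 // => i _; rewrite mnmE. Qed.
Lemma mdegr0 : mdegr 0%MM = 0%N.
Proof. by rewrite /mdegr big1 // => i _; rewrite mnmE. Qed.
Lemma mdeglD : {morph mdegl : u v / (u + v)%MM >-> (u + v)%N}.
Proof. by move=> u v; rewrite /mdegl -big_split; apply: eq_bigr => i _; rewrite mnmE. Qed.
Lemma mdegrD : {morph mdegr : u v / (u + v)%MM >-> (u + v)%N}.
Proof. by move=> u v; rewrite /mdegr -big_split; apply: eq_bigr => i _; rewrite mnmE. Qed.

HB.instance Definition _ := isMeasure.Build (n.+1 + m.+1) mdegl mdegl0 mdeglD.
HB.instance Definition _ := isMeasure.Build (n.+1 + m.+1) mdegr mdegr0 mdegrD.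

Definition bihomog (R : fieldType) (d : nat * nat) :
    set {mpoly R[n.+1 + m.+1]} :=
  [set p | p \is d.1.-homog for mdegl /\ p \is d.2.-homog for mdegr].

End Bihomogeneous.

Section Biprojective.
Variables (R : fieldType) (n m : nat).

Definition biproj_form (d : nat * nat) : set (proj R n * proj R m -> R) :=
  [set (fun x => p.@[coord2 x]) | p in @bihomog n m R d].

Lemma biproj_formC c : biproj_form 0 (cst c).
Proof.
exists c%:MP; last by apply/funext => x; rewrite mevalC.
by split; rewrite /= -[c%:MP]mulr1 mul_mpolyC dhomogZ // dhomog1.
Qed.

Lemma biproj_formD d f g :
  biproj_form d f -> biproj_form d g -> biproj_form d (f + g).
Proof.
move=> [p [hp hp'] <-] [q [hq hq'] <-]; exists (p + q); first by split; exact: dhomogD.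
by apply/funext => v; rewrite mevalD.
Qed.

Lemma biproj_formM d e f g :
  biproj_form d f -> biproj_form e g -> biproj_form (d + e) (f * g).
Proof.
move=> [p [hp hp'] <-] [q [hq hq'] <-]; exists (p * q); first by split; exact: dhomogM.
by apply/funext => v; rewrite mevalM.
Qed.

Definition biproj_space : funSpace R :=
  FunSpace biproj_formC biproj_formD biproj_formM.

End Biprojective.

Section Projection.
Variables (L : fieldType) (n m : nat).
Variables (D : set (proj_space L n)) (F : set (biproj_space L n m)).
Hypothesis FD : F `<=` [set x | D x.1].

Lemma pr_subproof (x : subspace F) : (val x).1 \in D.
Proof. by apply/mem_set/FD/set_mem/valP. Qed.

Definition pr (x : subspace F) : subspace D := SigSub (pr_subproof x).

Lemma pr_morphism : morphism pr.
Proof.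
apply: (@morphism_forms L (subspace F) (subspace D) pr
  (fun d : nat => (d, 0%N) : nat * nat)) => d _ [_ [p hp <-] <-].
pose w (u : 'X_{1..n.+1}) : 'X_{1..n.+1 + m.+1} :=
  [multinom (if fintype.split i is inl j then u j else 0)%N | i < n.+1 + m.+1].
have wl u j : w u (lshift m.+1 j) = u j.
  by rewrite mnmE (unsplitK (inl j)).
have wr u j : w u (rshift n.+1 j) = 0%N.
  by rewrite mnmE (unsplitK (inr j)).
pose q : {mpoly L[n.+1 + m.+1]} := \sum_(u <- msupp p) p@_u *: 'X_[w u].
exists (fun x => q.@[coord2 x]).
  exists q => //; split; rewrite /q big_seq; apply: rpred_sum => u up;
    apply: dhomogZ; rewrite dhomogX.
    have <- : mdeg u = d by apply: (dhomogP _ _ _ hp).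
    rewrite /= /mdegl mdegE.
    by apply/eqP/eq_bigr => i _; rewrite wl.
  by rewrite /= /mdegr big1 // => i _; rewrite wr.
apply/funext => x /=; rewrite /q raddf_sum /= mevalE; apply: eq_bigr => u _.
rewrite mevalZ mevalX; congr (_ * _); rewrite big_split_ord /=.
rewrite [X in _ * X]big1 ?mulr1 => [|i _]; last by rewrite wr.
by apply: eq_bigr => i _; rewrite wl /coord2 row_mxEl.
Qed.

End Projection.

(* A valuation in additive notation, with arbitrary value group; its value at 0,
   which should be infinite, is left unspecified. *)
Record valuation (K : fieldType) := Valuation {
  vgroup : zmodType;
  vle : rel vgroup;
  vle_refl : reflexive vle;
  vle_anti : antisymmetric vle;
  vle_trans : transitive vle;
  vle_total : total vle;
  vle_add : forall g a b, vle a b -> vle (g + a) (g + b);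
  vval :> K -> vgroup;
  vvalM : forall x y, x != 0 -> y != 0 -> vval (x * y) = vval x + vval y;
  vvalD : forall x y g, x != 0 -> y != 0 -> x + y != 0 ->
    vle g (vval x) -> vle g (vval y) -> vle g (vval (x + y))
}.

Section Specialisation.
Variables (L K : fieldType) (iota : {rmorphism L -> K}) (v : valuation K).

Definition integral (z : K) : Prop := z = 0 \/ vle 0 (v z).

Definition infinitesimal (z : K) : Prop :=
  z = 0 \/ (vle 0 (v z) /\ v z <> 0).

Record nonstandard_extension : Prop := NonstandardExtension {
  ns_proper : exists z : K, forall c : L, z <> iota c;
  ns_nontrivial : exists2 z : K, z != 0 & v z <> 0;
  ns_trivial_base : forall c : L, c != 0 -> v (iota c) = 0;
  ns_residue : forall z, integral z -> exists c : L, infinitesimal (z - iota c)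
}.

(* p' has primitive homogeneous coordinates whose residues are homogeneous
   coordinates of p. *)
Definition specializes n (p' : proj K n) (p : proj L n) : Prop :=
  exists (x : 'rV[K]_n.+1) (y : 'rV[L]_n.+1),
    [/\ x \in line p', y \in line p, y != 0 &
        forall i, infinitesimal (x ord0 i - iota (y ord0 i))].

(* p' is p, seen as a K-point. *)
Definition is_constant n (p' : proj K n) (p : proj L n) : Prop :=
  map_mx iota (vpick p) \in line p'.

(* D(K) and F(K): the common zeros over K of the forms over L that vanish on D,
   respectively F. *)
Definition Kpoints n (D : set (proj L n)) : set (proj K n) :=
  [set p' | forall d (f : {mpoly L[n.+1]}), f \is d.-homog ->
     (forall p, D p -> f.@[coord p] = 0) ->
     (map_mpoly iota f).@[coord p'] = 0].

Definition Kpoints2 n m (F : set (proj L n * proj L m)) :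
    set (proj K n * proj K m) :=
  [set x' | forall d (f : {mpoly L[n.+1 + m.+1]}), bihomog d f ->
     (forall x, F x -> f.@[coord2 x] = 0) ->
     (map_mpoly iota f).@[coord2 x'] = 0].

(* a' is in D(K) and in the infinitesimal neighbourhood of a, and is generic
   in D over L. *)
Definition generic_near n (D : set (proj L n)) (a : proj L n) (a' : proj K n) :
    Prop :=
  [/\ Kpoints D a', specializes a' a & ~ exists2 p, D p & is_constant a' p].

Definition zariski_mult n m (F : set (proj L n * proj L m))
    (ab : proj L n * proj L m) (a' : proj K n) (e : nat) : Prop :=
  ([set b' : proj K m | specializes b' ab.2 /\ Kpoints2 F (a', b')]
     #= `I_e)%card.

Definition zariski_unramified n m (F : set (proj L n * proj L m))
    (ab : proj L n * proj L m) (a' : proj K n) : Prop :=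
  zariski_mult F ab a' 1.

End Specialisation.

(* Main.v *)
From HB Require Import structures.
Require Import Defs.
From mathcomp Require Import all_boot all_algebra.
From mathcomp Require Import boolp classical_sets functions cardinality.
From mathcomp Require Import mpoly.
From mathcomp Require Import zify ring.

(** Let A and B be the local rings of D at a and of F at (ab). They are discrete
    valuation rings: their elements are fractions of polynomials in affine
    coordinates, so they are noetherian by Hilbert's basis theorem
    ([noeth_mpoly]), and nonsingularity on a curve means that the maximal ideal
    is principal ([nonsingular_uniformizer]). If t is a uniformizer of A and th
    one of B, then t = u th^e in B with u a unit. The ideals of B that contain
    t are the powers of th up to e, so e is the algebraic multiplicity
    ([quotient_length_uniformizer]).

    A point over K that specialises to a is the same as a homomorphism from A to
    K that reduces to the evaluation at a, and likewise for F ([kpoint_hom],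
    [hom_kpoint]). For a generic point a' this homomorphism is injective, since t
    cannot vanish at a nonconstant point near a ([generic_hom]). The Zariski
    multiplicity is therefore the number of extensions to B of a given injective
    homomorphism from A to K ([local_multiplicity]).

    To count them, th is chosen so that every element of B is a fraction of
    polynomials in th over A ([fin_span_generator]). This is where finiteness of
    the projection enters: B is a ring of fractions of a finite A-algebra, and
    the fibre over a decomposes, so th can be taken to be a uniformizer at (ab)
    and a nonzero function at the other points of the fibre. An extension is
    then determined by the image of th, which must be an infinitesimal root of
    the image Q' over K of the minimal relation Q of th over A. In characteristic
    zero the roots of Q' are simple. Since K is algebraically closed, the number
    of infinitesimal roots of a polynomial is the order at 0 of its reduction
    ([infinitesimal_roots]), and the equation t = u th^e identifies this order
    with e ([count_extensions]).

    For the last assertion, e = 1 means that the maximal ideal of a generates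
    that of (ab). A Jacobian determinant shows that this condition is open
    ([fibre_ideal_open]). Flatness holds at every point of F, because the local
    rings of F are torsion-free over the discrete valuation rings of D
    ([torsion_free_flat]). *)

Set Implicit Arguments.
Unset Strict Implicit.
Unset Printing Implicit Defensive.

Import GRing.Theory Defs.
Local Open Scope classical_set_scope.
Local Open Scope ring_scope.

(** * Values infinitely close to a constant *)

Section Valuation.
Variables (K : fieldType) (v : valuation K).

Lemma vval1 : v 1 = 0.
Proof.
have := @vvalM _ v 1 1 (oner_neq0 _) (oner_neq0 _).
by rewrite mulr1 => /eqP; rewrite -[X in X == _]addr0 (inj_eq (addrI _)) eq_sym => /eqP.
Qed.

(** A totally ordered group is torsion-free, and twice the value of -1 is the
    value of 1. *)
Lemma vval_opp1 : v (-1) = 0.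
Proof.
have N0 : -1 != 0 :> K by rewrite oppr_eq0 oner_neq0.
have h : v (-1) + v (-1) = 0 by rewrite -vvalM // mulrNN mulr1 vval1.
apply: (@vle_anti _ v); case/orP: (@vle_total _ v 0 (v (-1))) => le.
  by rewrite le andbT; have := @vle_add _ v (v (-1)) _ _ le; rewrite addr0 h.
by rewrite le /=; have := @vle_add _ v (v (-1)) _ _ le; rewrite addr0 h.
Qed.

Lemma vvalN x : x != 0 -> v (- x) = v x.
Proof.
by move=> x0; rewrite -mulN1r vvalM ?vval_opp1 ?add0r // oppr_eq0 oner_neq0.
Qed.

Lemma vvalV x : x != 0 -> v x^-1 = - v x.
Proof.
move=> x0; apply/eqP; rewrite -addr_eq0 -vvalM ?invr_eq0 //.
by rewrite mulVf // vval1.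
Qed.

Lemma vint0 : integral v 0. Proof. by left. Qed.

Lemma vint1 : integral v 1.
Proof. by right; rewrite vval1 vle_refl. Qed.

Lemma infinitesimalW x : infinitesimal v x -> integral v x.
Proof. by case=> [->|[]]; [left|right]. Qed.

Lemma vintD x y : integral v x -> integral v y -> integral v (x + y).
Proof.
have [->|x0] := eqVneq x 0; first by rewrite add0r.
have [->|y0] := eqVneq y 0; first by rewrite addr0.
have [->|s0] := eqVneq (x + y) 0; first by left.
case=> [/eqP|hx]; first by rewrite (negPf x0).
case=> [/eqP|hy]; first by rewrite (negPf y0).
by right; apply: vvalD.
Qed.

Lemma vintM x y : integral v x -> integral v y -> integral v (x * y).
Proof.
have [->|x0] := eqVneq x 0; first by rewrite mul0r.
have [->|y0] := eqVneq y 0; first by rewrite mulr0.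
case=> [/eqP|hx]; first by rewrite (negPf x0).
case=> [/eqP|hy]; first by rewrite (negPf y0).
right; rewrite vvalM //; apply: (vle_trans hx).
by rewrite -[X in vle X]addr0; apply: vle_add.
Qed.

Lemma vintN x : integral v x -> integral v (- x).
Proof.
have [->|x0] := eqVneq x 0; first by rewrite oppr0.
by case=> [/eqP|hx]; [rewrite (negPf x0) | right; rewrite vvalN].
Qed.

Lemma infinitesimalN x : infinitesimal v x -> infinitesimal v (- x).
Proof.
have [->|x0] := eqVneq x 0; first by rewrite oppr0.
by case=> [/eqP|[hx nx]]; [rewrite (negPf x0) | right; rewrite vvalN].
Qed.

Lemma infinitesimalD x y :
  infinitesimal v x -> infinitesimal v y -> infinitesimal v (x + y).
Proof.
have [->|x0] := eqVneq x 0; first by rewrite add0r.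
have [->|y0] := eqVneq y 0; first by rewrite addr0.
have [->|s0] := eqVneq (x + y) 0; first by left.
case=> [/eqP|[hx nx]]; first by rewrite (negPf x0).
case=> [/eqP|[hy ny]]; first by rewrite (negPf y0).
right; split; first exact: vvalD.
move=> e; case/orP: (@vle_total _ v (v x) (v y)) => le.
  apply: nx; apply: (@vle_anti _ v); rewrite hx andbT -e.
  by apply: vvalD => //; apply: vle_refl.
apply: ny; apply: (@vle_anti _ v); rewrite hy andbT -e.
by apply: vvalD => //; apply: vle_refl.
Qed.

Lemma infinitesimalM x y :
  integral v x -> infinitesimal v y -> infinitesimal v (x * y).
Proof.
have [->|x0] := eqVneq x 0; first by rewrite mul0r; left.
have [->|y0] := eqVneq y 0; first by rewrite mulr0.
case=> [/eqP|hx]; first by rewrite (negPf x0).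
case=> [/eqP|[hy ny]]; first by rewrite (negPf y0).
have le : vle (v y) (v x + v y).
  by rewrite addrC -[X in vle X]addr0; apply: vle_add.
right; rewrite vvalM //; split; first exact: vle_trans le.
by move=> e; apply: ny; apply: (@vle_anti _ v); rewrite hy andbT -e.
Qed.

Lemma infinitesimalMr x y :
  infinitesimal v x -> integral v y -> infinitesimal v (x * y).
Proof. by move=> hx hy; rewrite mulrC; apply: infinitesimalM. Qed.

Lemma vintV x : ~ infinitesimal v x -> integral v x^-1.
Proof.
move=> nx; have x0 : x != 0 by apply/eqP => e; apply: nx; left.
right; rewrite vvalV //; case/orP: (@vle_total _ v 0 (v x)) => le.
  have -> : v x = 0 by apply/eqP; apply: contra_notT nx => /eqP; right.
  by rewrite oppr0 vle_refl.
by have := @vle_add _ v (- v x) _ _ le; rewrite addNr addr0.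
Qed.

End Valuation.

Section Near.
Variables (L K : fieldType) (iota : {rmorphism L -> K}) (v : valuation K).
Hypothesis triv : forall c : L, c != 0 -> v (iota c) = 0.

(** The constant c is the residue of z. A relation is convenient because the
    residues that occur are always known beforehand, as values of functions or
    coefficients of polynomials over L. *)
Definition near (z : K) (c : L) : Prop := infinitesimal v (z - iota c).

Lemma near_iota c : near (iota c) c.
Proof. by rewrite /near subrr; left. Qed.

Lemma near0 z : near z 0 <-> infinitesimal v z.
Proof. by rewrite /near rmorph0 subr0. Qed.

Lemma vint_iota c : integral v (iota c).
Proof.
have [->|c0] := eqVneq c 0; first by rewrite rmorph0; left.
by right; rewrite triv // vle_refl.
Qed.

Lemma near_integral z c : near z c -> integral v z.
Proof.
move=> h; rewrite -[z](subrK (iota c)); apply: vintD (vint_iota c).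
exact: infinitesimalW.
Qed.

Lemma nearD x y c d : near x c -> near y d -> near (x + y) (c + d).
Proof. by move=> hx hy; rewrite /near rmorphD opprD addrACA; apply: infinitesimalD. Qed.

Lemma nearN x c : near x c -> near (- x) (- c).
Proof. by move=> hx; rewrite /near rmorphN -opprD; apply: infinitesimalN. Qed.

Lemma nearM x y c d : near x c -> near y d -> near (x * y) (c * d).
Proof.
move=> hx hy; rewrite /near rmorphM.
have -> : x * y - iota c * iota d = (x - iota c) * y + iota c * (y - iota d).
  by rewrite mulrBl mulrBr addrA subrK.
apply: infinitesimalD; first exact: infinitesimalMr hx (near_integral hy).
exact: infinitesimalM (vint_iota c) hy.
Qed.

Lemma near_sum (I : Type) (r : seq I) (P : pred I) (f : I -> K) (g : I -> L) :
  (forall i, P i -> near (f i) (g i)) ->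
  near (\sum_(i <- r | P i) f i) (\sum_(i <- r | P i) g i).
Proof.
move=> h; apply: (big_rec2 near) => [|i x y Pi]; last by apply: nearD; exact: h.
by apply/near0; left.
Qed.

(** An infinitesimal constant is zero, because nonzero constants have value 0. *)
Lemma near_unique z c d : near z c -> near z d -> c = d.
Proof.
move=> hc hd; apply/eqP; rewrite -subr_eq0; apply/negPn/negP => n0.
have : near (z - z) (c - d) by apply: nearD => //; apply: nearN.
rewrite subrr /near sub0r => /infinitesimalN; rewrite opprK.
by case=> [/eqP|[_]]; [rewrite fmorph_eq0 (negPf n0) | rewrite triv].
Qed.

Lemma near_neq0 z c : near z c -> c != 0 -> z != 0.
Proof.
move=> h; apply: contra_neq => z0; apply: (near_unique h).
by rewrite z0; apply/near0; left.
Qed.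

Lemma nearV z c : near z c -> c != 0 -> near z^-1 c^-1.
Proof.
move=> h c0; have z0 := near_neq0 h c0.
have ni : ~ infinitesimal v z.
  by move=> hz; move/eqP: c0; apply; apply: (near_unique h); apply/near0.
have ic0 : iota c != 0 by rewrite fmorph_eq0.
have -> : near z^-1 c^-1 = infinitesimal v (- (z^-1 * iota c^-1) * (z - iota c)).
  rewrite /near; congr infinitesimal.
  by rewrite fmorphV mulNr mulrBr mulrAC mulVf // mul1r mulfVK // opprB.
apply: infinitesimalM h; apply: vintN; apply: vintM.
  exact: vintV.
exact: vint_iota.
Qed.

End Near.

(** * Noetherian rings *)

Definition lin_span (R : pzRingType) (a : nat -> R) k (x : R) : Prop :=
  exists c : nat -> R, x = \sum_(i < k) c i * a i.

(** In this form the property passes to quotients, polynomial rings and rings of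
    fractions by manipulating one sequence, without a choice of generators of
    an ideal. *)
Definition noeth (R : pzRingType) : Prop :=
  forall a : nat -> R, exists k, lin_span a k (a k).

Section Span.
Variables (R : pzRingType) (a : nat -> R).

Lemma lin_span0 k : lin_span a k 0.
Proof. by exists (fun=> 0); rewrite big1 // => i _; rewrite mul0r. Qed.

Lemma lin_spanD k x y : lin_span a k x -> lin_span a k y -> lin_span a k (x + y).
Proof.
move=> [c ->] [d ->]; exists (fun i => c i + d i).
by rewrite -big_split; apply: eq_bigr => i _; rewrite mulrDl.
Qed.

Lemma lin_spanM k x b : lin_span a k x -> lin_span a k (b * x).
Proof.
move=> [c ->]; exists (fun i => b * c i).
by rewrite mulr_sumr; apply: eq_bigr => i _; rewrite mulrA.
Qed.

Lemma lin_span_sum k (I : Type) (r : seq I) (P : pred I) (c f : I -> R) :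
  (forall i, P i -> lin_span a k (f i)) ->
  lin_span a k (\sum_(i <- r | P i) c i * f i).
Proof.
move=> h; elim/big_rec: _ => [|i x Pi hx]; first exact: lin_span0.
by apply: lin_spanD hx; apply: lin_spanM; exact: h.
Qed.

Lemma lin_span_gen k i : (i < k)%N -> lin_span a k (a i).
Proof.
move=> ik; exists (fun j => (j == i)%:R).
rewrite (bigD1 (Ordinal ik)) //= eqxx mul1r big1 ?addr0 // => j.
by rewrite -val_eqE /= => /negPf ->; rewrite mul0r.
Qed.

Lemma lin_spanS k l x : (k <= l)%N -> lin_span a k x -> lin_span a l x.
Proof.
move=> kl [c ->]; apply: lin_span_sum => i _.
by apply: lin_span_gen; apply: leq_trans kl.
Qed.

End Span.

Lemma noeth_field (R : fieldType) : noeth R.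
Proof.
move=> a; have [a0|/eqP a0] := pselect (a 0%N = 0).
  by exists 0%N; rewrite a0; apply: lin_span0.
exists 1%N, (fun=> a 1%N / a 0%N).
by rewrite big_ord1 mulfVK.
Qed.

Lemma noeth_surj (R S : pzRingType) (f : {rmorphism R -> S}) :
  (forall y, exists x, f x = y) -> noeth R -> noeth S.
Proof.
move=> sf nR b; have [a fa] := choice (fun i => sf (b i)).
have [k [c e]] := nR a; exists k, (f \o c).
by rewrite -fa e rmorph_sum; apply: eq_bigr => i _; rewrite -fa rmorphM.
Qed.

(** Hilbert's basis theorem. If no f k lies in the span of the earlier ones,
    the ideal I that they generate is not spanned by finitely many of its
    elements. Choose then g k in I, of least degree outside the span of
    g 0, ..., g (k - 1). For some k the leading coefficient of g k is a
    combination of the earlier leading coefficients; cancelling it produces an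
    element outside the span that has smaller degree than g k. *)
Lemma noeth_poly (R : nzRingType) : noeth R -> noeth {poly R}.
Proof.
move=> nR f; apply: contrapT => /forallNP nf.
pose I x := exists k, lin_span f k x.
have Isum k (c : nat -> {poly R}) (g : nat -> {poly R}) :
    (forall i, (i < k)%N -> I (g i)) -> I (\sum_(i < k) c i * g i).
  elim: k => [|k IHk] h; first by rewrite big_ord0; exists 0%N; apply: lin_span0.
  have [k1 h1] := IHk (fun i ik => h i (ltnW ik)); have [k2 h2] := h k (ltnSn k).
  exists (maxn k1 k2); rewrite big_ord_recr; apply: lin_spanD.
    by apply: lin_spanS h1; apply: leq_maxl.
  by apply: lin_spanM; apply: lin_spanS h2; apply: leq_maxr.
pose new k (g : nat -> {poly R}) x := I x /\ ~ lin_span g k x.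
have ex_new k g : (forall i, (i < k)%N -> I (g i)) -> exists x, new k g x.
  move=> h.
  have [K hK] : exists K, forall i, (i < k)%N -> lin_span f K (g i).
    elim: k h => [|k IHk] h; first by exists 0%N.
    have [K1 h1] := IHk (fun i ik => h i (ltnW ik)); have [K2 h2] := h k (ltnSn k).
    exists (maxn K1 K2) => i; rewrite ltnS leq_eqVlt => /orP[/eqP ->|ik].
      by apply: lin_spanS h2; apply: leq_maxr.
    by apply: lin_spanS (h1 _ ik); apply: leq_maxl.
  exists (f K); split; first by exists K.+1; apply: lin_span_gen.
  move=> [c e]; apply: (nf K); rewrite e; apply: lin_span_sum => i _.
  exact: hK.
have ex_min (s : seq {poly R}) : exists x, (forall y, y \in s -> I y) ->
    new (size s) (nth 0 s) x /\
    forall y, new (size s) (nth 0 s) y -> (size x <= size y)%N.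
  have [h|nh] := pselect (forall y, y \in s -> I y); last by exists 0 => /nh.
  have [x0 nx0] := ex_new (size s) (nth 0 s) (fun i ik => h _ (mem_nth 0 ik)).
  pose P n := `[< exists2 x, new (size s) (nth 0 s) x & size x = n >].
  have exP : exists n, P n by exists (size x0); apply/asboolP; exists x0.
  case: (ex_minnP exP) => n /asboolP [x nx <-] hmin; exists x => _; split=> //.
  by move=> y ny; apply: hmin; apply/asboolP; exists y.
have [G hG] := choice ex_min.
pose prev n := iter n (fun s => rcons s (G s)) [::].
pose g n := G (prev n).
have prevE n : prev n = mkseq g n.
  by elim: n => // n IHn; rewrite mkseqS -IHn.
have size_prev n : size (prev n) = n by rewrite prevE size_mkseq.
have nth_prev n i : (i < n)%N -> nth 0 (prev n) i = g i.
  by move=> ik; rewrite prevE nth_mkseq.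
have span_prev n x : lin_span (nth 0 (prev n)) n x <-> lin_span g n x.
  by split=> -[c ->]; exists c; apply: eq_bigr => i _; rewrite nth_prev.
have gP n : I (g n) /\ new n g (g n) /\
    forall y, new n g y -> (size (g n) <= size y)%N.
  elim/ltn_ind: n => n IHn.
  have h y : y \in prev n -> I y.
    by rewrite prevE => /mapP [i]; rewrite mem_iota => /andP[_ /IHn []] ? _ ->.
  have [[h1 h2] h3] := hG _ h; rewrite size_prev in h2 h3.
  split=> //; split; first by split=> // /span_prev.
  by move=> y [Iy ny]; apply: h3; split=> // /span_prev.
have mono i j : (i <= j)%N -> (size (g i) <= size (g j))%N.
  move=> ij; have [_ [_ h]] := gP i; have [Ij [[_ nj] _]] := gP j.
  by apply: h; split=> // /(lin_spanS ij).
have [k [c e]] := nR (fun i => lead_coef (g i)).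
pose h := g k - \sum_(i < k) (c i *: 'X^(size (g k) - size (g i))) * g i.
have [Ik [[_ nk] mk]] := gP k.
have gk0 : g k != 0 by apply/eqP => e0; apply: nk; rewrite e0; apply: lin_span0.
have spank x : lin_span g k (x - h) -> lin_span g k x -> lin_span g k h.
  move=> h1 h2; have -> : h = x - (x - h) by rewrite opprB addrC subrK.
  by apply: lin_spanD => //; rewrite -mulN1r; apply: lin_spanM.
have nh : new k g h.
  split.
    have -> : h = \sum_(i < k.+1)
        (if i == k :> nat then 1 else - (c i *: 'X^(size (g k) - size (g i)))) * g i.
      rewrite big_ord_recr /= eqxx mul1r addrC; congr (_ + _).
      rewrite -sumrN; apply: eq_bigr => i _.
      by rewrite -mulNr (ltn_eqF (ltn_ord i)).
    by apply: (Isum _ (fun i => if i == k then 1 else - (c i *: 'X^(size (g k) - size (g i))))) => i _; case: (gP i).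
  move=> hh; apply: nk.
  have -> : g k = h + \sum_(i < k) (c i *: 'X^(size (g k) - size (g i))) * g i.
    by rewrite subrK.
  apply: lin_spanD => //; apply: lin_span_sum => i _; exact: lin_span_gen.
have : (size h < size (g k))%N.
  have sz : (0 < size (g k))%N by rewrite size_poly_gt0.
  rewrite -(prednK sz) ltnS; apply/leq_sizeP => j; rewrite leq_eqVlt => /orP[/eqP <-|lt].
    rewrite /h coefB -lead_coefE e coef_sum; apply/eqP; rewrite subr_eq0; apply/eqP.
    apply: eq_bigr => i _; rewrite -scalerAl coefZ coefXnM.
    have le := mono i k (ltnW (ltn_ord i)).
    have [g0|gi0] := eqVneq (g i) 0.
      by rewrite g0 lead_coef0 coef0 if_same mulr0.
    have si : (0 < size (g i))%N by rewrite size_poly_gt0.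
    have -> : ((size (g k)).-1 < size (g k) - size (g i))%N = false.
      by rewrite ltnNge -subn1 leq_sub2l.
    congr (_ * _); rewrite lead_coefE; congr (_`_ _).
    by lia.
  rewrite /h coefB coef_sum nth_default; last by rewrite -(prednK sz).
  rewrite big1 ?subrr // => i _; rewrite -scalerAl coefZ coefXnM.
  have le := mono i k (ltnW (ltn_ord i)).
  case: ifP => _; first by rewrite mulr0.
  rewrite nth_default ?mulr0 // leq_subRL; first by rewrite subnK // -(prednK sz).
  by apply: leq_trans (leq_subr _ _) _; rewrite -(prednK sz).
by rewrite ltnNge mk.
Qed.

Fixpoint iterated_poly (R : comNzRingType) n : comNzRingType :=
  if n is n'.+1 then {poly iterated_poly R n'} else R.

(** When f and x generate S, this g is surjective, and S inherits from R the
    property of being noetherian. *)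
Lemma iterated_poly_eval (R S : comNzRingType) n (f : {rmorphism R -> S})
    (x : 'I_n -> S) :
  exists g : {rmorphism iterated_poly R n -> S},
    (forall c, exists p, g p = f c) /\ (forall i, exists p, g p = x i).
Proof.
elim: n x => [|n IHn] x; first by exists f; split=> [c|[]//]; exists c.
have [g [gc gx]] := IHn (x \o lift ord0).
pose G : {rmorphism iterated_poly R n.+1 -> S} :=
  horner_morph (fun y => mulrC (x ord0) (g y)).
have GC p : G p%:P = g p by rewrite /= horner_morphC.
exists G; split=> [c|i].
  by have [p e] := gc c; exists p%:P; rewrite GC.
case: (unliftP ord0 i) => [j|] ->.
  by have [p e] := gx j; exists p%:P; rewrite GC.
by exists 'X; rewrite /= horner_morphX.
Qed.

Lemma mpoly_gen (R : nzRingType) n (P : {mpoly R[n]} -> Prop) :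
  (forall c, P c%:MP) -> (forall i, P 'X_i) ->
  (forall p q, P p -> P q -> P (p + q)) ->
  (forall p q, P p -> P q -> P (p * q)) -> forall p, P p.
Proof.
move=> hC hX hD hM; elim/mpolyind => [|c m p _ _ hp].
  by rewrite -mpolyC0.
apply: (hD) hp; rewrite -mul_mpolyC; apply: (hM) => //.
rewrite mpolyXE_id; apply: (big_rec P) => [|i x _ hx]; first by rewrite -mpolyC1.
apply: (hM) hx; elim: (m i) => [|k IHk]; first by rewrite expr0 -mpolyC1.
by rewrite exprS; apply: (hM).
Qed.

Lemma noeth_mpoly (R : fieldType) n : noeth {mpoly R[n]}.
Proof.
have [g [gc gx]] :=
  iterated_poly_eval (@mpolyC n R) (fun i => 'X_i : {mpoly R[n]}).
have nI : noeth (iterated_poly R n).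
  by elim: n {g gc gx} => [|n IHn]; [apply: noeth_field | apply: noeth_poly].
apply: (noeth_surj (f := g)) nI; apply: mpoly_gen => //.
- by move=> p q [x <-] [y <-]; exists (x + y); rewrite rmorphD.
- by move=> p q [x <-] [y <-]; exists (x * y); rewrite rmorphM.
Qed.

(** * Ideals and lengths *)

(** Truncating a chain gives chains of all smaller lengths. *)
Lemma max_chain_length_unique (T : Type) (P : set (set T)) n n' :
  max_chain_length P n -> max_chain_length P n' -> n = n'.
Proof.
have chainS k l (J : nat -> set T) : (k <= l)%N ->
    (forall i, (i <= l)%N -> P (J i)) /\ (forall i, (i < l)%N -> J i `<` J i.+1) ->
    (forall i, (i <= k)%N -> P (J i)) /\ (forall i, (i < k)%N -> J i `<` J i.+1).
  by move=> kl [h1 h2]; split=> i ik; [apply: h1|apply: h2]; apply: leq_trans kl.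
move=> [[J cJ] nJ] [[J' cJ'] nJ'].
case: (ltngtP n n') => // lt.
  by case: nJ; exists J'; apply: chainS cJ'.
by case: nJ'; exists J; apply: chainS cJ.
Qed.

Section Ideal.
Variable R : comNzRingType.

Lemma ideal_gen_min (S I : set R) : is_ideal I -> S `<=` I -> ideal_gen S `<=` I.
Proof. by move=> hI SI x; apply. Qed.

Lemma sub_ideal_gen (S : set R) : S `<=` ideal_gen S.
Proof. by move=> x Sx I [_]; apply. Qed.

Lemma ideal_gen_ideal (S : set R) : is_ideal (ideal_gen S).
Proof.
split=> [I [[]]//|a b ha hb I hI|a b hb I hI].
  by case: (hI) => -[_ h _] _; apply: h; [apply: ha|apply: hb].
by case: (hI) => -[_ _ h] _; apply: h; apply: hb.
Qed.

Lemma ideal_sum (I : set R) k (c x : 'I_k -> R) :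
  is_ideal I -> (forall i, I (x i)) -> I (\sum_i c i * x i).
Proof.
move=> [I0 ID IM] h; apply: (big_ind I) => // i _; exact: IM.
Qed.

Lemma is_idealN (I : set R) x : is_ideal I -> I x -> I (- x).
Proof. by move=> [_ _ IM] Ix; rewrite -mulN1r; apply: IM. Qed.

Definition multiples (s : R) : set R := [set b | exists c, b = c * s].

Lemma multiples_ideal s : is_ideal (multiples s).
Proof.
split=> [|_ _ [c ->] [d ->]|a _ [c ->]]; first by exists 0; rewrite mul0r.
  by exists (c + d); rewrite mulrDl.
by exists (a * c); rewrite mulrA.
Qed.

Lemma multiples_gen s : multiples s s.
Proof. by exists 1; rewrite mul1r. Qed.

(** Cramer's rule. With a determinant that is a unit it gives Nakayama's lemma;
    with N a multiplication matrix, the Cayley-Hamilton theorem. *)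
Lemma det_solve k (N : 'M[R]_k) (e c : 'I_k -> R) :
  (forall i, \sum_j N i j * e j = c i) ->
  forall i, \det N * e i = \sum_j \adj N i j * c j.
Proof.
move=> h i; have E : N *m (\col_j e j) = \col_j c j.
  by apply/matrixP => a b; rewrite !mxE -h; apply: eq_bigr => j _; rewrite !mxE.
have := congr1 (mulmx (\adj N)) E; rewrite mulmxA mul_adj_mx mul_scalar_mx.
move/matrixP/(_ i 0); rewrite !mxE => ->.
by apply: eq_bigr => j _; rewrite !mxE.
Qed.

End Ideal.

(** * Local rings *)

Section Localization.
Variables (C B : comNzRingType) (K : fieldType).
Variables (ev : {rmorphism C -> B}).

(** The element b is sent to rho P / rho Q for any fraction P / Q that
    represents it; the condition on kernels makes the choice immaterial. *)
Lemma localization_hom (rho : {rmorphism C -> K}) :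
  (forall b, exists P Q, rho Q != 0 /\ b * ev Q = ev P) ->
  (forall P, ev P = 0 -> rho P = 0) ->
  exists sigma : {rmorphism B -> K}, forall P, sigma (ev P) = rho P.
Proof.
move=> frac ker.
have ex b : exists z, forall P Q, b * ev Q = ev P -> z * rho Q = rho P.
  have [P0 [Q0 [Q00 e0]]] := frac b; exists (rho P0 / rho Q0) => P Q e.
  have : ev (P0 * Q - P * Q0) = 0.
    by rewrite rmorphB !rmorphM -e0 -e mulrAC subrr.
  move/ker/eqP; rewrite rmorphB subr_eq0 !rmorphM => /eqP h.
  by rewrite mulrAC h mulfK.
have [s sP] := choice ex.
have sE b z P Q : rho Q != 0 -> b * ev Q = ev P -> z * rho Q = rho P -> s b = z.
  by move=> Q0 e h; apply: (mulIf Q0); rewrite h (sP b P Q e).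
have s_add : zmod_morphism s.
  move=> a b; have [P [Q [Q0 e]]] := frac a; have [P' [Q' [Q'0 e']]] := frac b.
  apply: (sE _ _ (P * Q' - P' * Q) (Q * Q')).
  - by rewrite rmorphM mulf_neq0.
  - by rewrite rmorphB !rmorphM -e -e'; ring.
  - by rewrite rmorphB !rmorphM -(sP _ _ _ e) -(sP _ _ _ e'); ring.
have s_mul : monoid_morphism s.
  split=> [|a b].
    by apply: (sE _ _ 1 1); rewrite ?rmorph1 ?oner_neq0 ?mulr1.
  have [P [Q [Q0 e]]] := frac a; have [P' [Q' [Q'0 e']]] := frac b.
  apply: (sE _ _ (P * P') (Q * Q')).
  - by rewrite rmorphM mulf_neq0.
  - by rewrite !rmorphM -e -e'; ring.
  - by rewrite !rmorphM -(sP _ _ _ e) -(sP _ _ _ e'); ring.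
pose Z := GRing.isZmodMorphism.Build B K s s_add.
pose M := GRing.isMonoidMorphism.Build B K s s_mul.
exists (HB.pack_for {rmorphism B -> K} s Z M) => P /=.
by apply: (sE _ _ P 1); rewrite ?rmorph1 ?oner_neq0 ?mulr1.
Qed.

Lemma localization_hom_unique (s s' : {rmorphism B -> K}) :
  (forall b, exists P Q, s (ev Q) != 0 /\ b * ev Q = ev P) ->
  (forall P, s (ev P) = s' (ev P)) -> s =1 s'.
Proof.
move=> frac h b; have [P [Q [Q0 e]]] := frac b; apply: (mulIf Q0).
by rewrite -rmorphM e (h P) (h Q) -rmorphM e.
Qed.

End Localization.

Section LocalDomain.
Variables (L : fieldType) (B : comNzRingType) (res : {rmorphism B -> L}).

(** The maximal ideal is given as the kernel of a homomorphism to L, which makes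
    the residue of an element a value that can be computed. *)
Record local_domain : Prop := LocalDomain {
  local_unit : forall b : B, res b != 0 -> exists b' : B, b * b' = 1;
  local_integral : forall a b : B, a * b = 0 -> a = 0 \/ b = 0
}.

Hypothesis locB : local_domain.

Lemma local_mulIf (s a b : B) : s != 0 -> a * s = b * s -> a = b.
Proof.
move=> s0 /eqP; rewrite -subr_eq0 -mulrBl => /eqP /(local_integral locB).
by case=> /eqP; rewrite ?(negPf s0) // subr_eq0 => /eqP.
Qed.

Lemma local_expf_neq0 (s : B) k : s != 0 -> s ^+ k != 0.
Proof.
move=> s0; elim: k => [|k IHk]; first by rewrite expr0 oner_neq0.
apply/eqP; rewrite exprS => /(local_integral locB) [] /eqP; first exact/negP.
exact/negP.
Qed.

Lemma res_neq0 b : res b != 0 -> b != 0.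
Proof. by apply: contra_neq => ->; rewrite rmorph0. Qed.

(** The determinant of N is a unit, so Cramer's rule recovers each x i from
    combinations that lie in I. *)
Lemma det_cancel k (I : set B) (N : 'M[B]_k) (x : 'I_k -> B) :
  is_ideal I -> res (\det N) != 0 ->
  (forall i, I (\sum_j N i j * x j)) -> forall i, I (x i).
Proof.
move=> hI /(local_unit locB) [w hw] h i.
have := det_solve (N := N) (e := x) (fun i => erefl) i.
move/(congr1 ( *%R w)); rewrite mulrA [w * _]mulrC hw mul1r => ->.
by case: (hI) => _ _ IM; apply: IM; apply: ideal_sum.
Qed.

(** Nakayama's lemma: the matrix 1 - M is the identity modulo the maximal ideal,
    so its determinant is a unit. *)
Lemma nakayama k (I : set B) (x : 'I_k -> B) :
  is_ideal I ->
  (forall i, exists2 M : 'I_k -> B,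
    forall j, res (M j) = 0 & I (x i - \sum_j M j * x j)) ->
  forall i, I (x i).
Proof.
move=> hI h; have [M hM] := choice (fun i => let: ex_intro2 M a b := h i in
  ex_intro (fun M => (forall j, res (M j) = 0) /\ I (x i - \sum_j M j * x j))
    M (conj a b)).
apply: (det_cancel (N := 1%:M - \matrix_(i, j) M i j)) => // [|i].
  rewrite -det_map_mx.
  have -> : map_mx res (1%:M - \matrix_(i, j) M i j) = 1%:M.
    apply/matrixP => i j; rewrite !mxE rmorphB (proj1 (hM i)) subr0.
    by rewrite rmorphMn rmorph1.
  by rewrite det1 oner_neq0.
have := proj2 (hM i); congr I.
under [RHS]eq_bigr do rewrite !mxE mulrBl.
rewrite sumrB; congr (_ - _); rewrite (bigD1 i) //= eqxx mul1r big1 ?addr0 // => j /negPf.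
by rewrite eq_sym => ->; rewrite mul0r.
Qed.

(** A local domain with such an element is a discrete valuation ring, and k is
    the order of b. *)
Definition uniformizer (s : B) : Prop :=
  [/\ res s = 0, s != 0 &
    forall b, b != 0 -> exists k u, res u != 0 /\ b = u * s ^+ k].

Lemma uniformizer_mult s b : uniformizer s -> res b = 0 -> multiples s b.
Proof.
move=> [rs s0 h] rb; have [->|b0] := eqVneq b 0.
  by exists 0; rewrite mul0r.
have [[|k] [u [u0 e]]] := h b b0.
  by move: rb u0; rewrite e expr0 mulr1 => ->; rewrite eqxx.
by exists (u * s ^+ k); rewrite e exprSr mulrA.
Qed.

Lemma uniformizer_unitM s w : uniformizer s -> res w != 0 -> uniformizer (w * s).
Proof.
move=> [rs s0 hs] w0; have [w' hw] := local_unit locB w0.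
split; first by rewrite rmorphM rs mulr0.
  by apply/eqP => /(local_integral locB) [] /eqP; [apply/negP/(res_neq0 w0) | apply/negP].
move=> b b0; have [n [u [u0 ->]]] := hs b b0; exists n, (u * w' ^+ n); split.
  have w'0 : res w' != 0.
    apply/eqP => h; have := congr1 res hw; rewrite rmorphM h mulr0 rmorph1 => /eqP.
    by rewrite eq_sym oner_eq0.
  by rewrite rmorphM rmorphXn mulf_neq0 // expf_neq0.
by rewrite -mulrA -exprMn mulrA [w' * w]mulrC hw mul1r.
Qed.

Lemma uniformizer_total (s a b : B) : uniformizer s ->
  (exists c : B, a = c * b) \/ (exists c : B, b = c * a).
Proof.
move=> [rs s0 h].
have [->|a0] := eqVneq a 0; first by left; exists 0; rewrite mul0r.
have [->|b0] := eqVneq b 0; first by right; exists 0; rewrite mul0r.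
have [k [u [u0 ->]]] := h _ a0; have [l [w [w0 ->]]] := h _ b0.
have [u' hu] := local_unit locB u0; have [w' hw] := local_unit locB w0.
case: (leqP k l) => kl; [right|left; move/ltnW in kl].
  exists (w * u' * s ^+ (l - k)).
  by rewrite -[in LHS](subnK kl) exprD -[LHS]mul1r -hu; ring.
exists (u * w' * s ^+ (k - l)).
by rewrite -[in LHS](subnK kl) exprD -[LHS]mul1r -hw; ring.
Qed.

(** A dependence between numerators becomes one between the fractions. *)
Lemma noeth_localization (C : comNzRingType) (ev : {rmorphism C -> B}) :
  noeth C ->
  (forall b, exists P Q, res (ev Q) != 0 /\ b * ev Q = ev P) -> noeth B.
Proof.
move=> nC frac b; have [P hP] := choice (fun i => frac (b i)).
have [Q hQ] := choice hP; have [k [c e]] := nC P; exists k.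
have [Q0 eQ] := hQ k; have [w hw] := local_unit locB Q0.
exists (fun i => w * ev (c i) * ev (Q i)).
have -> : b k = w * (b k * ev (Q k)) by rewrite mulrCA [w * _]mulrC hw mulr1.
rewrite eQ e rmorph_sum mulr_sumr; apply: eq_bigr => i _.
by rewrite rmorphM -(proj2 (hQ i)); ring.
Qed.

(** Krull's intersection theorem for a principal maximal ideal. An element b that
    is not a unit times a power of s gives a sequence with f n = f n.+1 * s. If
    f k depends on the earlier terms, which are all multiples of f k * s, then
    s is a unit. *)
Lemma uniformizer_krull s : noeth B -> res s = 0 -> s != 0 ->
  (forall b, res b = 0 -> multiples s b) -> uniformizer s.
Proof.
move=> nB rs s0 hs; split=> // b b0; apply: contrapT => nb.
pose bad x := x != 0 /\ ~ exists k u, res u != 0 /\ x = u * s ^+ k.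
have ex x : exists y, bad x -> bad y /\ x = y * s.
  have [bx|nbx] := pselect (bad x); last by exists 0 => /nbx.
  case: bx => x0 nx.
  have rx : res x = 0.
    apply: contra_notP nx => /eqP rx.
    by exists 0%N, x; rewrite expr0 mulr1.
  have [y e] := hs x rx; exists y => _; split=> //; split.
    by apply: contra_neq x0 => y0; rewrite e y0 mul0r.
  move=> [k [u [u0 ey]]]; apply: nx; exists k.+1, u.
  by split=> //; rewrite exprSr mulrA -ey.
have [nxt hn] := choice ex.
pose f n := iter n nxt b.
have fbad n : bad (f n) by elim: n => // n /hn [].
have fS n : f n = f n.+1 * s by have [] := hn _ (fbad n).
have fD n k : f n = f (n + k)%N * s ^+ k.
  elim: k => [|k IHk]; first by rewrite addn0 expr0 mulr1.
  by rewrite IHk fS addnS exprS mulrA.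
have [k [c e]] := nB f.
have : f k * (1 - s * \sum_(i < k) c i * s ^+ (k - i.+1)) = 0.
  rewrite mulrBr mulr1 {1}e; apply/eqP; rewrite subr_eq0; apply/eqP.
  rewrite mulr_sumr mulr_sumr; apply: eq_bigr => i _.
  rewrite [f i](fD i (k - i)%N) subnKC ?(ltnW (ltn_ord i)) //.
  have -> : (k - i = (k - i.+1).+1)%N by have := ltn_ord i; lia.
  by rewrite exprS; ring.
case/(local_integral locB) => [/eqP|/(congr1 res)].
  by rewrite (negPf (proj1 (fbad k))).
rewrite rmorphB rmorphM rs mul0r subr0 rmorph1 rmorph0 => /eqP.
by rewrite oner_eq0.
Qed.

(** Each generator x i of the maximal ideal is congruent to a multiple of the
    single cotangent vector t modulo the square of that ideal, so t generates
    it by Nakayama's lemma. *)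
Lemma uniformizer_exists k (x : 'I_k -> B) :
  noeth B -> (forall i, res (x i) = 0) ->
  (forall b, res b = 0 -> exists c : 'I_k -> B, b = \sum_i c i * x i) ->
  cotangent_dim [set b | res b = 0] 1 -> exists s, uniformizer s.
Proof.
move=> nB rx hx; rewrite /cotangent_dim /=.
set m2 := ideal_gen _; have m2I : is_ideal m2 by apply: ideal_gen_ideal.
move=> [t [rt ht hf]].
have m2S b : m2 b ->
    exists2 M : 'I_k -> B, forall j, res (M j) = 0 & b = \sum_j M j * x j.
  move: b; apply: ideal_gen_min.
    split.
    - by exists (fun=> 0) => [j|]; rewrite ?rmorph0 // big1 // => j _; rewrite mul0r.
    - move=> _ _ [M rM ->] [M' rM' ->]; exists (fun j => M j + M' j) => [j|].
        by rewrite rmorphD rM rM' addr0.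
      by rewrite -big_split; apply: eq_bigr => j _; rewrite mulrDl.
    - move=> a _ [M rM ->]; exists (fun j => a * M j) => [j|].
        by rewrite rmorphM rM mulr0.
      by rewrite mulr_sumr; apply: eq_bigr => j _; rewrite mulrA.
  move=> _ [a ra [b rb <-]]; have [c ->] := hx b rb.
  exists (fun j => a * c j) => [j|]; first by rewrite rmorphM ra mul0r.
  by rewrite mulr_sumr; apply: eq_bigr => j _; rewrite mulrA.
have hm i : multiples (t ord0) (x i).
  apply: (nakayama (I := multiples (t ord0))) => [|{}i].
    exact: multiples_ideal.
  have [c] := ht _ (rx i); rewrite big_ord1 => /m2S [M rM e].
  by exists M => //; rewrite -e opprB addrC subrK; exists (c ord0).
exists (t ord0); apply: uniformizer_krull => // [|b rb].
  apply/eqP => t0; have := hf (fun=> 1); rewrite big_ord1 t0 mulr0 => h.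
  have : res 1 = 0 by apply: h ord0; case: m2I.
  by apply/eqP; rewrite rmorph1 oner_neq0.
have [c ->] := hx b rb; apply: ideal_sum hm; exact: multiples_ideal.
Qed.

(** The ideals generated by the powers of s form a chain of length e. In any
    chain, the least exponent of a power of s in the ideal drops at each
    strict inclusion, starting from e at most. *)
Lemma quotient_length_uniformizer s e : uniformizer s ->
  quotient_length (multiples (s ^+ e)) e.
Proof.
move=> us; have [rs s0 h] := us; split.
  exists (fun i => multiples (s ^+ (e - i))); split=> i ie.
    split; first exact: multiples_ideal.
    by move=> _ [c ->]; exists (c * s ^+ i); rewrite -mulrA -exprD subnKC.
  have ei : (e - i = (e - i.+1).+1)%N by lia.
  split=> [_ [c ->]|/(_ _ (multiples_gen _)) [c]].
    by exists (c * s); rewrite ei exprS mulrA.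
  rewrite ei exprS mulrA -[LHS]mul1r => /local_mulIf.
  move=> /(_ (local_expf_neq0 _ s0)) /(congr1 res).
  by rewrite rmorphM rs mulr0 rmorph1 => /eqP; rewrite oner_eq0.
move=> [J [hJ cJ]].
suff: forall i, (i <= e.+1)%N -> exists k, (k + i <= e)%N /\ J i (s ^+ k).
  by move=> /(_ _ (leqnn _)) [k []]; lia.
elim=> [|i IHi] ie.
  exists e; rewrite addn0; split=> //.
  by apply: (proj2 (hJ 0%N isT)); exact: multiples_gen.
have [k [ki Jk]] := IHi (ltnW ie).
have [sub /existsNP [b /not_implyP [Jb nJb]]] := cJ i ie.
have [[_ _ IM] _] := hJ i (ltnW ie).
have [[J0 _ IM'] _] := hJ i.+1 ie.
have [b0|b0] := eqVneq b 0.
  by case: nJb; rewrite b0; case: (hJ i (ltnW ie)) => -[].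
have [l [u [u0 eb]]] := h b b0; exists l; split.
  rewrite addnS; apply: leq_trans ki; rewrite -addSn leq_add2r ltnNge.
  apply/negP => kl; apply: nJb; rewrite eb -(subnK kl) exprD mulrA.
  exact: IM.
have [u' hu] := local_unit locB u0.
have -> : s ^+ l = u' * b by rewrite eb mulrA [u' * u]mulrC hu mul1r.
exact: IM'.
Qed.

End LocalDomain.

(** * Roots infinitely close to zero *)

Section NearPoly.
Variables (L K : fieldType) (iota : {rmorphism L -> K}) (v : valuation K).
Hypothesis triv : forall c : L, c != 0 -> v (iota c) = 0.
Local Notation near := (near iota v).

Lemma near_horner (P : {poly K}) (p : {poly L}) z c :
  (forall i, near P`_i p`_i) -> near z c -> near P.[z] p.[c].
Proof.
move=> h hz; set N := maxn (size P) (size p).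
rewrite (@horner_coef_wide _ N P) ?leq_maxl //.
rewrite (@horner_coef_wide _ N p) ?leq_maxr //.
apply: near_sum => i _; apply: nearM => //.
elim: (nat_of_ord i) => [|k IHk].
  by rewrite !expr0 -(rmorph1 iota); apply: near_iota.
by rewrite !exprS; apply: nearM.
Qed.

(** The coefficients of the quotient are found from the top down, by
    Q_i = P_(i+1) + r Q_(i+1) with r infinitesimal. *)
Lemma near_deflate (P : {poly K}) (p : {poly L}) r :
  (forall i, near P`_i ('X * p)`_i) -> infinitesimal v r ->
  forall Q, P = Q * ('X - r%:P) -> forall i, near Q`_i p`_i.
Proof.
move=> h /(near0 iota) hr Q e.
have step i : near Q`_i.+1 p`_i.+1 -> near Q`_i p`_i.
  move=> hi; have := h i.+1.
  rewrite coefXM /= e mulrBr coefB coefMX /= coefMC => hP.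
  have -> : p`_i = p`_i + p`_i.+1 * 0 by rewrite mulr0 addr0.
  by rewrite -(subrK (Q`_i.+1 * r) Q`_i); apply: nearD => //; apply: nearM.
have big i : (maxn (size Q) (size p) <= i)%N -> near Q`_i p`_i.
  rewrite geq_max => /andP[h1 h2]; rewrite !nth_default //.
  by apply/near0; left.
move=> i; case: (leqP (maxn (size Q) (size p)) i) => [/big //|lt].
rewrite -(subKn (ltnW lt)); elim: (_ - i)%N => [|k IHk].
  by rewrite subn0; apply: big.
case: (ltnP k (maxn (size Q) (size p))) => kN.
  by apply: step; rewrite -subSn // subSS.
move: IHk; rewrite (_ : (maxn _ _ - k.+1)%N = (maxn (size Q) (size p) - k)%N) //.
by lia.
Qed.

End NearPoly.

Section InfinitesimalRoots.
Variables (L : fieldType) (K : closedFieldType).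
Variables (iota : {rmorphism L -> K}) (v : valuation K).
Hypothesis triv : forall c : L, c != 0 -> v (iota c) = 0.
Local Notation near := (near iota v).

(** If no root z of P is infinitesimal, every 1 / z is integral and P is the
    product of its constant term by the integral polynomials 1 - X / z. The
    constant term is infinitesimal, so all coefficients of P would be. *)
Lemma infinitesimal_root_exists (P : {poly K}) n (p1 : {poly L}) :
  p1`_0 != 0 -> (forall i, near P`_i ('X^(n.+1) * p1)`_i) ->
  exists2 r, infinitesimal v r & root P r.
Proof.
move=> p10 h; apply: contrapT => nr.
have [rs eP] := closed_field_poly_normal P.
have Pn : P`_n.+1 != 0.
  by apply: near_neq0 (h n.+1) _ => //; rewrite coefXnM ltnn subnn.
have P0 : P != 0 by apply: contra_neq Pn => ->; rewrite coef0.
have intrs z : z \in rs -> integral v z^-1.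
  move=> zrs; apply: vintV => iz; apply: nr; exists z => //.
  rewrite eP rootE hornerZ horner_prod (big_rem z) //= hornerXsubC subrr.
  by rewrite mul0r mulr0.
have nz z : z \in rs -> z != 0.
  move=> zrs; apply/eqP => z0; apply: nr; exists z; first by left.
  rewrite eP rootE hornerZ horner_prod (big_rem z) //= hornerXsubC subrr.
  by rewrite mul0r mulr0.
have [R [intR eR]] : exists R : {poly K}, (forall i, integral v R`_i) /\
    \prod_(z <- rs) ('X - z%:P) = (\prod_(z <- rs) - z) *: R.
  elim: rs intrs nz {eP} => [|z rs IHrs] h1 h2.
    exists 1; rewrite !big_nil scale1r; split=> // i; rewrite coef1.
    by case: eqP => _; [apply: vint1 | left].
  have [R [intR eR]] := IHrs (fun y yr => h1 y (mem_behead (s := z :: rs) yr))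
    (fun y yr => h2 y (mem_behead (s := z :: rs) yr)).
  have z0 := h2 z (mem_head _ _); have iz := h1 z (mem_head _ _).
  exists ((1 - z^-1 *: 'X) * R); split=> [i|].
    rewrite mulrBl mul1r -scalerAl coefB coefZ coefXM; apply: vintD => //.
    apply: vintN; apply: vintM => //; case: ifP => // _; exact: vint0.
  have -> : \prod_(y <- z :: rs) ('X - y%:P) =
      ((- z) *: (1 - z^-1 *: 'X)) * \prod_(y <- rs) ('X - y%:P).
    rewrite big_cons scalerBr scalerA mulNr mulfV // scaleN1r opprK addrC.
    by rewrite -[(- z) *: 1]mul_polyC mulr1 rmorphN.
  by rewrite big_cons eR -!mul_polyC polyCM; ring.
have e0 : P`_0 = lead_coef P * (\prod_(z <- rs) - z).
  rewrite {1}eP coefZ -horner_coef0 horner_prod; congr (_ * _).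
  by apply: eq_bigr => z _; rewrite hornerXsubC sub0r.
have inf0 : infinitesimal v P`_0 by apply/(near0 iota); have := h 0%N; rewrite coefXnM.
have : near P`_n.+1 0.
  apply/near0; rewrite eP eR scalerA -e0 coefZ; exact: infinitesimalMr.
move/near_unique => /(_ triv _ (h n.+1)) /eqP.
by rewrite coefXnM ltnn subnn eq_sym (negPf p10).
Qed.

(** The infinitesimal roots of P, counted with multiplicity, are as many as the
    order at 0 of the reduction of P: they are split off one at a time. *)
Lemma infinitesimal_roots n (P : {poly K}) (p1 : {poly L}) :
  p1`_0 != 0 -> (forall i, near P`_i ('X^n * p1)`_i) ->
  exists (rs : seq K) (P1 : {poly K}),
    [/\ size rs = n, forall r, r \in rs -> infinitesimal v r,
        P = \prod_(r <- rs) ('X - r%:P) * P1 &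
        forall z, infinitesimal v z -> ~~ root P1 z].
Proof.
move=> p10; elim: n P => [|n IHn] P h.
  exists [::], P; split=> // [|z /(near0 iota) hz]; first by rewrite big_nil mul1r.
  have hP : near P.[z] ('X^0 * p1).[0] by apply: near_horner.
  apply: (near_neq0 triv hP).
  by rewrite expr0 mul1r horner_coef0.
have [r ir /factor_theorem [Q eQ]] := infinitesimal_root_exists p10 h.
have hQ : forall i, near Q`_i ('X^n * p1)`_i.
  by apply: (near_deflate triv _ ir eQ) => i; rewrite mulrA -exprS.
have [rs [P1 [e1 h1 h2 h3]]] := IHn Q hQ.
exists (r :: rs), P1; split=> //=; first by rewrite e1.
  by move=> z; rewrite inE => /predU1P [->|/h1].
by rewrite big_cons eQ h2 mulrC mulrA.
Qed.

End InfinitesimalRoots.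

(** * Counting the extensions of a specialisation *)

Lemma near_localization (L K : fieldType) (iota : {rmorphism L -> K})
    (v : valuation K) (triv : forall c : L, c != 0 -> v (iota c) = 0)
    (C B : comNzRingType) (ev : {rmorphism C -> B})
    (res : {rmorphism B -> L}) (sigma : {rmorphism B -> K}) :
  (forall b, exists P Q, res (ev Q) != 0 /\ b * ev Q = ev P) ->
  (forall P, near iota v (sigma (ev P)) (res (ev P))) ->
  forall b, near iota v (sigma b) (res b).
Proof.
move=> frac h b; have [P [Q [Q0 e]]] := frac b.
have sQ0 := near_neq0 triv (h Q) Q0.
have -> : sigma b = sigma (ev P) / sigma (ev Q) by rewrite -e rmorphM mulfK.
have -> : res b = res (ev P) / res (ev Q) by rewrite -e rmorphM mulfK.
by apply: nearM => //; apply: nearV.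
Qed.

(** The rings A and B are discrete valuation rings, B dominates A, and every
    element of B is a fraction of polynomials in th over A. *)
Section Count.
Variables (L : fieldType) (K : closedFieldType).
Variables (iota : {rmorphism L -> K}) (v : valuation K).
Hypothesis triv : forall c : L, c != 0 -> v (iota c) = 0.
Hypothesis char0 : forall k, (k.+1)%:R != 0 :> K.
Local Notation near := (near iota v).

Variables (A B : comNzRingType) (phi : {rmorphism A -> B}).
Variables (resA : {rmorphism A -> L}) (resB : {rmorphism B -> L}).
Hypothesis locA : local_domain resA.
Hypothesis locB : local_domain resB.
Hypothesis res_phi : forall a, resB (phi a) = resA a.
Hypothesis phi_inj : forall a, phi a = 0 -> a = 0.
Variables (t : A) (th : B).
Hypothesis unif_t : uniformizer resA t.
Hypothesis unif_th : uniformizer resB th.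

Definition poly_at : {rmorphism {poly A} -> B} :=
  horner_morph (fun a => mulrC th (phi a)).

Lemma poly_atC a : poly_at a%:P = phi a.
Proof. by rewrite /= horner_morphC. Qed.

Lemma poly_atX : poly_at 'X = th.
Proof. by rewrite /= horner_morphX. Qed.

Lemma res_poly_at P : resB (poly_at P) = resA P`_0.
Proof.
have [rt _ _] := unif_th; rewrite /= /horner_morph -horner_map rt horner_coef0.
by rewrite -map_poly_comp coef_map; apply: res_phi.
Qed.

Hypothesis gen : forall b, exists G H : {poly A},
  resB (poly_at H) != 0 /\ b * poly_at H = poly_at G.
Hypothesis alg : exists2 P : {poly A}, P != 0 & poly_at P = 0.

Let t_neq0 : t != 0. Proof. by case: unif_t. Qed.

(** As long as all coefficients are divisible by t, a division by t lowers the
    order of the leading coefficient. *)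
Lemma primitive_part (Q : {poly A}) : Q != 0 ->
  exists k Q', [/\ Q = t ^+ k *: Q', size Q' = size Q &
    exists i, resA Q'`_i != 0].
Proof.
move=> Q0; have lQ0 : lead_coef Q != 0 by rewrite lead_coef_eq0.
have [rt _ ht] := unif_t; have [j [u [u0 eu]]] := ht _ lQ0.
elim: j Q Q0 lQ0 eu => [|j IHj] Q Q0 lQ0 eu.
  exists 0%N, Q; rewrite expr0 scale1r; split=> //; exists (size Q).-1.
  by rewrite -lead_coefE eu expr0 mulr1.
have [[i hi]|nh] := pselect (exists i, resA Q`_i != 0).
  by exists 0%N, Q; rewrite expr0 scale1r; split=> //; exists i.
have h i : exists c, Q`_i = c * t.
  apply: (uniformizer_mult unif_t); apply/eqP/negPn/negP => hi.
  by apply: nh; exists i.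
have [c hc] := choice h.
have sQ : (0 < size Q)%N by rewrite size_poly_gt0.
have ctop : c (size Q).-1 = u * t ^+ j.
  apply: (local_mulIf locA t_neq0).
  by rewrite -hc -lead_coefE eu exprSr mulrA.
have ctop0 : c (size Q).-1 != 0.
  by apply: contra_neq lQ0 => c0; rewrite lead_coefE hc c0 mul0r.
pose Q' := \poly_(i < size Q) c i.
have sQ' : size Q' = size Q by apply: size_poly_eq.
have eQ : Q = t *: Q'.
  apply/polyP => i; rewrite coefZ coef_poly; case: ltnP => si.
    by rewrite hc mulrC.
  by rewrite nth_default // mulr0.
have lQ' : lead_coef Q' = c (size Q).-1.
  by rewrite lead_coefE sQ' coef_poly prednK // leqnn.
have Q'0 : Q' != 0 by rewrite -size_poly_gt0 sQ'.
have [] := IHj Q' Q'0; rewrite ?lQ' //.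
move=> k [Q'' [e1 e2 e3]]; exists k.+1, Q''; split=> //.
  by rewrite eQ e1 scalerA exprS.
by rewrite e2.
Qed.

(** A primitive relation of least degree does the work of the minimal polynomial
    of th over the fraction field of A, with coefficients in A. *)
Lemma minimal_relation : exists Q : {poly A},
  [/\ Q != 0, poly_at Q = 0, exists i, resA Q`_i != 0 &
      forall P, poly_at P = 0 -> P != 0 -> (size Q <= size P)%N].
Proof.
have [P0 P00 eP0] := alg.
pose R n := `[< exists P : {poly A}, [/\ P != 0, poly_at P = 0 & size P = n] >].
have exR : exists n, R n by exists (size P0); apply/asboolP; exists P0.
case: (ex_minnP exR) => n /asboolP [Q [Q0 eQ sQ]] hmin.
have [k [Q' [e1 e2 e3]]] := primitive_part Q0.
exists Q'; split=> //.
- by rewrite -size_poly_gt0 e2 size_poly_gt0.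
- have : phi t ^+ k * poly_at Q' = 0.
    by rewrite -rmorphXn -poly_atC -rmorphM mul_polyC -e1.
  case/(local_integral locB) => // /eqP; apply: contraTeq => _.
  apply: (local_expf_neq0 locB); apply: contra_neq t_neq0; exact: phi_inj.
- by move=> P eP P0'; rewrite e2 sQ; apply: hmin; apply/asboolP; exists P.
Qed.

Variable sigmaA : {rmorphism A -> K}.
Hypothesis near_sigmaA : forall a, near (sigmaA a) (resA a).
Hypothesis sigmaA_inj : forall a, sigmaA a = 0 -> a = 0.

Local Notation "P ^s" := (map_poly sigmaA P) (at level 2, format "P ^s").

Lemma sigmaA_neq0 a : a != 0 -> sigmaA a != 0.
Proof. by apply: contra_neq; apply: sigmaA_inj. Qed.

(** The remainder of the pseudo-division of P by Q is a relation of smaller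
    degree, so it is 0. Thus Q divides the product of P by a power of the
    leading coefficient of Q, and sigmaA does not kill that power. *)
Lemma minimal_root (Q : {poly A}) : Q != 0 -> poly_at Q = 0 ->
  (forall P, poly_at P = 0 -> P != 0 -> (size Q <= size P)%N) ->
  forall P, poly_at P = 0 -> forall r, root Q^s r -> root P^s r.
Proof.
move=> Q0 eQ hmin P eP r rQ.
have := Pdiv.ComRing.rdivp_eq Q P.
set R := Pdiv.Ring.rmodp P Q; set S := Pdiv.Ring.rdivp P Q; set k := _ ^+ _ => e.
have eR : poly_at R = 0.
  have := congr1 poly_at e.
  by rewrite -mul_polyC rmorphM eP mulr0 rmorphD rmorphM eQ mulr0 add0r.
have R0 : R = 0.
  apply/eqP/negPn/negP => R0; have := hmin R eR R0.
  by rewrite leqNgt Pdiv.Ring.ltn_rmodpN0.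
move: e; rewrite R0 addr0 => /(congr1 (map_poly sigmaA)).
rewrite -mul_polyC !rmorphM /= map_polyC => /(congr1 (fun p => p.[r])).
rewrite !hornerM hornerC (rootP rQ) mulr0 => /eqP; rewrite mulf_eq0.
have k0 : k != 0 by apply: (local_expf_neq0 locA); rewrite lead_coef_eq0.
by rewrite (negPf (sigmaA_neq0 k0)).
Qed.

Lemma size_mul_local (P Q : {poly A}) : P != 0 -> Q != 0 ->
  size (P * Q) = (size P + size Q).-1.
Proof.
move=> P0 Q0; apply: size_proper_mul; apply/eqP.
by case/(local_integral locA) => /eqP; rewrite lead_coef_eq0; apply/negP.
Qed.

(** Suppose that r is a common root of the images of Q and of its derivative,
    and let P be a polynomial of least degree whose image vanishes at r; its
    degree is smaller than that of Q. By pseudo-division P divides a constant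
    multiple of Q, so P or the quotient is a relation for th, and the
    minimality of Q leaves only a constant P, which has no root. *)
Lemma minimal_separable (Q : {poly A}) : Q != 0 -> poly_at Q = 0 ->
  (forall P, poly_at P = 0 -> P != 0 -> (size Q <= size P)%N) ->
  forall r, root Q^s r -> ~~ root (Q^`())^s r.
Proof.
move=> Q0 eQ hmin r rQ; apply/negP => rQ'.
have sQ : (1 < size Q)%N.
  rewrite ltnNge; apply/negP => /size1_polyC e; move: eQ Q0; rewrite e poly_atC.
  by move/phi_inj => ->; rewrite polyC0 eqxx.
have Q'0 : Q^`() != 0.
  apply/eqP => /polyP /(_ (size Q).-2); rewrite coef_deriv coef0.
  have -> : (size Q).-2.+1 = (size Q).-1 by lia.
  rewrite -lead_coefE => /(congr1 sigmaA); rewrite rmorphMn rmorph0.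
  have -> : (size Q).-1 = (size Q).-2.+1 by lia.
  rewrite -mulr_natr => /eqP; rewrite mulf_eq0 (negPf (char0 _)) orbF.
  by apply/negP/sigmaA_neq0; rewrite lead_coef_eq0.
pose R n := `[< exists P : {poly A}, [/\ P != 0, root P^s r & size P = n] >].
have exR : exists n, R n by exists (size Q); apply/asboolP; exists Q.
case: (ex_minnP exR) => n /asboolP [P [P0 rP sP]] hminP.
have sPQ : (size P < size Q)%N.
  rewrite sP; apply: (@leq_ltn_trans (size Q^`())); last exact: lt_size_deriv.
  by apply: hminP; apply/asboolP; exists Q^`().
have := Pdiv.ComRing.rdivp_eq P Q.
set T := Pdiv.Ring.rmodp Q P; set S := Pdiv.Ring.rdivp Q P; set k := _ ^+ _ => e.
have rT : root T^s r.
  apply/rootP; have := congr1 (fun p => (map_poly sigmaA p).[r]) e => /=.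
  rewrite -mul_polyC rmorphD !rmorphM /= hornerD !hornerM.
  by rewrite (rootP rQ) (rootP rP) !mulr0 add0r.
have T0 : T = 0.
  apply/eqP/negPn/negP => T0.
  have : (n <= size T)%N by apply: hminP; apply/asboolP; exists T.
  by rewrite leqNgt -sP Pdiv.Ring.ltn_rmodpN0.
move: e; rewrite T0 addr0 => e.
have k0 : k != 0 by apply: (local_expf_neq0 locA); rewrite lead_coef_eq0.
have S0 : S != 0.
  apply/eqP => S0; move: e; rewrite S0 mul0r -mul_polyC => /eqP.
  rewrite -size_poly_eq0 size_mul_local ?polyC_eq0 //.
  by rewrite size_polyC k0 add1n /= size_poly_eq0 (negPf Q0).
have : poly_at S * poly_at P = 0.
  by rewrite -rmorphM -e -mul_polyC rmorphM eQ mulr0.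
case/(local_integral locB) => [eS|eP]; last first.
  by have := hmin P eP P0; rewrite leqNgt sPQ.
have : size (k%:P * Q) = (size S + size P).-1.
  by rewrite mul_polyC e size_mul_local.
rewrite size_mul_local ?polyC_eq0 // size_polyC k0 add1n /=.
have := hmin S eS S0; move=> h1 h2.
have arith (a b c : nat) : (a <= b)%N -> a = (b + c).-1 -> (c <= 1)%N by lia.
have sP1 := arith _ _ _ h1 h2.
move: rP P0; rewrite (size1_polyC sP1) map_polyC rootC polyC_eq0 => /eqP /sigmaA_inj ->.
by rewrite eqxx.
Qed.

(** An extension sigma is determined by sigma th, which is an infinitesimal root
    of the image of the minimal relation Q; conversely each such root defines an
    extension. These roots are simple, and their number is the order c at 0 of
    the reduction of Q. The relation th^e G(th) = t H(th), which expresses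
    that u = G(th) / H(th), reduces to a polynomial of order e, and the
    infinitesimal roots of Q are roots of it: so c <= e. On the other hand
    Q(th) = 0 shows that th^c times a unit is a multiple of t, hence of
    th^e: so e <= c. *)
Theorem count_extensions : exists (e : nat) (u : B) (rs : seq K),
  [/\ resB u != 0, phi t = u * th ^+ e, uniq rs /\ size rs = e,
    forall sigma : {rmorphism B -> K}, (forall a, sigma (phi a) = sigmaA a) ->
      (forall b, near (sigma b) (resB b)) -> sigma th \in rs &
    forall r, r \in rs -> exists sigma : {rmorphism B -> K},
      [/\ forall a, sigma (phi a) = sigmaA a,
          forall b, near (sigma b) (resB b) & sigma th = r]].
Proof.
have [Q [Q0 eQ [i0 hi0] hmin]] := minimal_relation.
have [rt t0 ht] := unif_t; have [rth th0 hth] := unif_th.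
have phit0 : phi t != 0 by apply: contra_neq t0; apply: phi_inj.
have [e [u [u0 eu]]] := hth _ phit0.
have [c [q1 hq1 eq]] := multiplicity_XsubC (map_poly resA Q) 0.
have q0 : map_poly resA Q != 0.
  by apply: contra_neq hi0 => h; rewrite -coef_map h coef0.
move: hq1; rewrite q0 /= rootE horner_coef0 => q10.
rewrite subr0 mulrC in eq.
have nearP (P : {poly A}) i : near (P^s)`_i (map_poly resA P)`_i.
  rewrite !coef_map; exact: near_sigmaA.
have [] := infinitesimal_roots triv (P := Q^s) (n := c) q10.
  by move=> i; rewrite -eq.
move=> rs [Q1 [srs irs eQs nQ1]].
have rootrs r : r \in rs -> root Q^s r.
  by move=> rrs; rewrite eQs rootM (_ : root _ r) // root_prod_XsubC.
(* a repeated entry of rs is a double root of the image of Q *)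
have uniq_rs : uniq rs.
  apply: contraT => /(uniqPn 0) [i [j [ij js eij]]].
  pose r := nth 0 rs i.
  have rrs : r \in rs by apply: mem_nth; apply: ltn_trans js.
  have rrs' : r \in rem r rs.
    rewrite -has_pred1 has_count count_rem rrs /= eqxx subn_gt0.
    have := perm_to_rem rrs.
    rewrite -(cat_take_drop j rs) count_cat.
    have -> : drop j rs = r :: drop j.+1 rs by rewrite (drop_nth 0 js) -eij.
    have : r \in take j rs.
      rewrite /r -(nth_take _ ij); apply: mem_nth.
      by rewrite size_take js.
    by rewrite -has_pred1 has_count /= eqxx; lia.
  have := minimal_separable Q0 eQ hmin (rootrs r rrs).
  have [W eW] : exists W, Q^s = ('X - r%:P) * (('X - r%:P) * W).
    rewrite eQs (big_rem r) //= (big_rem r rrs') /=; eexists.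
    by rewrite -!mulrA.
  rewrite -deriv_map eW derivM rootE hornerD !hornerM hornerXsubC.
  by rewrite subrr !(mul0r, mulr0) addr0 eqxx.
have [G [H [H0 eGH]]] := gen u.
have G0 : resB (poly_at G) != 0 by rewrite -eGH rmorphM mulf_neq0.
(* the relation th^e G(th) - t H(th) = 0 *)
pose P := 'X^e * G - t%:P * H.
have eP : poly_at P = 0.
  by rewrite rmorphB !rmorphM rmorphXn poly_atX poly_atC eu -eGH; ring.
have mP : map_poly resA P = 'X^e * map_poly resA G.
  by rewrite rmorphB !rmorphM /= map_polyXn map_polyC /= rt mul0r subr0.
have [] := infinitesimal_roots triv (P := P^s) (n := e) (p1 := map_poly resA G).
- by move: G0; rewrite res_poly_at coef_map.
- by move=> i; rewrite -mP.
move=> rs' [P1 [srs' irs' ePs nP1]].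
have ce : (c <= e)%N.
  rewrite -srs -srs'; apply: uniq_leq_size => // r rrs.
  have := minimal_root Q0 eQ hmin eP (rootrs r rrs).
  by rewrite ePs rootM (negPf (nP1 _ (irs r rrs))) orbF root_prod_XsubC.
(* below degree c the coefficients of Q are multiples of t, and the coefficient
   of degree c is a unit *)
have ec : (e <= c)%N.
  rewrite leqNgt; apply/negP => lt.
  have hi i : (i < c)%N -> exists d, Q`_i = d * t.
    move=> ic; apply: (uniformizer_mult unif_t).
    by rewrite -coef_map eq coefXnM ic.
  have [w hw] : exists w, poly_at (take_poly c Q) = phi t * w.
    have [d hd] := choice (fun i : 'I_c => hi i (ltn_ord i)).
    exists (poly_at (\sum_i d i *: 'X^i)); rewrite -poly_atC -rmorphM.
    congr (poly_at _); rewrite mul_polyC scaler_sumr /take_poly poly_def.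
    by apply: eq_bigr => i _; rewrite scalerA hd mulrC.
  have := congr1 poly_at (poly_take_drop c Q); rewrite eQ rmorphD hw rmorphM.
  rewrite rmorphXn poly_atX eu -(subnK lt) addnS exprS exprD => h.
  have : (u * (th ^+ (e - c.+1) * th) * w + poly_at (drop_poly c Q)) * th ^+ c = 0.
    by rewrite -h; ring.
  case/(local_integral locB) => [|/eqP]; last first.
    by rewrite (negPf (local_expf_neq0 locB _ th0)).
  move/(congr1 resB); rewrite rmorphD !rmorphM rth !(mulr0, mul0r) add0r rmorph0.
  rewrite res_poly_at coef_drop_poly add0n -coef_map eq coefXnM ltnn subnn => /eqP.
  exact/negP.
have {ce ec} ce : c = e by apply/eqP; rewrite eqn_leq ce.
exists e, u, rs; split=> //; first by rewrite srs.
- move=> sigma hs ns.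
  have : root Q^s (sigma th).
    apply/rootP; rewrite -[RHS](rmorph0 sigma) -eQ /= /horner_morph -horner_map.
    by rewrite -map_poly_comp (eq_map_poly hs).
  rewrite eQs rootM root_prod_XsubC => /orP [//|].
  apply: contraTT => _; apply: nQ1; apply/(near0 iota).
  by rewrite -rth.
- move=> r rrs.
  pose rho : {rmorphism {poly A} -> K} := horner_morph (fun a => mulrC r (sigmaA a)).
  have near_rho S : near (rho S) (resB (poly_at S)).
    rewrite res_poly_at -coef_map -horner_coef0 /= /horner_morph.
    apply: (near_horner triv) => [i|]; first exact: nearP.
    by apply/near0; exact: irs.
  have [|S eS|sigma hs] := localization_hom (ev := poly_at) (rho := rho).
  - move=> b; have [S [T [T0 e']]] := gen b; exists S, T; split=> //.
    exact: near_neq0 (near_rho T) T0.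
  - by apply/eqP; apply: (minimal_root Q0 eQ hmin eS); exact: rootrs.
  exists sigma; split=> [a||].
  - by rewrite -poly_atC hs /= horner_morphC.
  - apply: (near_localization triv (ev := poly_at)) => [b|S].
      by have [S [T ?]] := gen b; exists S, T.
    by rewrite hs.
  - by rewrite -poly_atX hs /= horner_morphX.
Qed.

Lemma extension_unique (sigma sigma' : {rmorphism B -> K}) :
  (forall a, sigma (phi a) = sigmaA a) -> (forall a, sigma' (phi a) = sigmaA a) ->
  (forall b, near (sigma b) (resB b)) -> sigma th = sigma' th ->
  sigma =1 sigma'.
Proof.
move=> h h' ns e; apply: (localization_hom_unique (ev := poly_at)) => [b|P].
  have [S [T [T0 eb]]] := gen b; exists S, T; split=> //.
  exact: near_neq0 (ns _) T0.
rewrite /= /horner_morph -!horner_map -!map_poly_comp e.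
by congr _.[_]; apply: eq_map_poly => a; rewrite /= h h'.
Qed.

End Count.

(** * A generator of a localised finite algebra *)

(** The ring B is the local ring, at a point of the fibre, of an algebra spanned
    over A by the finite family e. *)
Section Generator.
Variables (L : fieldType) (A B : comNzRingType) (phi : {rmorphism A -> B}).
Variables (resA : {rmorphism A -> L}) (resB : {rmorphism B -> L}).
Variable (inA : {rmorphism L -> A}).
Hypothesis locA : local_domain resA.
Hypothesis locB : local_domain resB.
Hypothesis res_phi : forall a, resB (phi a) = resA a.
Hypothesis res_in : forall c, resA (inA c) = c.
Variables (t : A) (s : B).
Hypothesis unif_t : uniformizer resA t.
Hypothesis unif_s : uniformizer resB s.
Variables (k : nat) (e : 'I_k -> B).

Definition fin_span : set B :=
  [set b | exists a : 'I_k -> A, b = \sum_i phi (a i) * e i].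

Hypothesis span1 : fin_span 1.
Hypothesis spanMe : forall i j, fin_span (e i * e j).
Hypothesis frac : forall b, exists p q,
  [/\ fin_span p, fin_span q, resB q != 0 & b * q = p].

Let R := fin_span.

Let R0 : R 0.
Proof. by exists (fun=> 0); rewrite big1 // => i _; rewrite rmorph0 mul0r. Qed.

Let RD x y : R x -> R y -> R (x + y).
Proof.
move=> [a ->] [b ->]; exists (fun i => a i + b i).
by rewrite -big_split; apply: eq_bigr => i _; rewrite rmorphD mulrDl.
Qed.

Let Rphi a x : R x -> R (phi a * x).
Proof.
move=> [b ->]; exists (fun i => a * b i).
by rewrite mulr_sumr; apply: eq_bigr => i _; rewrite rmorphM mulrA.
Qed.

Let RN x : R x -> R (- x).
Proof. by move=> /(Rphi (-1)); rewrite rmorphN rmorph1 mulN1r. Qed.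

Let RB x y : R x -> R y -> R (x - y).
Proof. by move=> hx hy; apply: RD => //; apply: RN. Qed.

Let RM x y : R x -> R y -> R (x * y).
Proof.
move=> [a ->] hy; rewrite mulr_suml; apply: (big_ind R) => // i _.
rewrite -mulrA; apply: Rphi; case: hy => [b ->]; rewrite mulr_sumr.
apply: (big_ind R) => // j _; rewrite mulrCA; apply: Rphi; exact: spanMe.
Qed.

Let RC a : R (phi a). Proof. by rewrite -[phi a]mulr1; apply: Rphi. Qed.

Let Re i : R (e i).
Proof.
exists (fun j => (j == i)%:R); rewrite (bigD1 i) //= eqxx rmorph1 mul1r big1 ?addr0 //.
by move=> j /negPf ->; rewrite rmorph0 mul0r.
Qed.

Let RX x n : R x -> R (x ^+ n).
Proof. by move=> hx; elim: n => [|n IHn]; rewrite ?expr0 // exprS; apply: RM. Qed.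

Let Rpoly x P : R x -> R (poly_at phi x P).
Proof.
move=> hx; elim/poly_ind: P => [|P c IHP]; first by rewrite rmorph0.
by rewrite rmorphD rmorphM poly_atX poly_atC; apply: RD (RC c); apply: RM.
Qed.

(** Cayley-Hamilton: the characteristic polynomial of the multiplication by x on
    the spanning family annihilates every e i, hence 1. *)
Lemma fin_span_integral x : R x -> exists2 P : {poly A}, P \is monic & poly_at phi x P = 0.
Proof.
move=> hx; have [M hM] := choice (fun i => RM hx (Re i)).
exists (char_poly (\matrix_(i, j) M i j)); first exact: char_poly_monic.
rewrite /char_poly -det_map_mx.
set N := map_mx _ _.
have h i : \sum_j N i j * e j = 0.
  under eq_bigr do rewrite !mxE rmorphB rmorphMn poly_atX poly_atC mulrBl.
  rewrite sumrB -hM (bigD1 i) //= eqxx mulr1n big1 => [|j /negPf].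
    by rewrite addr0 subrr.
  by rewrite eq_sym => ->; rewrite mulr0n mul0r.
have {}h i : \det N * e i = 0.
  by rewrite (det_solve h) big1 // => j _; rewrite mulr0.
rewrite -[LHS]mulr1; case: span1 => a ->.
by rewrite mulr_sumr big1 // => i _; rewrite mulrCA h mulr0.
Qed.

Let ev x (F : {poly L}) := poly_at phi x (map_poly inA F).

Lemma common_denominator (f : 'I_k -> B) s0 : R s0 ->
  (forall i, multiples s0 (f i)) ->
  exists q, [/\ R q, resB q = 1 & forall i, exists2 p, R p & q * f i = s0 * p].
Proof.
move=> Rs0 hf; have h i : exists pq : B * B,
    [/\ R pq.1, R pq.2, resB pq.2 != 0 & pq.2 * f i = s0 * pq.1].
  have [g ->] := hf i; have [p [q [Rp Rq q0 eq]]] := frac g.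
  by exists (p, q); split=> //=; rewrite -eq; ring.
have [pq hpq] := choice h.
pose Q := \prod_i (pq i).2.
have RQ : R Q by apply: (big_ind R) => // i _; case: (hpq i).
have Q0 : resB Q != 0.
  by rewrite rmorph_prod; apply/prodf_neq0 => i _; case: (hpq i).
exists (phi (inA (resB Q)^-1) * Q); split.
- exact: Rphi.
- by rewrite rmorphM res_phi res_in mulVf.
move=> i; have [Rp Rq q0 eq] := hpq i.
exists (phi (inA (resB Q)^-1) * (\prod_(j | j != i) (pq j).2 * (pq i).1)).
  apply: Rphi; apply: RM => //; apply: (big_ind R) => // j _; by case: (hpq j).
set c := phi _; rewrite /Q (bigD1 i) //=; set Pi := \prod_(j | _) _.
transitivity (c * Pi * ((pq i).2 * f i)); first by ring.
by rewrite eq; ring.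
Qed.

(** The maximal ideal of the given point, in the finite algebra, is generated by
    th and t. This asks th to be a uniformizer at the point and to be nonzero at
    the other points of the fibre. Let q be a common denominator, with value 1
    at the point, of the quotients by a uniformizer s0 of the functions
    e i - (e i)(point). Modulo t the algebra is finite over L, and mu = 1 - q is
    annihilated by X^r V(X) with V(0) nonzero. The Bezout identity between a
    power of X and V provides ep, a polynomial in mu, that is idempotent
    modulo t, has value 1 at the point and annihilates a power of mu; it singles
    out the component of the point in the fibre. The element th is s0 on this
    component and 1 on the others. *)
Lemma separating_uniformizer :
  exists th, [/\ R th, uniformizer resB th & forall i, exists x y,
    [/\ R x, R y & e i - phi (inA (resB (e i))) = th * x + phi t * y]].
Proof.
have [s0 [Rs0 us0]] : exists s0, R s0 /\ uniformizer resB s0.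
  have [p [q [Rp Rq q0 eq]]] := frac s; exists p; split=> //.
  by rewrite -eq mulrC; apply: uniformizer_unitM.
have [q [Rq q1 hq]] := common_denominator Rs0
  (f := fun i => e i - phi (inA (resB (e i))))
  (fun i => uniformizer_mult us0 (etrans (rmorphB _ _ _)
     (etrans (congr1 (fun z => resB (e i) - z) (etrans (res_phi _) (res_in _)))
       (subrr _)))).
pose mu := 1 - q.
have Rmu : R mu by apply: RB.
have rmu : resB mu = 0 by rewrite rmorphB rmorph1 q1 subrr.
have [P mP eP] := fin_span_integral Rmu.
have [r [V hV eV]] := multiplicity_XsubC (map_poly resA P) 0.
have p0 : map_poly resA P != 0 by rewrite monic_neq0 // monic_map.
move: hV; rewrite p0 subr0 /= in eV * => hV.
(* two extra factors X place 1 - ep in the square of the maximal ideal, so that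
   th remains a uniformizer *)
pose n := r.+2.
have [[U W] /= eUW] : exists u : {poly L} * {poly L}, u.1 * 'X^n + u.2 * V = 1.
  apply/Bezout_eq1_coprimepP; rewrite coprimep_expl //.
  by rewrite -['X]subr0 coprimep_sym -(rmorph0 polyC) coprimep_XsubC.
have evD F G : ev mu (F + G) = ev mu F + ev mu G by rewrite /ev !rmorphD.
have evM F G : ev mu (F * G) = ev mu F * ev mu G by rewrite /ev !rmorphM.
have evXn j : ev mu 'X^j = mu ^+ j.
  by rewrite /ev map_polyXn rmorphXn poly_atX.
have Rev F : R (ev mu F) by apply: Rpoly.
pose T x := exists2 y, R y & x = phi t * y.
have TD x y : T x -> T y -> T (x + y).
  by move=> [a Ra ->] [b Rb ->]; exists (a + b); [exact: RD | rewrite mulrDr].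
have TM x y : R x -> T y -> T (x * y).
  by move=> Rx [a Ra ->]; exists (x * a); [exact: RM | ring].
have Tp : T (ev mu (V * 'X^r)).
  rewrite -eV.
  have h i : exists c, P`_i - inA (resA P`_i) = c * t.
    by apply: (uniformizer_mult unif_t); rewrite rmorphB res_in subrr.
  have [c hc] := choice h.
  pose P' := \poly_(i < size P) c i.
  have eP' : map_poly inA (map_poly resA P) = P - t%:P * P'.
    apply/polyP => i; rewrite coefB coefCM !coef_map [P'`_i]coef_poly /=.
    case: ltnP => si; first by rewrite [t * _]mulrC -hc subKr.
    by rewrite mulr0 subr0 nth_default // !rmorph0.
  exists (- poly_at phi mu P'); first by apply: RN; apply: Rpoly.
  by rewrite /ev eP' rmorphB eP rmorphM poly_atC sub0r mulrN.
pose ep := ev mu (W * V).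
have Rep : R ep by apply: Rev.
have e1 : 1 - ep = ev mu (U * 'X^n).
  apply/eqP; rewrite subr_eq -evD eUW.
  by rewrite /ev map_polyC /= rmorph1 poly_atC rmorph1.
have Tmu : T (ep * mu ^+ n).
  rewrite -evXn -evM (_ : W * V * 'X^n = W * 'X^2 * (V * 'X^r)).
    by rewrite evM; apply: TM.
  by rewrite /n !exprS; ring.
have Tep : T (ep * (1 - ep)).
  by rewrite e1 evM mulrCA evXn; apply: TM.
have [d ed] : multiples s0 mu by apply: uniformizer_mult us0 rmu.
have rep : resB ep = 1.
  have : resB (1 - ep) = 0.
    by rewrite e1 evM evXn rmorphM rmorphXn rmu exprS mul0r mulr0.
  by rewrite rmorphB rmorph1 => /eqP; rewrite subr_eq0 => /eqP.
pose th := s0 * ep + (1 - ep).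
have Rth : R th by apply: RD; [apply: RM | apply: RB].
exists th; split=> //.
  have -> : th = (ep + s0 * (d ^+ 2 * ev mu (U * 'X^r))) * s0.
    rewrite /th e1 evM [ev mu (U * 'X^r)]evM !evXn /n !exprS; set m := mu ^+ r.
    by rewrite ed expr0; ring.
  apply: uniformizer_unitM => //; have [rs0 _ _] := us0.
  by rewrite rmorphD rmorphM rs0 mul0r addr0 rep oner_neq0.
move=> i; have [p Rp epi] := hq i; set f := e i - _ in epi *.
have Rf : R f by apply: RB.
pose g := \sum_(j < n) mu ^+ j.
have Rg : R g by apply: (big_ind R) => // j _; apply: RX.
have ef : f = mu ^+ n * f + s0 * (p * g).
  have := subrX1 mu n; rewrite -/g => /(congr1 ( *%R^~ f)).
  have -> : mu - 1 = - q by rewrite /mu; ring.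
  move=> h; rewrite mulrA -epi -[LHS](subrK (mu ^+ n * f)) addrC; congr (_ + _).
  by move: h; rewrite mulrBl mul1r => h; rewrite -opprB h; ring.
have [y1 Ry1 ey1] := Tmu; have [y2 Ry2 ey2] := Tep.
exists (ep * (p * g) + (1 - ep) * f), (y1 * f - (1 - s0) * y2 * (p * g) + (1 - s0) * y2 * f).
split.
- by apply: RD; apply: RM => //; [apply: RM | apply: RB].
- by apply: RD; [apply: RB|]; repeat (apply: RM || apply: RB || done).
- transitivity (ep * (mu ^+ n * f + s0 * (p * g)) + (1 - ep) * f).
    by rewrite -ef; ring.
  transitivity (th * (ep * (p * g) + (1 - ep) * f) + (phi t * y1) * f
      - (1 - s0) * (phi t * y2) * (p * g) + (1 - s0) * (phi t * y2) * f).
    by rewrite -ey1 -ey2 /th; ring.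
  by ring.
Qed.

(** The maximal ideal being (th, t), there are matrices a and b over A such that
    e = res e + th a e + t b e. The matrix 1 - th a - t b has a determinant
    H(th) of residue 1, and Cramer's rule writes each e i as a fraction with
    denominator H(th). *)
Theorem fin_span_generator : exists th,
  [/\ uniformizer resB th,
      forall b, exists G H : {poly A},
        resB (poly_at phi th H) != 0 /\ b * poly_at phi th H = poly_at phi th G &
      exists2 P : {poly A}, P != 0 & poly_at phi th P = 0].
Proof.
have [th [Rth uth hth]] := separating_uniformizer.
have [P mP eP] := fin_span_integral Rth.
exists th; split=> //; last by exists P => //; apply: monic_neq0.
have h i : exists ab : ('I_k -> A) * ('I_k -> A),
    e i - phi (inA (resB (e i))) =
    th * (\sum_j phi (ab.1 j) * e j) + phi t * (\sum_j phi (ab.2 j) * e j).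
  by have [x [y [[a ->] [b ->] ->]]] := hth i; exists (a, b).
have [ab hab] := choice h.
pose N : 'M[{poly A}]_k :=
  \matrix_(i, j) ((i == j)%:R - ('X * ((ab i).1 j)%:P + (t * (ab i).2 j)%:P)).
pose evt := poly_at phi th.
have evNE i j : evt (N i j) =
    (i == j)%:R - (th * phi ((ab i).1 j) + phi t * phi ((ab i).2 j)).
  rewrite mxE [LHS]rmorphB rmorphMn rmorph1 rmorphD rmorphM /evt.
  by rewrite poly_atX !poly_atC rmorphM.
have evN i : \sum_j (map_mx evt N) i j * e j = phi (inA (resB (e i))).
  under eq_bigr do rewrite mxE evNE mulrBl mulrDl -!mulrA.
  rewrite sumrB big_split /= -!mulr_sumr -hab (bigD1 i) //= eqxx mul1r big1.
    by rewrite addr0 subKr.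
  by move=> j /negPf; rewrite eq_sym => ->; rewrite mul0r.
have [rth _ _] := uth; have [rt _ _] := unif_t.
pose H := \det N.
have rH : resB (evt H) = 1.
  rewrite -det_map_mx -det_map_mx (_ : map_mx _ _ = 1%:M) ?det1 //.
  apply/matrixP => i j; rewrite mxE [X in resB X]mxE evNE.
  rewrite rmorphB rmorphD !rmorphM rth !res_phi rt.
  by rewrite !mul0r addr0 subr0 rmorphMn rmorph1 mxE.
have eH i : exists G, e i * evt H = evt G.
  exists (\sum_j \adj N i j * (inA (resB (e j)))%:P).
  rewrite mulrC -det_map_mx (det_solve evN) rmorph_sum; apply: eq_bigr => j _.
  by rewrite rmorphM poly_atC -map_mx_adj !mxE.
have [G hG] := choice eH.
have RH p : R p -> exists G, p * evt H = evt G.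
  move=> [a ->]; exists (\sum_i (a i)%:P * G i).
  rewrite mulr_suml [RHS]rmorph_sum; apply: eq_bigr => i _.
  by rewrite -mulrA hG rmorphM poly_atC.
move=> b; have [p [q [Rp Rq q0 eq]]] := frac b.
have [Gp ep] := RH p Rp; have [Gq eq'] := RH q Rq; exists Gp, Gq; split.
  by rewrite -/evt -eq' rmorphM rH mulr1.
by rewrite -/evt -ep -eq' -eq mulrA.
Qed.

End Generator.

(** * Flatness over a valuation ring *)

Section Flatness.
Variables (A B : comNzRingType) (phi : {rmorphism A -> B}).
Hypothesis total : forall a b : A, (exists c, a = c * b) \/ (exists c, b = c * a).
Hypothesis torsion_free : forall a b, phi a * b = 0 -> a = 0 \/ b = 0.

Definition spanned k (e : 'I_k -> B) (b : B) : Prop :=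
  exists c : 'I_k -> A, b = \sum_i phi (c i) * e i.

Definition independent k (e : 'I_k -> B) : Prop :=
  forall c : 'I_k -> A, \sum_i phi (c i) * e i = 0 -> forall i, c i = 0.

Lemma least_multiple k (c : 'I_k.+1 -> A) :
  exists i, forall j, exists d, c j = d * c i.
Proof.
elim: k c => [|k IHk] c.
  by exists ord0 => j; exists 1; rewrite mul1r [j]ord1.
have [i hi] := IHk (c \o lift ord0).
have [[d hd]|[d hd]] := total (c ord0) (c (lift ord0 i)).
  exists (lift ord0 i) => j; case: (unliftP ord0 j) => [j'|] ->; last by exists d.
  by have [d' hd'] := hi j'; exists d'.
exists ord0 => j; case: (unliftP ord0 j) => [j'|] ->; last by exists 1; rewrite mul1r.
by have [d' /= ->] := hi j'; exists (d' * d); rewrite hd mulrA.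
Qed.

(** A shortest family whose span contains l is independent: in a linear relation
    some coefficient divides all the others; B being torsion-free, it can be
    cancelled, and the corresponding element of the family is redundant. *)
Lemma independent_cover (l : seq B) : exists k (e : 'I_k -> B),
  independent e /\ forall b, b \in l -> spanned e b.
Proof.
pose P k := `[< exists e : 'I_k -> B, forall b, b \in l -> spanned e b >].
have exP : exists k, P k.
  exists (size l); apply/asboolP; exists (fun i => nth 0 l i) => b bl.
  have il : (index b l < size l)%N by rewrite index_mem.
  exists (fun i => (i == Ordinal il)%:R); rewrite (bigD1 (Ordinal il)) //=.
  rewrite eqxx rmorph1 mul1r nth_index // big1 ?addr0 // => i /negPf ->.
  by rewrite rmorph0 mul0r.
case: (ex_minnP exP) => k /asboolP [e he] hmin; exists k, e; split=> // c hc i.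
case: k e he hmin c hc i => [|k] e he hmin c hc i; first by case: i.
apply: contrapT => ci; have [i0 /choice [d hd]] := least_multiple c.
have ci0 : c i0 <> 0 by move=> h; apply: ci; rewrite hd h mulr0.
have : phi (c i0) * \sum_j phi (d j) * e j = 0.
  rewrite -[RHS]hc mulr_sumr; apply: eq_bigr => j _.
  by rewrite (hd j) rmorphM; ring.
have d1 : d i0 = 1.
  have : phi (c i0) * phi (d i0 - 1) = 0.
    by rewrite -rmorphM mulrBr mulr1 mulrC -hd subrr rmorph0.
  case/torsion_free => // h.
  have : phi (d i0 - 1) * 1 = 0 by rewrite h mul0r.
  case/torsion_free => /eqP; first by rewrite subr_eq0 => /eqP.
  by rewrite oner_eq0.
case/torsion_free => // hd0.
have ei0 : e i0 = \sum_(j < k) phi (- d (lift i0 j)) * e (lift i0 j).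
  move: hd0; rewrite (bigD1_ord i0) //= d1 rmorph1 mul1r => /eqP.
  rewrite addr_eq0 => /eqP ->; rewrite -sumrN; apply: eq_bigr => j _.
  by rewrite rmorphN mulNr.
suff: (k.+1 <= k)%N by rewrite ltnn.
apply: hmin; apply/asboolP; exists (e \o lift i0) => b /he [a ->].
exists (fun j => a (lift i0 j) - a i0 * d (lift i0 j)).
rewrite (bigD1_ord i0) //= ei0 mulr_sumr -big_split; apply: eq_bigr => j _ /=.
by rewrite rmorphB rmorphN rmorphM; ring.
Qed.

Section Coordinates.
Variables (k : nat) (e : 'I_k -> B) (ind_e : independent e).
Variable coord : B -> 'I_k -> A.
Hypothesis coordP : forall b, spanned e b -> b = \sum_i phi (coord b i) * e i.

Lemma coord_unique b c i : b = \sum_i phi (c i) * e i -> coord b i = c i.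
Proof.
move=> eb; apply/eqP; rewrite -subr_eq0; apply/eqP.
apply: (ind_e (c := fun i => coord b i - c i)).
under eq_bigr do rewrite rmorphB mulrBl.
rewrite sumrB -eb -coordP ?subrr //; by exists c.
Qed.

(** Tensors with right factors in the span of e have a normal form, so equality
    of coordinates implies equality of tensors. *)
Lemma tensor_expand (N : lmodType A) (s : seq (N * B)) :
  (forall p, p \in [seq q.2 | q <- s] -> spanned e p) ->
  tensor_eq phi s
    [seq (\sum_(p <- s) coord p.2 i *: p.1, e i) | i <- enum 'I_k].
Proof.
have merge (f g : 'I_k -> N) r : tensor_eq phi
    ([seq (f i, e i) | i <- r] ++ [seq (g i, e i) | i <- r])
    [seq (f i + g i, e i) | i <- r].
  elim: r => [|i r IHr] /=; first exact: te_refl.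
  apply: (@te_trans _ _ _ _ _ ([:: (f i, e i); (g i, e i)] ++
    ([seq (f i, e i) | i <- r] ++ [seq (g i, e i) | i <- r]))).
    rewrite -[X in tensor_eq _ X _]cat1s; apply: (te_cat (s := [:: _]) (te_refl _ _)).
    rewrite -cat1s catA -[X in tensor_eq _ _ X]cat1s [X in tensor_eq _ _ X]catA.
    by apply: te_cat; [apply: te_comm | apply: te_refl].
  rewrite -[X in tensor_eq _ _ X]cat1s; apply: te_cat IHr.
  by apply: te_sym; apply: te_addl.
have single (n : N) (c : 'I_k -> A) r : tensor_eq phi
    [:: (n, \sum_(i <- r) phi (c i) * e i)] [seq (c i *: n, e i) | i <- r].
  elim: r => [|i r IHr] /=.
    rewrite big_nil; apply: te_trans (te_zero _ _ 0).
    rewrite -[X in (n, X)](mul0r (0 : B)) -[X in X * _](rmorph0 phi).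
    by rewrite -[X in (X, 0)](scale0r n); apply: te_sym; apply: te_scale.
  rewrite big_cons; apply: te_trans (te_addr _ _ _ _) _.
  rewrite -[X in tensor_eq _ X _]cat1s -[X in tensor_eq _ _ X]cat1s.
  by apply: te_cat IHr; apply: te_sym; apply: te_scale.
have zero r : tensor_eq phi [::] [seq (0 : N, e i) | i <- r].
  elim: r => [|i r IHr]; first exact: te_refl.
  rewrite -[X in tensor_eq _ X _]cat0s [X in tensor_eq _ _ X]/=.
  rewrite -[X in tensor_eq _ _ X]cat1s; apply: te_cat IHr.
  by apply: te_sym; apply: te_zero.
elim: s => [|[n b] s IHs] h.
  by under eq_map do rewrite big_nil; apply: zero.
under eq_map do rewrite big_cons /=.
apply: te_trans (merge _ _ _); rewrite -cat1s; apply: te_cat.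
  have {1}-> := coordP (h b (mem_head _ _)).
  by rewrite -big_enum; apply: single.
by apply: IHs => p ps; apply: h; rewrite inE ps orbT.
Qed.

End Coordinates.

(** A derivation of an equality of tensors involves finitely many elements of B.
    Coordinates are additive and A-linear on the span of an independent family;
    so they are preserved by each step as soon as that span contains these
    elements. *)
Lemma tensor_eq_coord (N : lmodType A) (s t : seq (N * B)) : tensor_eq phi s t ->
  exists l : seq B, forall k (e : 'I_k -> B), independent e ->
    (forall b, b \in l -> spanned e b) ->
    forall coord : B -> 'I_k -> A,
    (forall b, spanned e b -> b = \sum_i phi (coord b i) * e i) ->
    forall i, \sum_(p <- s) coord p.2 i *: p.1 = \sum_(p <- t) coord p.2 i *: p.1.
Proof.
elim=> {s t}.
- by move=> s; exists [::].
- by move=> s t _ [l hl]; exists l => k e ie le co hco i; rewrite (hl k e).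
- move=> s t u _ [l hl] _ [l' hl']; exists (l ++ l') => k e ie le co hco i.
  rewrite (hl k e) // => [|b bl]; last by apply: le; rewrite mem_cat bl.
  by apply: (hl' k e) => // b bl; apply: le; rewrite mem_cat bl orbT.
- move=> s s' t t' _ [l hl] _ [l' hl']; exists (l ++ l') => k e ie le co hco i.
  rewrite !big_cat /= (hl k e) // => [|b bl]; last by apply: le; rewrite mem_cat bl.
  congr (_ + _).
  by apply: (hl' k e) => // b bl; apply: le; rewrite mem_cat bl orbT.
- by move=> s t; exists [::] => k e ie le co hco i; rewrite !big_cat /= addrC.
- move=> n n' b; exists [::] => k e ie le co hco i.
  by rewrite !big_cons !big_nil /= !addr0 scalerDr.
- move=> n b b'; exists [:: b; b'] => k e ie le co hco i.
  rewrite !big_cons !big_nil /= !addr0 -scalerDl; congr (_ *: _).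
  apply: (coord_unique ie hco (c := fun i => co b i + co b' i)).
  have eb := hco b (le b (mem_head _ _)).
  have eb' : b' = \sum_i phi (co b' i) * e i.
    by apply: hco; apply: le; rewrite !inE eqxx orbT.
  rewrite {1}eb {1}eb'.
  by rewrite -big_split; apply: eq_bigr => j _; rewrite rmorphD mulrDl.
- move=> b; exists [::] => k e ie le co hco i.
  by rewrite big_cons !big_nil /= scaler0 addr0.
- move=> a n b; exists [:: b] => k e ie le co hco i.
  rewrite !big_cons !big_nil /= !addr0 scalerA; congr (_ *: _); apply/esym.
  apply: (coord_unique ie hco (c := fun i => co b i * a)).
  have {1}-> := hco b (le b (mem_head _ _)); rewrite mulr_sumr.
  by apply: eq_bigr => j _; rewrite rmorphM; ring.
Qed.

(** Both tensors live over a finitely generated, hence free, submodule of B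
    that also supports the given equality. There they are compared through
    their coordinates, on which u acts injectively. *)
Theorem torsion_free_flat : flat phi.
Proof.
move=> N' N u inj_u s t /tensor_eq_coord [l hl].
have [k [e [ie le]]] := independent_cover
  (l ++ ([seq p.2 | p <- s] ++ [seq p.2 | p <- t])).
have ex_coord b : exists c : 'I_k -> A, spanned e b -> b = \sum_i phi (c i) * e i.
  have [[c eb]|nb] := pselect (spanned e b); first by exists c.
  by exists (fun=> 0) => /nb.
have [co hco] := choice ex_coord.
have ls p : p \in [seq q.2 | q <- s] -> spanned e p.
  by move=> ps; apply: le; rewrite !mem_cat ps !orbT.
have lt p : p \in [seq q.2 | q <- t] -> spanned e p.
  by move=> ps; apply: le; rewrite !mem_cat ps !orbT.
apply: te_trans (tensor_expand hco ls) _.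
apply: te_trans (te_sym (tensor_expand hco lt)).
have ll b : b \in l -> spanned e b by move=> bl; apply: le; rewrite mem_cat bl.
have eq i : \sum_(p <- s) co p.2 i *: p.1 = \sum_(p <- t) co p.2 i *: p.1.
  have := hl k e ie ll co hco i; rewrite !big_map /= => h.
  apply: inj_u; rewrite !linear_sum.
  under eq_bigr do rewrite linearZ.
  by under [RHS]eq_bigr do rewrite linearZ.
by under eq_map do rewrite eq; apply: te_refl.
Qed.

End Flatness.

(** * Stalks of an irreducible space *)

Section Stalk.
Variables (L : fieldType) (X : funSpace L).

Lemma zopen_neq0 d (f : X -> L) : form d f -> zopen [set y | f y != 0].
Proof.
move=> fd; exists [set f]; split=> [_ ->|]; first by exists d.
apply/seteqP; split=> y /=; first by move=> h _ ->; apply/eqP/negPn/negP.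
by move=> h; rewrite (h f erefl) eqxx.
Qed.

(** The identity principle: the zero set of f and the complement of U are closed
    and cover the irreducible space X. *)
Lemma form_eq0 (irrX : irreducible_set [set: X]) d (f : X -> L) (U : set X) x :
  form d f -> zopen U -> U x -> (forall y, U y -> f y = 0) -> forall y, f y = 0.
Proof.
move=> fd oU Ux hf.
have cf : zclosed [set y | f y = 0].
  exists [set f]; split=> [_ ->|]; first by exists d.
  by apply/seteqP; split=> y /= => [h _ ->|/(_ f erefl)].
case: (irrX.2 _ _ cf oU) => [y _|h y|h].
- by have [Uy|nUy] := pselect (U y); [left; apply: hf | right].
- exact: h.
- by have := h x I.
Qed.

Variable x : X.

Lemma germP (phi psi : regular_fun x) :
  germ phi = germ psi <-> exists U, [/\ zopen U, U x & forall y, U y -> phi y = psi y].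
Proof.
have -> : germ phi = germ psi <-> phi - psi \in @zero_germ L X x.
  by rewrite Quotient.idealrBE; split=> /eqP.
split=> [/asboolP|] [U [oU Ux h]].
  by exists U; split=> // y /h /eqP; rewrite subr_eq0 => /eqP.
by apply/asboolP; exists U; split=> // y /h e; apply/eqP; rewrite subr_eq0; apply/eqP.
Qed.

Lemma stalk_germ (s : stalk x) : exists phi, s = germ phi.
Proof. by exists (repr s); rewrite /germ reprK. Qed.

Definition germ_hom : {rmorphism regular_fun x -> stalk x} :=
  \pi_({ideal_quot (@zero_germ L X x)})%qT.

Lemma germ_homE phi : germ_hom phi = germ phi. Proof. by []. Qed.

Definition residue_fun (s : stalk x) : L := repr s x.

Lemma residue_germ phi : residue_fun (germ phi) = phi x.
Proof.
have /germP [U [_ Ux h]] : germ (repr (germ phi)) = germ phi by rewrite /germ reprK.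
exact: h.
Qed.

Lemma residue_zmod : zmod_morphism residue_fun.
Proof.
move=> s t; have [phi ->] := stalk_germ s; have [psi ->] := stalk_germ t.
by rewrite -!germ_homE -rmorphB !germ_homE !residue_germ.
Qed.

Lemma residue_monoid : monoid_morphism residue_fun.
Proof.
split=> [|s t].
  by rewrite -(rmorph1 germ_hom) germ_homE residue_germ.
have [phi ->] := stalk_germ s; have [psi ->] := stalk_germ t.
by rewrite -!germ_homE -rmorphM !germ_homE !residue_germ.
Qed.

HB.instance Definition _ :=
  GRing.isZmodMorphism.Build (stalk x) L residue_fun residue_zmod.
HB.instance Definition _ :=
  GRing.isMonoidMorphism.Build (stalk x) L residue_fun residue_monoid.

Definition residue : {rmorphism stalk x -> L} := residue_fun.

Lemma residueE phi : residue (germ phi) = phi x.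
Proof. exact: residue_germ. Qed.

Lemma max_idealE : @max_ideal L X x = [set b | residue b = 0].
Proof.
apply/seteqP; split=> [_ [phi -> h]|b /= h]; first by rewrite /= residueE.
by have [phi e] := stalk_germ b; exists phi; rewrite // -residueE -e.
Qed.

(** If a product of germs is zero, the product of the numerators vanishes near x,
    hence everywhere, and by irreducibility one numerator is zero. *)
Lemma stalk_local_domain : irreducible_set [set: X] -> local_domain residue.
Proof.
move=> irrX; split=> [b|a b].
  have [phi ->] := stalk_germ b; rewrite residueE => px.
  have /asboolP [U [oU Ux [d [f [g [fd gd h]]]]]] := regvalP phi.
  have V_open : zopen (U `&` [set y | f y != 0]).
    by apply: zopenI => //; apply: zopen_neq0 fd.
  have Vx : (U `&` [set y | f y != 0]) x.
    split=> //=; apply: contra_neq px => fx.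
    by have [_ ->] := h x Ux; rewrite fx mul0r.
  have rp : (fun y => (phi y)^-1) \in regular_pred x.
    apply/asboolP; exists (U `&` [set y | f y != 0]); split=> //.
    exists d, g, f; split=> // y [/h [gy ->] fy]; split=> //.
    by rewrite invfM invrK mulrC.
  exists (germ (RegularFun rp)); rewrite -!germ_homE -rmorphM -(rmorph1 germ_hom).
  apply/germP; exists (U `&` [set y | f y != 0]); split=> // y [/h [gy e] fy].
  have -> : (phi * RegularFun rp) y = phi y * (phi y)^-1 by [].
  by rewrite mulfV // e mulf_neq0 // invr_eq0.
have [phi ->] := stalk_germ a; have [psi ->] := stalk_germ b.
rewrite -!germ_homE -rmorphM -(rmorph0 germ_hom) => /germP [W [oW Wx hW]].
have /asboolP [U [oU Ux [d [f [g [fd gd hf]]]]]] := regvalP phi.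
have /asboolP [V [oV Vx [d' [f' [g' [fd' gd' hf']]]]]] := regvalP psi.
have ff y : f y * f' y = 0.
  apply: (form_eq0 irrX (formM fd fd') (zopenI oW (zopenI oU oV)) (x := x)) => //.
  move=> {}y [Wy [/hf [gy ey] /hf' [gy' ey']]].
  have := hW y Wy; have -> : (phi * psi) y = phi y * psi y by [].
  rewrite ey ey' mulf_div => /eqP; rewrite mulf_eq0 invr_eq0.
  by rewrite (negPf (mulf_neq0 gy gy')) orbF => /eqP.
have closed_zero e h : form e h -> zclosed [set y : X | h y = 0].
  move=> he; exists [set h]; split=> [_ ->|]; first by exists e.
  by apply/seteqP; split=> y /= => [hy _ ->|/(_ h erefl)].
case: (irrX.2 _ _ (closed_zero _ _ fd) (closed_zero _ _ fd')) => [y _|h|h].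
- by have /eqP := ff y; rewrite mulf_eq0 => /orP [] /eqP; [left|right].
- left; apply/germP; exists U; split=> // y Uy.
  by have [_ ->] := hf y Uy; rewrite (h y) // mul0r.
- right; apply/germP; exists V; split=> // y Vy.
  by have [_ ->] := hf' y Vy; rewrite (h y) // mul0r.
Qed.

End Stalk.

(** * Affine charts of projective sets *)

Lemma mmap_const (R : nzRingType) (S : comNzRingType) n (j : {rmorphism R -> S})
  (Y : 'I_n -> S) c : mmap j Y c%:MP = j c.
Proof. exact: mmapC. Qed.

(** Homogeneous coordinates co for which the forms are the polynomials in G. The
    affine coordinates are the quotients of the coordinates i and pi i: for a
    projective space pi is constant, for a product of two it is constant on each
    block. By the last condition, this division multiplies all the monomials of
    a form by the same factor. *)
Record chart (L : fieldType) (X : funSpace L) N (co : X -> 'I_N -> L)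
    (G : deg X -> set {mpoly L[N]}) (pi : 'I_N -> 'I_N) : Prop := Chart {
  chart_form : forall d f,
    form d f <-> exists2 p, G d p & f = (fun y => p.@[co y]);
  chart_const : forall c, G 0 c%:MP;
  chart_add : forall d p q, G d p -> G d q -> G d (p + q);
  chart_mul : forall d e p q, G d p -> G e q -> G (d + e) (p * q);
  chart_pivot : forall i, exists d, G d 'X_i /\ G d 'X_(pi i);
  chart_scale : forall d, exists w : 'I_N -> nat, forall p m, G d p -> m \in msupp p ->
    forall (R : comNzRingType) (Y : 'I_N -> R),
      \prod_i Y (pi i) ^+ m i = \prod_i Y (pi i) ^+ w i
}.

Section Chart.
Variables (L : fieldType) (X : funSpace L) (N : nat) (co : X -> 'I_N -> L).
Variables (G : deg X -> set {mpoly L[N]}) (pi : 'I_N -> 'I_N).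
Hypothesis ch : chart co G pi.

Lemma chart_subspace (V : set X) :
  @chart L (subspace V) N (fun y => co (val y)) G pi.
Proof.
have [h1 h2 h3 h4 h5 h6] := ch.
apply: (@Chart L (subspace V) N _ G pi _ h2 h3 h4 h5 h6) => d f; split.
  by move=> [g /h1 [p Gp ->] <-]; exists p.
by move=> [p Gp ->]; exists (fun y => p.@[co y]) => //; apply/h1; exists p.
Qed.

Definition chart_domain : set X := [set y | forall i, co y (pi i) != 0].

Definition ratio (R : fieldType) (Y : 'I_N -> R) (i : 'I_N) : R := Y i / Y (pi i).

Lemma form_eval d p : G d p -> form d (fun y => p.@[co y]).
Proof. by move=> Gp; apply/(chart_form ch); exists p. Qed.

Lemma form_coord i : exists d,
  form d (fun y => co y i) /\ form d (fun y => co y (pi i)).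
Proof.
have [d [h1 h2]] := chart_pivot ch i; exists d.
by split; apply/(chart_form ch); [exists 'X_i|exists 'X_(pi i)] => //;
  apply/funext => y; rewrite mevalXU.
Qed.

Lemma chart_domain_open : zopen chart_domain.
Proof.
have -> : chart_domain =
    [set y | forall i, i \in enum 'I_N -> co y (pi i) != 0].
  by apply/seteqP; split=> y h i //; apply: h; rewrite mem_enum.
elim: (enum 'I_N) => [|i s IHs].
  rewrite (_ : [set y | _] = setT); first exact: zopenT.
  by apply/seteqP.
have [d [_ fd]] := form_coord i.
rewrite (_ : [set y | _] = [set y | co y (pi i) != 0] `&`
    [set y | forall i, i \in s -> co y (pi i) != 0]).
  by apply: zopenI IHs; apply: zopen_neq0 fd.
apply/seteqP; split=> y h /=.
  by split=> [|j js]; apply: h; rewrite inE ?eqxx ?js ?orbT.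
by case: h => h1 h2 j; rewrite inE => /predU1P [->|/h2].
Qed.

Lemma eval_homogeneous d : exists w : 'I_N -> nat, forall p, G d p ->
  forall (R : fieldType) (j : {rmorphism L -> R}) (Y : 'I_N -> R),
  (forall i, Y (pi i) != 0) ->
  mmap j Y p = \prod_i Y (pi i) ^+ w i * mmap j (ratio Y) p.
Proof.
have [w hw] := chart_scale ch d; exists w => p Gp R j Y Y0.
rewrite /mmap mulr_sumr big_seq [RHS]big_seq; apply: eq_bigr => m mp.
rewrite mulrCA; congr (_ * _); rewrite -(hw _ _ Gp mp) /mmap1 -big_split.
by apply: eq_bigr => i _ /=; rewrite -exprMn /ratio mulrC mulfVK.
Qed.

(** The equation holds over every field that contains L, so the same p and q
    serve for the points over L and for those over K. *)
Lemma homogenize P : exists d p q, [/\ G d p, G d q &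
  forall (R : fieldType) (j : {rmorphism L -> R}) (Y : 'I_N -> R),
  (forall i, Y (pi i) != 0) ->
  mmap j Y q != 0 /\ mmap j Y p = mmap j Y q * mmap j (ratio Y) P].
Proof.
elim/mpoly_gen: P => [c|i|P Q|P Q].
- exists 0, c%:MP, 1%:MP; split; try exact: (chart_const ch).
  by move=> R j Y _; rewrite !mmap_const rmorph1 oner_neq0 mul1r.
- have [d [h1 h2]] := chart_pivot ch i; exists d, 'X_i, 'X_(pi i); split=> //.
  move=> R j Y Y0; rewrite !mmapX !mmap1U; split=> //.
  by rewrite /ratio mulrC mulfVK.
- move=> [d [p [q [Gp Gq h]]]] [d' [p' [q' [Gp' Gq' h']]]].
  exists (d + d'), (p * q' + q * p'), (q * q'); split.
  + by apply: (chart_add ch); apply: (chart_mul ch).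
  + exact: (chart_mul ch).
  + move=> R j Y Y0; have [q0 e] := h R j Y Y0; have [q0' e'] := h' R j Y Y0.
    rewrite rmorphD !rmorphM; split; first by rewrite mulf_neq0.
    by rewrite /= e e' (rmorphD (mmap j (ratio Y))) /=; ring.
- move=> [d [p [q [Gp Gq h]]]] [d' [p' [q' [Gp' Gq' h']]]].
  exists (d + d'), (p * p'), (q * q'); split; try exact: (chart_mul ch).
  move=> R j Y Y0; have [q0 e] := h R j Y Y0; have [q0' e'] := h' R j Y Y0.
  rewrite !rmorphM; split; first by rewrite mulf_neq0.
  by rewrite /= e e'; ring.
Qed.

Definition affc (y : X) : 'I_N -> L := ratio (co y).

Lemma form_affc d : exists c : X -> L, (forall y, chart_domain y -> c y != 0) /\
  forall f, form d f -> exists P : {mpoly L[N]},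
    forall y, chart_domain y -> f y = c y * P.@[affc y].
Proof.
have [w hw] := eval_homogeneous d; exists (fun y => \prod_i co y (pi i) ^+ w i).
split=> [y Uy|f /(chart_form ch) [p Gp ->]].
  by apply/prodf_neq0 => i _; apply: expf_neq0.
by exists p => y Uy; apply: (hw p Gp L idfun).
Qed.

Lemma eval_form P : exists d f g, [/\ form d f, form d g &
  forall y, chart_domain y -> g y != 0 /\ f y = g y * P.@[affc y]].
Proof.
have [d [p [q [Gp Gq h]]]] := homogenize P.
exists d, (fun y => p.@[co y]), (fun y => q.@[co y]); split; try exact: form_eval.
by move=> y Uy; apply: (h L idfun).
Qed.

Lemma zopen_eval_neq0 P : zopen [set y | chart_domain y /\ P.@[affc y] != 0].
Proof.
have [d [f [g [fd gd h]]]] := eval_form P.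
rewrite (_ : [set y | _] = chart_domain `&` [set y | f y != 0]).
  by apply: zopenI; [apply: chart_domain_open | apply: zopen_neq0 fd].
apply/seteqP; split=> y [Uy /= n0]; split=> //; have [g0 e] := h y Uy.
  by rewrite e mulf_neq0.
by move: n0; rewrite e mulf_eq0 (negPf g0).
Qed.

Lemma eval_regular P y : chart_domain y -> regular_at (fun y => P.@[affc y]) y.
Proof.
move=> Uy; have [d [f [g [fd gd h]]]] := eval_form P.
exists chart_domain; split=> //; first exact: chart_domain_open.
by exists d, f, g; split=> // z /h [g0 ->]; rewrite mulrC mulKf.
Qed.

Section Point.
Variables (x : X) (Ux : chart_domain x).

Lemma eval_subproof P : (fun y => P.@[affc y]) \in regular_pred x.
Proof. by apply/asboolP; apply: eval_regular. Qed.

Definition chart_germ (P : {mpoly L[N]}) : stalk x :=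
  germ (RegularFun (eval_subproof P)).

Lemma chart_germ_zmod : zmod_morphism chart_germ.
Proof.
move=> P Q; rewrite /chart_germ -!germ_homE -rmorphB; congr (germ_hom x _).
by apply: val_inj; apply/funext => y /=; rewrite mevalB.
Qed.

Lemma chart_germ_monoid : monoid_morphism chart_germ.
Proof.
split=> [|P Q]; rewrite /chart_germ -!germ_homE.
  rewrite -(rmorph1 (germ_hom x)); congr (germ_hom x _).
  by apply: val_inj; apply/funext => y /=; rewrite meval1.
rewrite -rmorphM; congr (germ_hom x _).
by apply: val_inj; apply/funext => y /=; rewrite mevalM.
Qed.

HB.instance Definition _ :=
  GRing.isZmodMorphism.Build {mpoly L[N]} (stalk x) chart_germ chart_germ_zmod.
HB.instance Definition _ :=
  GRing.isMonoidMorphism.Build {mpoly L[N]} (stalk x) chart_germ chart_germ_monoid.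

Definition evg : {rmorphism {mpoly L[N]} -> stalk x} := chart_germ.

Lemma residue_evg P : residue x (evg P) = P.@[affc x].
Proof. exact: residueE. Qed.

Lemma evg_eqP P (phi : regular_fun x) : (exists U, [/\ zopen U, U x &
    forall y, U y -> chart_domain y -> phi y = P.@[affc y]]) -> germ phi = evg P.
Proof.
move=> [U [oU Uy h]]; apply/germP; exists (U `&` chart_domain).
split=> //; first by apply: zopenI => //; exact: chart_domain_open.
by move=> y [? ?]; apply: h.
Qed.

Lemma evg_frac b : exists P Q, residue x (evg Q) != 0 /\ b * evg Q = evg P.
Proof.
have [phi ->] := stalk_germ b.
have /asboolP [U [oU Uy [d [f [g [fd gd h]]]]]] := regvalP phi.
have [c [c0 hc]] := form_affc d.
have [P hP] := hc f fd; have [Q hQ] := hc g gd; exists P, Q; split.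
  have [g0 _] := h x Uy; rewrite residue_evg; apply: contra_neq g0 => q0.
  by rewrite hQ // q0 mulr0.
rewrite -germ_homE -rmorphM; apply: evg_eqP; exists U; split=> // y /h [g0 e] cy.
have -> : (phi * RegularFun (eval_subproof Q)) y = phi y * Q.@[affc y] by [].
rewrite e hP // hQ //; field; move: g0; rewrite hQ // mulf_eq0 negb_or.
by case/andP => -> ->.
Qed.

(** The identity principle, applied to the numerator of P as a quotient of
    forms. *)
Lemma evg_eq0 (irrX : irreducible_set [set: X]) P : evg P = 0 ->
  forall y, chart_domain y -> P.@[affc y] = 0.
Proof.
rewrite -(rmorph0 (germ_hom x)) => /germP [U [oU Uy h]].
have [d [f [g [fd gd hf]]]] := eval_form P.
have f0 y : f y = 0.
  apply: (form_eq0 irrX fd (zopenI oU chart_domain_open) (x := x)) => //.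
  by move=> {}y [/h e /hf [_ ->]]; rewrite -[P.@[_]]/(RegularFun (eval_subproof P) y) e mulr0.
move=> y Cy; have [g0 e] := hf y Cy; apply/eqP.
by have /eqP := e; rewrite f0 eq_sym mulf_eq0 (negPf g0).
Qed.

Lemma evg_eval0 P : (forall y, chart_domain y -> P.@[affc y] = 0) -> evg P = 0.
Proof.
move=> h; rewrite -(rmorph0 (germ_hom x)) germ_homE; apply/esym/evg_eqP.
by exists setT; split=> //; [exact: zopenT | move=> y _ /h ->].
Qed.

Definition local_coord (i : 'I_N) : stalk x := evg ('X_i - (affc x i)%:MP).

Lemma residue_local_coord i : residue x (local_coord i) = 0.
Proof. by rewrite residue_evg mevalB mevalXU mevalC subrr. Qed.

End Point.
End Chart.

Lemma mpoly_taylor (R : comNzRingType) N (c : 'I_N -> R) P :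
  exists g : 'I_N -> {mpoly R[N]}, P - P.@[c]%:MP = \sum_i g i * ('X_i - (c i)%:MP).
Proof.
elim/mpoly_gen: P => [a|i|P Q [g hg] [g' hg']|P Q [g hg] [g' hg']].
- exists (fun=> 0); rewrite mevalC subrr big1 // => i _; exact: mul0r.
- exists (fun j => (j == i)%:R); rewrite mevalXU (bigD1 i) //= eqxx mul1r.
  by rewrite big1 ?addr0 // => j /negPf ->; rewrite mul0r.
- exists (fun i => g i + g' i); rewrite mevalD mpolyCD opprD addrACA hg hg'.
  by rewrite -big_split; apply: eq_bigr => i _; rewrite mulrDl.
- exists (fun i => Q * g i + P.@[c]%:MP * g' i); rewrite mevalM mpolyCM.
  transitivity (Q * (P - P.@[c]%:MP) + P.@[c]%:MP * (Q - Q.@[c]%:MP)).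
    by ring.
  rewrite hg hg' !mulr_sumr -big_split; apply: eq_bigr => i _ /=.
  by ring.
Qed.

Section ChartLocal.
Variables (L : fieldType) (X : funSpace L) (N : nat) (co : X -> 'I_N -> L).
Variables (G : deg X -> set {mpoly L[N]}) (pi : 'I_N -> 'I_N).
Hypothesis ch : chart co G pi.
Hypothesis irrX : irreducible_set [set: X].
Variables (x : X) (Ux : chart_domain co pi x).
Local Notation ev := (evg ch Ux).
Local Notation zeta := (local_coord ch Ux).

Lemma local_coord_gen b : residue x b = 0 ->
  exists c : 'I_N -> stalk x, b = \sum_i c i * zeta i.
Proof.
move=> rb; have [P [Q [Q0 e]]] := evg_frac ch Ux b.
have [w hw] := local_unit (stalk_local_domain x irrX) Q0.
have [g hg] := mpoly_taylor (affc co pi x) P.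
have Px : P.@[affc co pi x] = 0.
  by rewrite -(residue_evg ch Ux) -e rmorphM rb mul0r.
exists (fun i => w * ev (g i)).
have -> : b = w * (b * ev Q) by rewrite mulrCA [w * _]mulrC hw mulr1.
rewrite e -[P]subr0 -(mpolyC0 N L) -Px hg rmorph_sum mulr_sumr.
by apply: eq_bigr => i _; rewrite rmorphM mulrA.
Qed.

Lemma stalk_noeth : noeth (stalk x).
Proof.
apply: (noeth_localization (stalk_local_domain x irrX) (ev := ev)).
  exact: noeth_mpoly.
exact: evg_frac.
Qed.

Lemma nonsingular_uniformizer : curve X -> nonsingular x ->
  exists s, uniformizer (residue x) s.
Proof.
move=> [_ dX] [d dX' cd].
have {dX dX'} d1 : d = 1%N by apply: max_chain_length_unique dX' dX.
rewrite d1 max_idealE in cd.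
apply: (uniformizer_exists (stalk_local_domain x irrX) stalk_noeth) cd.
  exact: (residue_local_coord ch Ux).
exact: local_coord_gen.
Qed.

End ChartLocal.

(** * Points of projective space *)

Section ProjPoint.
Variables (R : fieldType) (n : nat).
Implicit Types (p q : proj R n).

Lemma dim_line p : \dim (line p) = 1%N.
Proof. by case: p => l /= /eqP. Qed.

Lemma vpick_neq0 p : vpick p != 0.
Proof. by rewrite vpick0 -dimv_eq0 dim_line. Qed.

Lemma line_vpick p : line p = <[vpick p]>%VS.
Proof.
apply/esym/eqP; rewrite eqEdim; apply/andP; split.
  by rewrite -memvE memv_pick.
by rewrite dim_vline vpick_neq0 dim_line.
Qed.

Lemma line_inj p q : line p = line q -> p = q.
Proof.
case: p q => [l hl] [l' hl'] /= e; move: hl hl'; rewrite e => hl hl'.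
by congr Proj; apply: eq_irrelevance.
Qed.

Lemma coord_pivot p : exists i, coord p i != 0.
Proof.
apply: contrapT => /forallNP h; have /negP := vpick_neq0 p; apply.
by apply/eqP/rowP => i; rewrite mxE; apply/eqP/negPn/negP; apply: h.
Qed.

Lemma mem_line_ratio p (x : 'rV[R]_n.+1) i0 : x \in line p -> x ord0 i0 != 0 ->
  coord p i0 != 0 /\ forall i, coord p i / coord p i0 = x ord0 i / x ord0 i0.
Proof.
rewrite line_vpick => /vlineP [a ->]; rewrite mxE mulf_eq0 negb_or => /andP [a0 p0].
by split=> // i; rewrite !mxE /coord -mulf_div mulfV // mul1r.
Qed.

Lemma line_of_ratio p (x : 'rV[R]_n.+1) i0 : coord p i0 != 0 ->
  (forall i, x ord0 i = x ord0 i0 * (coord p i / coord p i0)) -> x \in line p.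
Proof.
move=> p0 h; rewrite line_vpick; apply/vlineP; exists (x ord0 i0 / coord p i0).
by apply/rowP => i; rewrite [LHS]h mxE mulrA mulrAC.
Qed.

Lemma proj_eq_ratio p q i0 : coord p i0 != 0 -> coord q i0 != 0 ->
  (forall i, coord p i / coord p i0 = coord q i / coord q i0) -> p = q.
Proof.
move=> p0 q0 h; apply: line_inj; apply/eqP; rewrite eqEdim; apply/andP; split.
  rewrite [X in (X <= _)%VS]line_vpick -memvE.
  apply: (line_of_ratio (i0 := i0)) => // i.
  by rewrite -h -/(coord p i0) mulrCA mulfV // mulr1.
by rewrite !dim_line.
Qed.

Lemma proj_of_coord (z : 'I_n.+1 -> R) i0 : z i0 = 1 ->
  exists p, (\row_i z i \in line p) /\
    coord p i0 != 0 /\ forall i, coord p i / coord p i0 = z i.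
Proof.
move=> z1; set x := \row_i z i.
have x0 : x != 0.
  by apply/eqP => /rowP /(_ i0); rewrite !mxE z1 => /eqP; rewrite oner_eq0.
have hd : \dim <[x]>%VS == 1%N by rewrite dim_vline x0.
exists (Proj hd).
have xl : x \in line (Proj hd) by exact: memv_line.
split=> //; have [|p0 h] := mem_line_ratio (i0 := i0) xl.
  by rewrite mxE z1 oner_neq0.
by split=> // i; rewrite h !mxE z1 divr1.
Qed.

End ProjPoint.

Section Specialization.
Variables (L K : fieldType) (iota : {rmorphism L -> K}) (v : valuation K).
Hypothesis triv : forall c : L, c != 0 -> v (iota c) = 0.
Local Notation near := (near iota v).
Variables (n : nat) (p : proj L n) (i0 : 'I_n.+1).
Hypothesis p0 : coord p i0 != 0.

Lemma specializes_ratio p' : specializes iota v p' p ->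
  coord p' i0 != 0 /\
  forall i, near (coord p' i / coord p' i0) (coord p i / coord p i0).
Proof.
move=> [x [y [xp yp y0 h]]].
have yi0 : y ord0 i0 != 0.
  move: yp; rewrite line_vpick => /vlineP [a ya]; rewrite ya mxE mulf_neq0 //.
  by apply: contra_neq y0 => a0; rewrite ya a0 scale0r.
have xi0 : x ord0 i0 != 0 by apply: near_neq0 yi0; [exact: triv | exact: h].
have [p'0 e'] := mem_line_ratio xp xi0; have [_ e] := mem_line_ratio yp yi0.
split=> // i; rewrite e e'; apply: nearM => //; first exact: h.
by apply: nearV => //; apply: h.
Qed.

Lemma specializes_of_ratio z : z i0 = 1 ->
  (forall i, near (z i) (coord p i / coord p i0)) ->
  exists p', [/\ specializes iota v p' p, coord p' i0 != 0 &
    forall i, coord p' i / coord p' i0 = z i].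
Proof.
move=> z1 hz; have [p' [hx [p'0 hp']]] := proj_of_coord z1.
exists p'; split=> //; exists (\row_i z i), (\row_i (coord p i / coord p i0)).
split=> //.
- by apply: (line_of_ratio p0) => i; rewrite !mxE divff // mul1r.
- by apply/eqP => /rowP /(_ i0); rewrite !mxE divff // => /eqP; rewrite oner_eq0.
- by move=> i; rewrite !mxE; apply: hz.
Qed.

Lemma is_constant_ratio p' : coord p' i0 != 0 ->
  (forall i, coord p' i / coord p' i0 = iota (coord p i / coord p i0)) ->
  is_constant iota p' p.
Proof.
move=> p'0 h; apply: (line_of_ratio p'0) => i.
rewrite !mxE h -rmorphM; congr (iota _).
by rewrite -/(coord p i0) mulrCA mulfV // mulr1.
Qed.

End Specialization.

(** * The charts of projective and biprojective space *)

Lemma proj_chart (L : fieldType) n (i0 : 'I_n.+1) :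
  @chart L (proj_space L n) n.+1 (@coord L n)
    (fun d : nat => [set p : {mpoly L[n.+1]} | p \is d.-homog]) (fun=> i0).
Proof.
split=> [d f|c|d p q|d e p q|i|d].
- by split=> -[p hp e]; exists p.
- by rewrite /= -[c%:MP]mulr1 mul_mpolyC dhomogZ // dhomog1.
- exact: dhomogD.
- exact: dhomogM.
- by exists 1%N; split; rewrite /= dhomogX; apply/eqP; exact: mdeg1.
exists (fun i => if i == i0 then d else 0%N) => p m hp mp R Y.
rewrite -!expr_sum; congr (_ ^+ _).
rewrite [RHS](bigD1 i0) //= eqxx [X in _ = (_ + X)%N]big1 ?addn0 => [|i /negPf -> //].
by rewrite -mdegE; apply: (dhomogP _ _ _ hp).
Qed.

Definition bipivot n m (i0 : 'I_n.+1) (j0 : 'I_m.+1) (i : 'I_(n.+1 + m.+1)) :=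
  if fintype.split i is inl _ then lshift m.+1 i0 else rshift n.+1 j0.

Lemma bipivotl n m (i0 : 'I_n.+1) (j0 : 'I_m.+1) i :
  bipivot i0 j0 (lshift m.+1 i) = lshift m.+1 i0.
Proof. by rewrite /bipivot (unsplitK (inl i)). Qed.

Lemma bipivotr n m (i0 : 'I_n.+1) (j0 : 'I_m.+1) j :
  bipivot i0 j0 (rshift n.+1 j) = rshift n.+1 j0.
Proof. by rewrite /bipivot (unsplitK (inr j)). Qed.

Lemma coord2l (R : fieldType) n m (x : proj R n * proj R m) i :
  coord2 x (lshift m.+1 i) = coord x.1 i.
Proof. by rewrite /coord2 row_mxEl. Qed.

Lemma coord2r (R : fieldType) n m (x : proj R n * proj R m) j :
  coord2 x (rshift n.+1 j) = coord x.2 j.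
Proof. by rewrite /coord2 row_mxEr. Qed.

Lemma biproj_chart (L : fieldType) n m (i0 : 'I_n.+1) (j0 : 'I_m.+1) :
  @chart L (biproj_space L n m) (n.+1 + m.+1) (@coord2 L n m)
    (@bihomog n m L) (bipivot i0 j0).
Proof.
have Ul i : mdegl (U_(lshift m.+1 i) : 'X_{1..n.+1 + m.+1}) = 1%N /\
            mdegr (U_(lshift m.+1 i) : 'X_{1..n.+1 + m.+1}) = 0%N.
  split; rewrite /mdegl /mdegr.
    rewrite (bigD1 i) //= mnm1E eqxx big1 // => j ji.
    by rewrite mnm1E (inj_eq (@lshift_inj _ _)) eq_sym (negPf ji).
  by rewrite big1 // => j _; rewrite mnm1E eq_lrshift.
have Ur j : mdegl (U_(rshift n.+1 j) : 'X_{1..n.+1 + m.+1}) = 0%N /\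
            mdegr (U_(rshift n.+1 j) : 'X_{1..n.+1 + m.+1}) = 1%N.
  split; rewrite /mdegl /mdegr; last first.
    rewrite (bigD1 j) //= mnm1E eqxx big1 // => i ij.
    by rewrite mnm1E (inj_eq (@rshift_inj _ _)) eq_sym (negPf ij).
  by rewrite big1 // => i _; rewrite mnm1E eq_rlshift.
split=> [d f|c|d p q [hp hp'] [hq hq']|d e p q [hp hp'] [hq hq']|i|d].
- by split=> -[p hp e]; exists p.
- by split; rewrite /= -[c%:MP]mulr1 mul_mpolyC dhomogZ // dhomog1.
- by split; apply: dhomogD.
- by split; apply: dhomogM.
- case: (split_ordP i) => j ->; rewrite ?bipivotl ?bipivotr.
    by exists (1%N, 0%N); do 2!split; rewrite /= dhomogX; apply/eqP; case: (Ul j) (Ul i0) => ? ? [].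
  by exists (0%N, 1%N); do 2!split; rewrite /= dhomogX; apply/eqP; case: (Ur j) (Ur j0) => ? ? [].
pose w (i : 'I_(n.+1 + m.+1)) :=
  if i == lshift m.+1 i0 then d.1 else if i == rshift n.+1 j0 then d.2 else 0%N.
exists w => p u [hp hp'] up R Y; rewrite !big_split_ord /=.
have eql (F : 'I_(n.+1 + m.+1) -> nat) : \prod_(i < n.+1)
    Y (bipivot i0 j0 (lshift m.+1 i)) ^+ F (lshift m.+1 i) =
    Y (lshift m.+1 i0) ^+ (\sum_(i < n.+1) F (lshift m.+1 i)).
  by rewrite expr_sum; apply: eq_bigr => i _; rewrite bipivotl.
have eqr (F : 'I_(n.+1 + m.+1) -> nat) : \prod_(i < m.+1)
    Y (bipivot i0 j0 (rshift n.+1 i)) ^+ F (rshift n.+1 i) =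
    Y (rshift n.+1 j0) ^+ (\sum_(i < m.+1) F (rshift n.+1 i)).
  by rewrite expr_sum; apply: eq_bigr => i _; rewrite bipivotr.
rewrite (eql u) (eqr u) (eql w) (eqr w) /w; congr (_ ^+ _ * _ ^+ _).
  rewrite [RHS](bigD1 i0) //= eqxx [X in _ = (_ + X)%N]big1 ?addn0 => [|i ii].
    by apply: (dhomogP _ _ _ hp).
  by rewrite (inj_eq (@lshift_inj _ _)) (negPf ii) eq_lrshift.
rewrite [RHS](bigD1 j0) //= eqxx eq_rlshift [X in _ = (_ + X)%N]big1 ?addn0 => [|j jj].
  by apply: (dhomogP _ _ _ hp').
by rewrite (inj_eq (@rshift_inj _ _)) (negPf jj) eq_rlshift.
Qed.

(** * Points infinitely near a given point and homomorphisms of its stalk *)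

Section KPoint.
Variables (L K : fieldType) (iota : {rmorphism L -> K}) (v : valuation K).
Hypothesis triv : forall c : L, c != 0 -> v (iota c) = 0.
Local Notation near := (near iota v).
Variables (X : funSpace L) (N : nat) (co : X -> 'I_N -> L).
Variables (G : deg X -> set {mpoly L[N]}) (pi : 'I_N -> 'I_N).
Hypothesis ch : chart co G pi.
Hypothesis irrX : irreducible_set [set: X].
Variables (x : X) (Ux : chart_domain co pi x).
Local Notation ev := (evg ch Ux).

Definition on_locus (Y : 'I_N -> K) : Prop := forall d p, G d p ->
  (forall y, p.@[co y] = 0) -> mmap iota Y p = 0.

Lemma near_mmap (Y : 'I_N -> K) (c : 'I_N -> L) P :
  (forall i, near (Y i) (c i)) -> near (mmap iota Y P) P.@[c].
Proof.
move=> h; elim/mpoly_gen: P => [a|i|P Q hP hQ|P Q hP hQ].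
- by rewrite mmap_const mevalC; apply: near_iota.
- by rewrite mmapX mmap1U mevalXU.
- by rewrite rmorphD mevalD; apply: nearD.
- by rewrite rmorphM mevalM; apply: nearM.
Qed.

(** A point over K near x evaluates the germs at x. A denominator does not vanish
    at x, so its value is not infinitesimal; a polynomial that vanishes as a germ
    homogenizes to a form that vanishes on X, and therefore at the point. *)
Lemma kpoint_hom (Y : 'I_N -> K) : (forall i, Y (pi i) != 0) ->
  (forall i, near (ratio pi Y i) (affc co pi x i)) -> on_locus Y ->
  exists sigma : {rmorphism stalk x -> K},
    (forall P, sigma (ev P) = mmap iota (ratio pi Y) P) /\
    (forall b, near (sigma b) (residue x b)).
Proof.
move=> Y0 hY locY.
have nearP P : near (mmap iota (ratio pi Y) P) (residue x (ev P)).
  by rewrite residue_evg; apply: near_mmap.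
have [|P eP|sigma hs] := localization_hom (ev := ev) (rho := mmap iota (ratio pi Y)).
- move=> b; have [P [Q [Q0 e]]] := evg_frac ch Ux b; exists P, Q; split=> //.
  exact: (near_neq0 triv (nearP Q)).
- have [d [p [q [Gp Gq h]]]] := homogenize ch P.
  have p0 y : p.@[co y] = 0.
    apply: (form_eq0 irrX (form_eval ch Gp) (chart_domain_open ch) Ux).
    move=> {}y Uy; have [_ e] := h L idfun (co y) Uy.
    rewrite -[LHS]/(mmap idfun (co y) p) e.
    have := evg_eq0 irrX eP Uy; rewrite -[P.@[_]]/(mmap idfun (ratio pi (co y)) P) => ->.
    by rewrite mulr0.
  have [q0 e] := h K iota Y Y0; have := locY d p Gp p0; rewrite e => /eqP.
  by rewrite mulf_eq0 (negPf q0) => /eqP.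
exists sigma; split=> //; apply: (near_localization triv (ev := ev)).
  exact: evg_frac.
by move=> P; rewrite hs; exact: nearP.
Qed.

Lemma hom_evgE (sigma : {rmorphism stalk x -> K}) (Y : 'I_N -> K) :
  (forall c, sigma (ev c%:MP) = iota c) -> (forall i, sigma (ev 'X_i) = Y i) ->
  forall P, sigma (ev P) = mmap iota Y P.
Proof.
move=> hc hX; elim/mpoly_gen => [a|i|P Q hP hQ|P Q hP hQ].
- by rewrite mmap_const.
- by rewrite mmapX mmap1U.
- by rewrite !rmorphD hP hQ.
- by rewrite !rmorphM hP hQ.
Qed.

(** A form that vanishes on X has a zero germ, whatever the coordinates by which
    it is divided. *)
Lemma hom_kpoint (sigma : {rmorphism stalk x -> K}) (Y : 'I_N -> K) :
  (forall c, sigma (ev c%:MP) = iota c) -> (forall i, Y (pi i) != 0) ->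
  (forall i, sigma (ev 'X_i) = ratio pi Y i) -> on_locus Y.
Proof.
move=> hc Y0 hX d p Gp p0; have [w hw] := eval_homogeneous ch d.
rewrite (hw p Gp K iota Y Y0) -(hom_evgE hc hX).
rewrite (_ : ev p = 0) ?rmorph0 ?mulr0 //; apply: evg_eval0 => y Uy.
have := hw p Gp L idfun (co y) Uy; rewrite -[mmap _ _ p]/(p.@[co y]) p0.
move/esym/eqP; rewrite mulf_eq0; case/orP => [/prodf_eq0 [i _]|/eqP //].
by rewrite expf_eq0 (negPf (Uy i)) andbF.
Qed.

End KPoint.

(** * Open subspaces *)

Section OpenSubspace.
Variables (L : fieldType) (X : funSpace L).

Lemma zopen_subspace (V : set X) (O : set (subspace V)) : zopen O ->
  exists O' : set X, zopen O' /\ forall y : subspace V, O y <-> O' (val y).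
Proof.
move=> [E [hE eE]].
pose E' := [set f : X -> L | (exists d, form d f) /\ E (f \o val)].
exists (~` [set y | forall f, E' f -> f y = 0]); split.
  by exists E'; split=> [f []|]; rewrite ?setCK.
move=> y; have -> : O y <-> ~ (~` O) y by rewrite /setC /=; split=> [? //|/contrapT].
rewrite eE /setC /=; split=> h h'; apply: h => f Ef.
  by have [d [g gd fe]] := hE f Ef; rewrite -fe in Ef *; apply: h'; split=> //; exists d.
by case: Ef => _; apply: h'.
Qed.

Lemma zopen_val (V O' : set X) : zopen O' -> zopen [set y : subspace V | O' (val y)].
Proof.
move=> [E [hE eE]]; exists [set f \o val | f in E]; split.
  by move=> _ [f Ef <-]; have [d fd] := hE f Ef; exists d, f.
have -> : ~` [set y : subspace V | O' (val y)] = [set y | (~` O') (val y)] by [].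
rewrite eE; apply/seteqP; split=> y /= h f.
  by move=> [g Eg <-]; apply: h.
by move=> Ef; apply: (h (f \o val)); exists f.
Qed.

Lemma regular_val (V : set X) (phi : X -> L) (y : subspace V) :
  regular_at phi (val y) -> @regular_at L (subspace V) (phi \o val) y.
Proof.
move=> [U [oU Uy [d [f [g [fd gd h]]]]]].
exists [set y | U (val y)]; split=> //; first exact: zopen_val.
exists d, (f \o val), (g \o val); split; [by exists f | by exists g |].
by move=> z /h.
Qed.

Lemma regular_extend (V : set X) (phi : subspace V -> L) (psi : X -> L)
    (y : subspace V) : zopen V -> (forall z : subspace V, psi (val z) = phi z) ->
  @regular_at L (subspace V) phi y -> regular_at psi (val y).
Proof.
move=> oV e [U [oU Uy [d [_ [_ [[f fd <-] [g gd <-] h]]]]]].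
have [O' [oO' hO']] := zopen_subspace oU.
exists (O' `&` V); split; first exact: zopenI.
  by split; [apply/hO' | apply/set_mem/valP].
exists d, f, g; split=> // z [O'z Vz].
pose z' : subspace V := SigSub (mem_set Vz).
have := h z'; rewrite -e /=; apply.
by apply/hO'.
Qed.

End OpenSubspace.

(** * Stalk maps *)

Section Morphisms.
Variables (L : fieldType) (X Y : funSpace L) (f : X -> Y) (hf : morphism f).

Definition stalk_hom x : {rmorphism stalk (f x) -> stalk x} := @stalk_map L X Y f hf x.

Lemma residue_stalk_map x s : residue x (stalk_map hf s) = residue (f x) s.
Proof.
by have [phi ->] := stalk_germ s; rewrite stalk_map_germ !residueE.
Qed.

(** The zero set of the numerator of s pulls back to a closed set that contains
    a nonempty open set, hence to X; by surjectivity the numerator is zero. *)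
Lemma stalk_map_inj x : irreducible_set [set: X] -> (forall y, exists x, f x = y) ->
  forall s, stalk_map (x := x) hf s = 0 -> s = 0.
Proof.
move=> irrX surj s; have [phi ->] := stalk_germ s; rewrite stalk_map_germ.
rewrite -(rmorph0 (germ_hom x)) -(rmorph0 (germ_hom (f x))) => /germP [W [oW Wx hW]].
have /asboolP [U [oU Ux [d [g [h [gd hd e]]]]]] := regvalP phi.
have closed_g : zclosed [set y : Y | g y = 0].
  exists [set g]; split=> [_ ->|]; first by exists d.
  by apply/seteqP; split=> y /= => [hy _ ->|/(_ g erefl)].
have oWU : zopen (W `&` f @^-1` U).
  by apply: zopenI => //; apply: (hf.1 (~` U)).
case: (irrX.2 _ _ (hf.1 _ closed_g) oWU) => [y _|h0|h0].
- have [[Wy Uy]|n] := pselect ((W `&` f @^-1` U) y); last by right.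
  left=> /=; have [h0 e'] := e _ Uy.
  have : phi (f y) = 0 := hW y Wy.
  by rewrite e' => /eqP; rewrite mulf_eq0 invr_eq0 (negPf h0) orbF => /eqP.
- apply/germP; exists U; split=> // y Uy; have [_ ->] := e y Uy.
  have [z <-] := surj y; have -> : g (f z) = 0 by apply: h0.
  by rewrite mul0r.
- by have := h0 x I; case.
Qed.

Definition germ_of (Z : funSpace L) (z : Z) (phi : Z -> L) (h : regular_at phi z) :
  stalk z := germ (RegularFun (asboolT h : phi \in regular_pred z)).

Lemma regular_fun_sum (Z : funSpace L) (z : Z) k (F : 'I_k -> regular_fun z) y :
  (\sum_i F i) y = \sum_i F i y.
Proof.
by elim/big_rec2: _ => // i a b _ <-.
Qed.

Lemma germ_of_span x k (V : set Y) (e : 'I_k -> X -> L) (c : 'I_k -> Y -> L)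
    (phi : X -> L) (hphi : regular_at phi x)
    (he : forall i, regular_at (e i) x) (hc : forall i, regular_at (c i) (f x)) :
  zopen V -> V (f x) -> (forall y, V (f y) -> phi y = \sum_i c i (f y) * e i y) ->
  germ_of hphi = \sum_i stalk_map hf (germ_of (hc i)) * germ_of (he i).
Proof.
move=> oV Vx h.
have -> : \sum_i stalk_map hf (germ_of (hc i)) * germ_of (he i) =
    germ_hom x (\sum_i pullback hf (RegularFun (asboolT (hc i) : c i \in regular_pred (f x)))
      * RegularFun (asboolT (he i) : e i \in regular_pred x)).
  by rewrite rmorph_sum; apply: eq_bigr => i _; rewrite stalk_map_germ rmorphM.
apply/germP; exists (f @^-1` V); split=> //; first exact: (hf.1 (~` V)).
by move=> y Vy; rewrite regular_fun_sum -[LHS]/(phi y) h.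
Qed.

(** In affine coordinates every polynomial is a form of every degree, and a
    regular function on all of W: so a local quotient of forms is a quotient
    of functions that are regular on W. *)
Lemma affine_fraction x (W : set X) (psi : X -> L) :
  zopen W -> W x -> affine (subspace W) -> regular_at psi x ->
  exists p q : X -> L, [/\ regular_on W p, regular_on W q, q x != 0 &
    exists O, [/\ zopen O, O x & forall y, O y -> psi y * q y = p y]].
Proof.
move=> oW Wx [N [Z [h [cZ [mh [g [hK gK mg]]]]]]] rpsi.
pose x' : subspace W := SigSub (mem_set Wx).
have r1 : @regular_at L (subspace W) (psi \o val) (g (h x')).
  by rewrite hK; apply: regular_val.
have [U [oU Uhx [d [p [q [pd qd e]]]]]] := mg.2 _ _ r1.
pose ext (r : subspace Z -> L) (y : X) : L :=
  if pselect (W y) is left Wy then r (h (SigSub (mem_set Wy))) else 0.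
have extE r (y : subspace W) : ext r (val y) = r (h y).
  rewrite /ext; case: pselect => [Wy|nW]; last by case: nW; apply/set_mem/valP.
  by congr (r (h _)); apply: val_inj.
have ext_reg r : @form L (subspace Z) d r -> regular_on W (ext r).
  move=> rd y Wy; pose y' : subspace W := SigSub (mem_set Wy).
  apply: (@regular_extend L X W (r \o h) (ext r) y' oW (extE r)).
  apply: mh.2; exists setT; split=> //; first exact: zopenT.
  exists d, r, (cst 1); split=> //.
    exists (cst 1) => //=; exists 1 => //; apply/funext => z; exact: meval1.
  by move=> z _; rewrite /= oner_neq0 divr1.
exists (ext p), (ext q); split; try exact: ext_reg.
  have [q0 _] := e _ Uhx.
  by rewrite -[x]/(val x') extE.
have oV : zopen (h @^-1` U) by apply: (mh.1 (~` U)).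
have [O' [oO' hO']] := zopen_subspace oV.
exists (O' `&` W); split; first exact: zopenI.
  by split=> //; apply/(hO' x').
move=> y [O'y Wy]; pose y' : subspace W := SigSub (mem_set Wy).
have Uy : U (h y') by apply/(hO' y').
have [q0] := e _ Uy; rewrite /= hK /= => ->.
by rewrite -[y]/(val y') !extE mulfVK.
Qed.

End Morphisms.

Section FiniteSpan.
Variables (L : fieldType) (X Y : funSpace L) (f : X -> Y) (hf : morphism f).
Hypothesis fin_f : finite_morphism f.

(** The span is the algebra of an affine open neighbourhood of the fibre,
    localised at the point f x of the base. *)
Lemma finite_fin_span (x : X) : exists k (e : 'I_k -> stalk x),
  [/\ fin_span (stalk_hom hf x) e 1,
      forall i j, fin_span (stalk_hom hf x) e (e i * e j) &
      forall b, exists p q, [/\ fin_span (stalk_hom hf x) e p,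
        fin_span (stalk_hom hf x) e q, residue x q != 0 & b * q = p]].
Proof.
have [_ /(_ (f x)) [V [oV Vx _ affW [k [e [re gen]]]]]] := fin_f.
have oW : zopen (f @^-1` V) by apply: (hf.1 (~` V)).
have he i : regular_at (e i) x by apply: re.
exists k, (fun i => germ_of (he i)).
have spanP phi (h : regular_on (f @^-1` V) phi) (hx : regular_at phi x) :
    fin_span (stalk_hom hf x) (fun i => germ_of (he i)) (germ_of hx).
  have [c [rc ec]] := gen _ h.
  exists (fun i => germ_of (rc i _ Vx)).
  exact: (germ_of_span hf hx he (fun i => rc i _ Vx) oV Vx ec).
have germ1 (h : regular_at (cst 1) x) : germ_of h = 1.
  rewrite -(rmorph1 (germ_hom x)); apply/germP; exists setT; split=> //.
  exact: zopenT.
have germM phi psi (h : regular_at phi x) (h' : regular_at psi x)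
    (h'' : regular_at (phi * psi) x) : germ_of h'' = germ_of h * germ_of h'.
  rewrite /germ_of -!germ_homE -rmorphM; apply/germP; exists setT; split=> //.
  exact: zopenT.
split.
- rewrite -(germ1 (@regular_cst _ _ 1 x)); apply: spanP => y _; exact: regular_cst.
- move=> i j; rewrite -(germM _ _ _ _ (regularM (he i) (he j))).
  by apply: spanP => y Wy; apply: regularM; apply: re.
move=> b; have [phi ->] := stalk_germ b.
have /asboolP rphi := regvalP phi.
have [p [q [rp rq q0 [O [oO Ox hO]]]]] := affine_fraction oW Vx affW rphi.
exists (germ_of (rp x Vx)), (germ_of (rq x Vx)); split.
- exact: spanP.
- exact: spanP.
- by rewrite residueE.
- by rewrite /germ_of -!germ_homE -rmorphM; apply/germP; exists O.
Qed.

End FiniteSpan.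

(** * The projection of a curve and its étale locus *)

Lemma kernel_ideal (R : comNzRingType) (S : comNzRingType) (f : {rmorphism R -> S}) :
  is_ideal [set b | f b = 0].
Proof.
split=> [|a b /= ha hb|a b /= hb]; first exact: rmorph0.
  by rewrite rmorphD ha hb addr0.
by rewrite rmorphM hb mulr0.
Qed.

Lemma mderiv_coord (R : comNzRingType) N (i k : 'I_N) (c : R) :
  ('X_i - c%:MP)^`M(k) = (i == k)%:R.
Proof.
rewrite mderivB mderivC subr0 mderivX mnm1E; case: eqP => [->|_]; last exact: scale0r.
rewrite scale1r (_ : (_ - _)%MM = 0%MM) ?mpolyX0 //.
by apply/mnmP => j; rewrite mnmBE subnn mnm0E.
Qed.

(** Comparing the derivatives of both sides identifies the values of the Taylor
    coefficients at the centre. *)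
Lemma mderiv_taylor (R : comNzRingType) N (c : 'I_N -> R) (P : {mpoly R[N]})
    (g : 'I_N -> {mpoly R[N]}) :
  P - P.@[c]%:MP = \sum_i g i * ('X_i - (c i)%:MP) ->
  forall k, (g k).@[c] = (P^`M(k)).@[c].
Proof.
move=> /[swap] k /(congr1 (mderiv k)); rewrite mderivB mderivC subr0 => ->.
rewrite (raddf_sum (mderiv k)) (rmorph_sum (meval c)) /= (bigD1 k) //=.
have dE i : ((g i * ('X_i - (c i)%:MP))^`M(k)).@[c] = (g i).@[c] * (i == k)%:R.
  rewrite mderivM mderiv_coord mevalD !mevalM mevalB mevalXU mevalC subrr mulr0 add0r.
  by congr (_ * _); case: eqP => _; rewrite ?meval1 ?meval0.
rewrite dE eqxx mulr1 big1 ?addr0 // => i /negPf ik.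
by rewrite dE ik mulr0.
Qed.

Section Projection.
Variables (L : fieldType) (n m : nat).
Variables (D : set (proj_space L n)) (F : set (biproj_space L n m)).
Hypothesis FD : F `<=` [set x | D x.1].
Hypothesis irrD : irreducible_set [set: subspace D].
Hypothesis irrF : irreducible_set [set: subspace F].
Hypothesis surj_pr : forall a : subspace D, exists x : subspace F, pr FD x = a.
Local Notation hf := (pr_morphism FD).
Local Notation fibre f x := (@fibre_ideal _ _ _ _ f x).
Variables (i0 : 'I_n.+1) (j0 : 'I_m.+1).

Definition coordD (y : subspace D) : 'I_n.+1 -> L := coord (val y).
Definition coordF (y : subspace F) : 'I_(n.+1 + m.+1) -> L := coord2 (val y).

Lemma chartD : @chart L (subspace D) _ coordD
  (fun d : nat => [set p : {mpoly L[n.+1]} | p \is d.-homog]) (fun=> i0).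
Proof. exact: (chart_subspace (proj_chart L i0)). Qed.

Lemma chartF : @chart L (subspace F) _ coordF (@bihomog n m L) (bipivot i0 j0).
Proof. exact: (chart_subspace (biproj_chart L i0 j0)). Qed.

Lemma chart_domainF x : coord (val x).1 i0 != 0 -> coord (val x).2 j0 != 0 ->
  chart_domain coordF (bipivot i0 j0) x.
Proof.
move=> h1 h2 i; rewrite /coordF; case: (split_ordP i) => j ->.
  by rewrite bipivotl coord2l.
by rewrite bipivotr coord2r.
Qed.

Lemma chart_domain_pr x : chart_domain coordF (bipivot i0 j0) x ->
  chart_domain coordD (fun=> i0) (pr FD x).
Proof.
by move=> /(_ (lshift m.+1 i0)) h i; move: h; rewrite bipivotl /coordF coord2l.
Qed.

Lemma affc_pr x i : affc coordD (fun=> i0) (pr FD x) i =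
  affc coordF (bipivot i0 j0) x (lshift m.+1 i).
Proof. by rewrite /affc /ratio bipivotl /coordF !coord2l. Qed.

Section At.
Variables (x : subspace F) (UF : chart_domain coordF (bipivot i0 j0) x).
Local Notation UD := (chart_domain_pr UF).
Local Notation evD := (evg chartD UD).
Local Notation evF := (evg chartF UF).

Lemma stalk_map_evgX i : stalk_hom hf x (evD 'X_i) = evF 'X_(lshift m.+1 i).
Proof.
rewrite [LHS]stalk_map_germ; apply: evg_eqP; exists setT; split=> //.
  exact: zopenT.
by move=> y _ _; rewrite /= !mevalXU affc_pr.
Qed.

Lemma stalk_map_evgC c : stalk_hom hf x (evD c%:MP) = evF c%:MP.
Proof.
rewrite [LHS]stalk_map_germ; apply: evg_eqP; exists setT; split=> //.
  exact: zopenT.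
by move=> y _ _; rewrite /= !mevalC.
Qed.

Lemma stalk_map_local_coord i :
  stalk_hom hf x (local_coord chartD UD i) = local_coord chartF UF (lshift m.+1 i).
Proof.
by rewrite /local_coord !rmorphB stalk_map_evgX stalk_map_evgC affc_pr.
Qed.

Lemma fibre_ideal_sub : fibre hf x `<=` @max_ideal L _ x.
Proof.
rewrite max_idealE; apply: ideal_gen_min.
  exact: kernel_ideal.
by move=> _ [s + <-]; rewrite max_idealE => rs; rewrite /mkset residue_stalk_map.
Qed.

Lemma local_coord_fibre i :
  fibre hf x (local_coord chartF UF (lshift m.+1 i)).
Proof.
apply: sub_ideal_gen; exists (local_coord chartD UD i).
  by rewrite max_idealE; apply: residue_local_coord.
exact: stalk_map_local_coord.
Qed.

Lemma fibre_ideal_coord b : fibre hf x b ->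
  exists g : 'I_n.+1 -> stalk x,
    b = \sum_l g l * local_coord chartF UF (lshift m.+1 l).
Proof.
move: b; apply: ideal_gen_min.
  split=> [|_ _ [g ->] [g' ->]|a _ [g ->]].
  - by exists (fun=> 0); rewrite big1 // => i _; rewrite mul0r.
  - exists (fun l => g l + g' l); rewrite -big_split.
    by apply: eq_bigr => l _; rewrite mulrDl.
  - exists (fun l => a * g l); rewrite mulr_sumr.
    by apply: eq_bigr => l _; rewrite mulrA.
move=> _ [s + <-]; rewrite max_idealE => rs.
have [c ->] := local_coord_gen chartD irrD UD rs.
exists (fun l => stalk_hom hf x (c l)).
rewrite -[LHS]/(stalk_hom hf x _) rmorph_sum; apply: eq_bigr => l _.
by rewrite rmorphM stalk_map_local_coord.
Qed.

Lemma fibre_ideal_max :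
  (forall j, fibre hf x (local_coord chartF UF (rshift n.+1 j))) ->
  fibre hf x = @max_ideal L _ x.
Proof.
move=> h; apply/seteqP; split; first exact: fibre_ideal_sub.
rewrite max_idealE => b rb.
have [c ->] := local_coord_gen chartF irrF UF rb.
apply: ideal_sum => [|i]; first exact: ideal_gen_ideal.
by case: (split_ordP i) => j ->; [apply: local_coord_fibre | apply: h].
Qed.

Lemma common_denominator_evg k (b : 'I_k -> stalk x) :
  exists (Q : {mpoly L[n.+1 + m.+1]}) P,
    residue x (evF Q) = 1 /\ forall i, b i * evF Q = evF (P i).
Proof.
have [P hP] := choice (fun i => evg_frac chartF UF (b i)).
have [Q hQ] := choice hP.
pose R := \prod_i Q i.
have R0 : residue x (evF R) != 0.
  rewrite rmorph_prod rmorph_prod; apply/prodf_neq0 => i _.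
  by case: (hQ i).
exists ((residue x (evF R))^-1 *: R).
exists (fun i => (residue x (evF R))^-1 *: (P i * \prod_(j | j != i) Q j)); split.
  rewrite -mul_mpolyC !rmorphM [X in X * _]residue_evg mevalC.
  exact: mulVf.
move=> i; have [_ e] := hQ i; rewrite -!mul_mpolyC !rmorphM /=.
by rewrite {2}/R (bigD1 i) //= rmorphM -e; ring.
Qed.

End At.

(** By hypothesis each coordinate Z_j of the second block satisfies near x a
    relation Psi_j = Q (Z_j - c_j) - sum_l P_l (Z_l - c_l), where l runs over
    the coordinates coming from D. Such a relation persists on the whole chart,
    and the Jacobian matrix of the Psi_j with respect to the second block is
    the identity at x. Wherever its determinant does not vanish, the Taylor
    expansion of the Psi_j at y expresses the local coordinates of the second
    block at y through those of the first, up to an invertible matrix. *)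
Lemma fibre_ideal_open x : chart_domain coordF (bipivot i0 j0) x ->
  fibre hf x = @max_ideal L _ x ->
  exists U, [/\ zopen U, U x & forall y, U y -> chart_domain coordF (bipivot i0 j0) y /\
    fibre hf y = @max_ideal L _ y].
Proof.
move=> UF eI; pose z y := affc coordF (bipivot i0 j0) y.
pose X i : {mpoly L[n.+1 + m.+1]} := 'X_i - (z x i)%:MP.
have ex_rel j : exists QP : {mpoly L[n.+1 + m.+1]} * ('I_n.+1 -> {mpoly L[n.+1 + m.+1]}),
    QP.1.@[z x] = 1 /\
    evg chartF UF (QP.1 * X (rshift n.+1 j) - \sum_l QP.2 l * X (lshift m.+1 l)) = 0.
  have [g eg] : exists g : 'I_n.+1 -> stalk x,
      local_coord chartF UF (rshift n.+1 j) =
      \sum_l g l * local_coord chartF UF (lshift m.+1 l).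
    by apply: fibre_ideal_coord; rewrite eI max_idealE; apply: residue_local_coord.
  have [Q [P [Q1 hP]]] := common_denominator_evg UF g.
  exists (Q, P); split=> /=; first by rewrite -(residue_evg chartF UF).
  rewrite rmorphB rmorphM rmorph_sum -[evg _ _ (X _)]/(local_coord chartF UF _) eg.
  rewrite mulr_sumr; apply/eqP; rewrite subr_eq0; apply/eqP.
  by apply: eq_bigr => l _; rewrite rmorphM -hP; rewrite -[evg _ _ (X _)]/(local_coord chartF UF _); ring.
have [QP hQP] := choice ex_rel.
pose Psi j := (QP j).1 * X (rshift n.+1 j) - \sum_l (QP j).2 l * X (lshift m.+1 l).
pose J := \matrix_(j, j') (Psi j)^`M(rshift n.+1 j').
have dX i k : (X i)^`M(k) = (i == k)%:R.
  exact: mderiv_coord.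
have X0 i : (X i).@[z x] = 0 by rewrite mevalB mevalXU mevalC subrr.
have Psi0 j y : chart_domain coordF (bipivot i0 j0) y -> (Psi j).@[z y] = 0.
  by move=> Uy; apply: (evg_eq0 irrF (proj2 (hQP j))).
have meval_det k (M : 'M[{mpoly L[n.+1 + m.+1]}]_k) c :
    (\det M).@[c] = \det (map_mx (meval c) M).
  by rewrite det_map_mx.
exists [set y | chart_domain coordF (bipivot i0 j0) y /\ (\det J).@[z y] != 0].
split; first exact: (zopen_eval_neq0 chartF).
  split=> //; rewrite meval_det (_ : map_mx _ _ = 1%:M) ?det1 ?oner_neq0 //.
  apply/matrixP => j j'; rewrite !mxE /Psi mderivB mderivM dX mevalB mevalD !mevalM X0.
  rewrite mulr0 add0r (proj1 (hQP j)) mul1r (raddf_sum (mderiv _)) (rmorph_sum (meval _)) big1 => [|l _].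
    rewrite subr0 (inj_eq (@rshift_inj _ _)).
    by case: eqP => _; rewrite ?meval1 ?meval0.
  rewrite /= mderivM dX mevalD !mevalM X0 mulr0 add0r eq_lrshift.
  by rewrite meval0 mulr0.
move=> y [Uy Jy]; split=> //; apply: (fibre_ideal_max (UF := Uy)).
have [g hg] := choice (fun j => mpoly_taylor (z y) (Psi j)).
apply: (det_cancel (stalk_local_domain y irrF)
  (N := \matrix_(j, j') evg chartF Uy (g j (rshift n.+1 j')))).
- exact: ideal_gen_ideal.
- rewrite -det_map_mx; move: Jy; rewrite meval_det; congr (\det _ != 0).
  apply/matrixP => j j'; rewrite !mxE residue_evg.
  by apply/esym; apply: (mderiv_taylor (hg j)).
- move=> j.
  have := congr1 (evg chartF Uy) (hg j).
  rewrite Psi0 // mpolyC0 subr0 (evg_eval0 chartF Uy (P := Psi j)); last by move=> w; apply: Psi0.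
  rewrite rmorph_sum big_split_ord /= => /esym/eqP; rewrite addrC addr_eq0 => /eqP e.
  rewrite (_ : \sum_j' _ = - \sum_l evg chartF Uy (g j (lshift m.+1 l)) *
      local_coord chartF Uy (lshift m.+1 l)).
    apply: (is_idealN (I := @fibre_ideal _ _ _ _ hf y)); first exact: ideal_gen_ideal.
    apply: ideal_sum => [|l]; first exact: ideal_gen_ideal.
    exact: local_coord_fibre.
  transitivity (\sum_j' evg chartF Uy (g j (rshift n.+1 j') *
      ('X_(rshift n.+1 j') - (z y (rshift n.+1 j'))%:MP))).
    by apply: eq_bigr => j' _; rewrite mxE rmorphM.
  by rewrite [LHS]e; congr (- _); apply: eq_bigr => l _; rewrite rmorphM.
Qed.

Lemma pr_flat x : (exists s, uniformizer (residue (pr FD x)) s) ->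
  flat (@stalk_map _ _ _ _ hf x).
Proof.
move=> [s us]; apply: (torsion_free_flat (phi := stalk_hom hf x)).
  move=> a b; exact: (uniformizer_total (stalk_local_domain (pr FD x) irrD) a b us).
move=> a b /(local_integral (stalk_local_domain x irrF)) [|]; last by right.
by move/(stalk_map_inj irrF surj_pr); left.
Qed.

End Projection.

(** * The two multiplicities *)

Lemma map_mpoly_meval (R S : comNzRingType) N (f : {rmorphism R -> S})
    (Y : 'I_N -> S) p : (map_mpoly f p).@[Y] = mmap f Y p.
Proof.
elim/mpoly_gen: p => [c|i|p q hp hq|p q hp hq].
- by rewrite map_mpolyC mevalC mmap_const.
- by rewrite map_mpolyX mevalXU mmapX mmap1U.
- by rewrite !rmorphD /= hp hq.
- by rewrite !rmorphM /= hp hq.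
Qed.

Section Multiplicity.
Variables (L : fieldType) (n m : nat).
Variables (D : set (proj_space L n)) (F : set (biproj_space L n m)).
Hypothesis curveD : curve (subspace D).
Hypothesis curveF : curve (subspace F).
Hypothesis FD : F `<=` [set x | D x.1].
Hypothesis surj_pr : forall a : subspace D, exists x : subspace F, pr FD x = a.
Local Notation hf := (pr_morphism FD).
Let irrD := curveD.1.
Let irrF := curveF.1.
Variable x : subspace F.

Lemma fibre_ideal_uniformizer t u th e : uniformizer (residue (pr FD x)) t ->
  residue x u != 0 -> stalk_hom hf x t = u * th ^+ e ->
  @fibre_ideal _ _ _ _ hf x = multiples (th ^+ e).
Proof.
move=> ut u0 eu; apply/seteqP; split.
  apply: ideal_gen_min; first exact: multiples_ideal.
  move=> _ [s + <-]; rewrite max_idealE => rs.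
  have [c ->] := uniformizer_mult ut rs; exists (stalk_hom hf x c * u).
  by rewrite -[LHS]/(stalk_hom hf x _) rmorphM eu mulrA.
have [w hw] := local_unit (stalk_local_domain x irrF) u0.
have [_ _ IM] := ideal_gen_ideal (@stalk_map _ _ _ _ hf x @` @max_ideal L _ (pr FD x)).
move=> _ [c ->].
have -> : c * th ^+ e = c * w * stalk_hom hf x t.
  by rewrite eu -mulrA [w * _]mulrA [w * u]mulrC hw mul1r.
apply: IM; apply: sub_ideal_gen; exists t => //.
by rewrite max_idealE; case: ut.
Qed.

Lemma etale_locus_open : (forall a : subspace D, nonsingular a) ->
  @fibre_ideal _ _ _ _ hf x = @max_ideal L _ x ->
  exists U : set (subspace F), [/\ zopen U, U x & forall y, U y -> etale_at hf y].
Proof.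
move=> smoothD eI.
have [i0 hi] := coord_pivot (val x).1; have [j0 hj] := coord_pivot (val x).2.
have [U [oU Ux hU]] := fibre_ideal_open irrD irrF (chart_domainF hi hj) eI.
exists U; split=> // y /hU [Uy eIy]; split=> //.
apply: pr_flat => //.
apply: (nonsingular_uniformizer (chartD D i0) irrD) => //.
exact: chart_domain_pr Uy.
Qed.

End Multiplicity.

Section Main.
Variables (L : fieldType) (charL : [pchar L] =i pred0).
Variables (K : closedFieldType) (iota : {rmorphism L -> K}) (v : valuation K).
Hypothesis triv : forall c : L, c != 0 -> v (iota c) = 0.
Variables (n m : nat).
Variables (D : set (proj_space L n)) (F : set (biproj_space L n m)).
Hypothesis curveD : curve (subspace D).
Hypothesis curveF : curve (subspace F).
Hypothesis FD : F `<=` [set x | D x.1].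
Hypothesis surj_pr : forall a : subspace D, exists x : subspace F, pr FD x = a.
Hypothesis finite_pr : finite_morphism (pr FD).
Local Notation hf := (pr_morphism FD).
Local Notation near := (near iota v).
Let irrD := curveD.1.
Let irrF := curveF.1.

(** If sigma kills t, it kills all local coordinates, which are multiples of t;
    then the coordinates of a' are those of a, against genericity. Hence sigma t
    is nonzero, and so is the image of a unit times a power of t. *)
Lemma generic_hom (a : subspace D) (i0 : 'I_n.+1) t (a' : proj K n)
    (Ua : chart_domain (@coordD L n D) (fun=> i0) a) :
  uniformizer (residue a) t -> generic_near iota v D (val a) a' ->
  exists sigma : {rmorphism stalk a -> K},
    [/\ coord a' i0 != 0,
        forall P, sigma (evg (chartD D i0) Ua P) = mmap iota (ratio (fun=> i0) (coord a')) P,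
        forall b, near (sigma b) (residue a b) &
        forall b, sigma b = 0 -> b = 0].
Proof.
move=> ut [Ka' sa' na']; have hi0 : coord (val a) i0 != 0 := Ua i0.
have [a'0 ra'] := specializes_ratio triv hi0 sa'.
have loc : on_locus iota (@coordD L n D) (fun d : nat => [set p : {mpoly L[n.+1]} | p \is d.-homog]) (coord a').
  move=> d p hp p0; rewrite -map_mpoly_meval; apply: (Ka' d) => // q Dq.
  exact: (p0 (SigSub (mem_set Dq))).
have [sigma [hs ns]] := kpoint_hom triv (chartD D i0) irrD Ua (fun=> a'0) ra' loc.
exists sigma; split=> // b sb0; apply/eqP/negPn/negP => b0.
have [rt t0 ht] := ut; have [k [u [u0 eb]]] := ht b b0.
have st0 : sigma t = 0.
  apply/eqP; move/eqP: sb0; rewrite eb rmorphM mulf_eq0.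
  rewrite (negPf (near_neq0 triv (ns u) u0)) /= rmorphXn expf_eq0.
  by case/andP.
case: na'; exists (val a); first exact/set_mem/valP.
apply: (is_constant_ratio hi0 a'0) => i.
have [c ec] := uniformizer_mult ut (residue_local_coord (chartD D i0) Ua i).
have := congr1 sigma ec; rewrite rmorphM st0 mulr0 /local_coord rmorphB rmorphB !hs.
rewrite mmap_const mmapX mmap1U => /eqP; rewrite subr_eq0 => /eqP.
by [].
Qed.

(** The points b' near b with (a', b') on F correspond to the extensions to the
    stalk of F of the homomorphism that a' defines on the stalk of D. *)
Theorem local_multiplicity (ab : subspace F) (a' : proj K n) :
  nonsingular (pr FD ab) -> nonsingular ab ->
  generic_near iota v D (val ab).1 a' ->
  exists e t u th, [/\ uniformizer (residue (pr FD ab)) t,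
    uniformizer (residue ab) th, residue ab u != 0,
    stalk_hom hf ab t = u * th ^+ e & zariski_mult iota v F (val ab) a' e].
Proof.
move=> nsa nsab ga'.
have [i0 hi] := coord_pivot (val ab).1; have [j0 hj] := coord_pivot (val ab).2.
have UF := chart_domainF hi hj; pose UD := chart_domain_pr FD UF.
have [t ut] := nonsingular_uniformizer (chartD D i0) irrD UD curveD nsa.
have [s us] := nonsingular_uniformizer (chartF F i0 j0) irrF UF curveF nsab.
have [k [e0 [sp1 spM spf]]] := finite_fin_span hf finite_pr ab.
pose evD := evg (chartD D i0) UD; pose evF := evg (chartF F i0 j0) UF.
have evX i : stalk_hom hf ab (evD 'X_i) = evF 'X_(lshift m.+1 i).
  exact: stalk_map_evgX.
have evC c : stalk_hom hf ab (evD c%:MP) = evF c%:MP by exact: stalk_map_evgC.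
pose inA : {rmorphism L -> stalk (pr FD ab)} := evD \o (@mpolyC n.+1 L).
have res_in c : residue (pr FD ab) (inA c) = c.
  by rewrite -[inA c]/(evD c%:MP) residue_evg mevalC.
have locA := stalk_local_domain (pr FD ab) irrD.
have locB := stalk_local_domain ab irrF.
have [th [uth gen alg]] := fin_span_generator locB (residue_stalk_map hf (x := ab))
  res_in ut us sp1 spM spf.
have [sA [a'0 sAev nA sAinj]] := generic_hom UD ut ga'.
have char0 l : (l.+1)%:R != 0 :> K.
  by rewrite -(rmorph_nat iota) fmorph_eq0 (pcharf0P _).1.
have [e [u [rs [u0 eu [uniq_rs size_rs] hrs hrs']]]] :=
  count_extensions triv char0 locA locB (residue_stalk_map hf (x := ab))
    (stalk_map_inj irrF surj_pr (x := ab)) ut uth gen alg nA sAinj.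
exists e, t, u, th; split=> //.
(* sg is the evaluation of germs at (a', b') *)
pose link (b' : proj K m) (sg : {rmorphism stalk ab -> K}) :=
  [/\ forall a, sg (stalk_hom hf ab a) = sA a, forall b, near (sg b) (residue ab b) &
      coord b' j0 != 0 /\
      forall j, sg (evF 'X_(rshift n.+1 j)) = coord b' j / coord b' j0].
pose S := [set b' : proj K m | specializes iota v b' (val ab).2 /\ Kpoints2 iota F (a', b')].
have ratio2l b' i : ratio (bipivot i0 j0) (coord2 (a', b')) (lshift m.+1 i) =
    coord a' i / coord a' i0.
  by rewrite /ratio bipivotl !coord2l.
have ratio2r b' j : ratio (bipivot i0 j0) (coord2 (a', b')) (rshift n.+1 j) =
    coord b' j / coord b' j0.
  by rewrite /ratio bipivotr !coord2r.
have pivot2 b' : coord b' j0 != 0 -> forall i, coord2 (a', b') (bipivot i0 j0 i) != 0.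
  move=> b'0 i; case: (split_ordP i) => l ->.
    by rewrite bipivotl coord2l.
  by rewrite bipivotr coord2r.
have S_link b' : S b' -> exists sg, link b' sg.
  move=> [sb' Kb']; have [b'0 rb'] := specializes_ratio triv hj sb'.
  have [|d p hp p0|sg [hs ns]] := kpoint_hom triv (chartF F i0 j0) irrF UF (pivot2 b' b'0).
  - move=> i; case: (split_ordP i) => l ->; rewrite /affc /coordF.
      rewrite ratio2l /ratio bipivotl !coord2l.
      by have [_ sa' _] := ga'; have [_] := specializes_ratio triv hi sa'; apply.
    by rewrite ratio2r /ratio bipivotr !coord2r.
  - rewrite -map_mpoly_meval; apply: (Kb' d) => // y Fy.
    exact: (p0 (SigSub (mem_set Fy))).
  exists sg; split=> //.
    apply: (localization_hom_unique (ev := evD)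
      (s := sg \o stalk_hom hf ab : {rmorphism stalk (pr FD ab) -> K})) => [b|P].
      have [P [Q [Q0 e']]] := evg_frac (chartD D i0) UD b; exists P, Q; split=> //.
      by apply: (near_neq0 triv (ns _)); rewrite residue_stalk_map.
    rewrite sAev.
    apply: (hom_evgE (sigma := sg \o stalk_hom hf ab : {rmorphism stalk (pr FD ab) -> K})) => [c|i]; rewrite -[LHS]/(sg (stalk_hom hf ab _)).
      by rewrite evC hs mmap_const.
    by rewrite evX hs mmapX mmap1U ratio2l.
  split=> // j; by rewrite hs mmapX mmap1U ratio2r.
have link_const b' sg : link b' sg -> forall c, sg (evF c%:MP) = iota c.
  by move=> [hA _ _] c; rewrite -evC hA sAev mmap_const.
have link_X b' sg : link b' sg -> forall i,
    sg (evF 'X_i) = ratio (bipivot i0 j0) (coord2 (a', b')) i.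
  move=> [hA _ [b'0 hb']] i; case: (split_ordP i) => l ->.
    by rewrite -evX hA sAev mmapX mmap1U ratio2l.
  by rewrite hb' ratio2r.
have root_S r : r \in rs -> exists b' sg, [/\ S b', link b' sg & sg th = r].
  move=> /hrs' [sg [hA ns er]].
  have [||b' [sb' b'0 rb']] := specializes_of_ratio (iota := iota) (v := v) hj
      (z := fun j => sg (evF 'X_(rshift n.+1 j))).
  - rewrite -(rmorph1 sg) -(rmorph1 evF); congr (sg _).
    apply/eqP; rewrite -subr_eq0 -rmorphB; apply/eqP; apply: evg_eval0 => y Uy.
    rewrite mevalB mevalXU meval1 /affc /ratio bipivotr divff ?subrr //.
    by have := Uy (rshift n.+1 j0); rewrite bipivotr.
  - move=> j; have := ns (evF 'X_(rshift n.+1 j)); rewrite residue_evg mevalXU.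
    by rewrite /affc /ratio bipivotr /coordF !coord2r.
  have lk : link b' sg by split=> //; split=> // j; rewrite rb'.
  exists b', sg; split=> //; split=> // d f bf f0; rewrite map_mpoly_meval.
  apply: (hom_kpoint (link_const _ _ lk)
    (pivot2 _ b'0) (link_X _ _ lk) bf).
  by move=> y; apply: f0; apply/set_mem/valP.
have link_eq b' c' sg sg' : link b' sg -> link c' sg' -> sg th = sg' th -> b' = c'.
  move=> lk lk' eth; have [hA ns [b'0 rb']] := lk; have [hA' ns' [c'0 rc']] := lk'.
  have E := extension_unique triv gen hA hA' ns eth.
  by apply: (proj_eq_ratio b'0 c'0) => j; rewrite -rb' -rc' E.
have link_fun b' sg sg' : link b' sg -> link b' sg' -> sg =1 sg'.
  move=> lk lk'; have [_ ns _] := lk.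
  apply: (localization_hom_unique (ev := evF)) => [b|P].
    have [P [Q [Q0 e']]] := evg_frac (chartF F i0 j0) UF b; exists P, Q; split=> //.
    exact: (near_neq0 triv (ns _)).
  rewrite (hom_evgE (link_const _ _ lk) (link_X _ _ lk)).
  by rewrite (hom_evgE (link_const _ _ lk') (link_X _ _ lk')).
have ex_index b' : exists i, S b' -> exists2 sg, link b' sg & i = index (sg th) rs.
  have [/S_link [sg lk]|nS] := pselect (S b'); last by exists 0%N => /nS.
  by exists (index (sg th) rs) => _; exists sg.
have [g hg] := choice ex_index.
have link_rs b' sg : link b' sg -> sg th \in rs by case=> hA ns _; apply: hrs.
apply/card_set_bijP; exists g; split.
- move=> b' /hg [sg lk ->]; rewrite /= -size_rs index_mem; exact: link_rs lk.
- move=> b' c' /set_mem/hg [sg lk ->] /set_mem/hg [sg' lk' ->] ei.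
  apply: (link_eq _ _ _ _ lk lk').
  by rewrite -(nth_index 0 (link_rs _ _ lk)) ei nth_index //; apply: link_rs lk'.
- move=> i /= ie; rewrite -size_rs in ie.
  have [b' [sg [Sb' lk er]]] := root_S _ (mem_nth 0 ie).
  exists b' => //; have [sg' lk' ->] := hg b' Sb'.
  by rewrite -(link_fun _ _ _ lk lk') er index_uniq.
Qed.

End Main.

Theorem theorem2p7
  (L : closedFieldType) (charL : [pchar L] =i pred0)
  (K : closedFieldType) (iota : {rmorphism L -> K}) (v : valuation K)
  (hK : nonstandard_extension iota v)
  (n m : nat)
  (D : set (proj_space L n)) (F : set (biproj_space L n m))
  (closedD : zclosed D) (curveD : curve (subspace D))
  (smoothD : forall a : subspace D, nonsingular a)
  (closedF : zclosed F) (curveF : curve (subspace F))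
  (FD : F `<=` [set x | D x.1])
  (finite_pr : finite_morphism (pr FD))
  (surj_pr : forall a : subspace D, exists x : subspace F, pr FD x = a)
  (ab : subspace F) (nonsing_ab : nonsingular ab)
  (a' : proj K n) (ha' : generic_near iota v D (val ab).1 a') :
  (exists e : nat,
     zariski_mult iota v F (val ab) a' e /\ alg_mult (pr_morphism FD) ab e) /\
  (zariski_unramified iota v F (val ab) a' <->
   exists U : set (subspace F),
     [/\ zopen U, U ab & forall x, U x -> etale_at (pr_morphism FD) x]).
Proof.
have triv := ns_trivial_base hK; have irrF := curveF.1.
have locB := stalk_local_domain ab irrF.
have [e [t [u [th [ut uth u0 eu zm]]]]] := local_multiplicity charL triv curveD
  curveF surj_pr finite_pr (smoothD _) nonsing_ab ha'.
have fib := fibre_ideal_uniformizer curveF ut u0 eu.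
have [rth th0 _] := uth; have [rt _ _] := ut.
split.
  exists e; split=> //; rewrite /alg_mult fib.
  exact: (quotient_length_uniformizer locB).
have max_th : @max_ideal L _ ab = multiples th.
  rewrite max_idealE; apply/seteqP; split=> b; first exact: uniformizer_mult uth.
  by move=> [c ->]; rewrite /mkset rmorphM rth mulr0.
have un_e : zariski_unramified iota v F (val ab) a' <-> e = 1%N.
  split=> [z1|e1]; last by move: zm; rewrite e1.
  have : (`I_e #= `I_1)%card by apply: card_eq_trans z1; rewrite card_eq_sym.
  by move/card_eq_II.
rewrite un_e; split=> [e1|[U [_ Uab /(_ ab Uab) [_]]]].
  apply: (etale_locus_open curveD curveF surj_pr smoothD).
  by rewrite fib e1 expr1 max_th.
rewrite fib max_th => eI.
have e0 : e != 0%N.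
  apply: contra_neq u0 => e0; have := residue_stalk_map (pr_morphism FD) t.
  by rewrite -[stalk_map _ _]/(stalk_hom _ _ _) eu e0 expr0 mulr1 rt.
have [c ec] : multiples (th ^+ e) th by rewrite eI; exact: multiples_gen.
case: e e0 {eu zm fib un_e eI} ec => [//|[//|e]] _; rewrite exprSr mulrA -[LHS]mul1r.
move/(local_mulIf locB th0) => /(congr1 (residue ab)).
by rewrite exprS !rmorphM rth mul0r mulr0 rmorph1 => /eqP; rewrite oner_eq0.
Qed.
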